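(* Let $d\ge 1$ be an integer, $\alpha\ge 1$, $0<\delta<1$, $\rho,\mu>0$. There exists $\varepsilon_0=\varepsilon_0(d,\rho,\mu,\alpha,\delta)>0$ such that for every $\varepsilon\in(0,\varepsilon_0)$, every $\omega\in\Omega_{\rho,\mu}$ and every $\alpha$-Hölder monotone function $f\colon\mathbb R\to[-\infty,+\infty)$ there exist a $1$-periodic function $E\colon\mathbb R\to[-\infty,+\infty)$, strictly increasing on $[0,1)$, and a $1$-periodic measurable function $\psi\colon\mathbb R\to\ell^2(\mathbb Z^d)$ such that $H(x)\psi(x)=E(x)\psi(x)$, $\|\psi(x)\|=1$, $|\psi(x;\mathbf 0)-1|<\varepsilon^{1-\delta}$ and $|\psi(x;\mathbf n)|\le\varepsilon^{(1-\delta)|\mathbf n|}$ for $\mathbf n\ne\mathbf 0$, for all $x\in\mathbb R$, and moreover, for every $x\in\mathbb R$ and $\mathbf n\in\mathbb Z^d$, $$H(x)\bigl(T^{\mathbf n}\psi(x-\mathbf n\cdot\omega)\bigr)=E(x-\mathbf n\cdot\omega)\bigl(T^{\mathbf n}\psi(x-\mathbf n\cdot\omega)\bigr).$$ For every $x\in\mathbb R$ the corresponding family $\psi_{\mathbf n}(x):=T^{\mathbf n}\psi(x-\mathbf n\cdot\omega)$, $\mathbf n\in\mathbb Z^d$, is an orthonormal basis of $\ell^2(\mathbb Z^d)$ consisting of eigenvectors of $H(x)$, with eigenvalues $E_{\mathbf n}(x):=E(x-\mathbf n\cdot\omega)$, respectively. In particular, the spectrum of $H(x)$ is pure point and simple,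 with uniformly exponentially localized eigenfunctions (that is, $|\psi_{\mathbf n}(x;\mathbf m)|\le\varepsilon^{(1-\delta)|\mathbf n+\mathbf m|}$ for all $x$ and all $\mathbf m\ne-\mathbf n$).
   Context: Notation. $|\mathbf n|=|n_1|+\dots+|n_d|$ for $\mathbf n\in\mathbb Z^d$; $\{e_{\mathbf n}\}$ is the standard basis of $\ell^2(\mathbb Z^d)$; $\psi(x;\mathbf n)=\langle\psi(x),e_{\mathbf n}\rangle$; $(T^{\mathbf n}\varphi)(\mathbf m)=\varphi(\mathbf n+\mathbf m)$; $\|t\|=\mathrm{dist}(t,\mathbb Z)$ for $t\in\mathbb R$. Monotone functions. A function $f\colon\mathbb R\to[-\infty,+\infty)$ is $\alpha$-Hölder monotone if it is $1$-periodic and $f(y)-f(x)\ge (y-x)^\alpha$ for $0\le x\le y<1$. The value $-\infty$ is allowed only at integer points. Frequencies. $\Omega_{\rho,\mu}=\{\omega\in[0,1)^d:\ \|\mathbf n\cdot\omega\|\ge e^{-\rho|\mathbf n|^{1/(1+\mu)}}\ \text{for all }\mathbf n\in\mathbb Z^d\setminus\{\mathbf 0\}\}$. Operators. On $\ell^2(\mathbb Z^d)$, $(H(x)\psi)(\mathbf n)=\varepsilon(\Delta\psi)(\mathbf n)+f(x+\omega\cdot\mathbf n)\psi(\mathbf n)$, where $(\Delta\psi)(\mathbf n)=\sum_{|\mathbf m-\mathbf n|=1}\psi(\mathbf m)$ (self-adjoint on its natural domain). Infinite values. If $f(0)=-\infty$ and $x+\omega\cdot\mathbf n\in\mathbb Z$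 for some (necessarily unique) $\mathbf n$, then $H(x)$ is understood in the sense of infinite coupling: $e_{\mathbf n}$ is an eigenvector with generalized eigenvalue $-\infty$, and on the orthogonal complement of $e_{\mathbf n}$ the operator acts as the compression of $\varepsilon\Delta+f(x+\omega\cdot)$ to that complement. *)

(* Defs.v *)
From HB Require Import structures.
From mathcomp Require Import all_boot all_order all_algebra.
From mathcomp Require Import complex.
From mathcomp Require Import all_classical all_reals all_analysis.
Set Implicit Arguments.
Unset Strict Implicit.
Unset Printing Implicit Defensive.
Import Order.TTheory GRing.Theory Num.Theory.
Import numFieldNormedType.Exports.
Local Open Scope classical_set_scope.
Local Open Scope ring_scope.
Local Open Scope complex_scope.

Section Lattice.
Context {R : realType} {d : nat}.
Implicit Types (n m : 'rV[int]_d) (w : 'rV[R]_d) (u v : 'rV[int]_d -> R[i]).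

Definition l1 n : nat := (\sum_(i < d) `|n ord0 i|)%N.

Definition idot n w : R := \sum_(i < d) (n ord0 i)%:~R * w ord0 i.

Definition basisv n : 'rV[int]_d -> R[i] := fun m => (m == n)%:R.

Definition l2shift n u : 'rV[int]_d -> R[i] := fun m => u (n + m).

Definition cabs (z : R[i]) : R := Normc.normc z.

Definition sqnorm u : \bar R :=
  (\esum_(n in [set: 'rV[int]_d]) ((cabs (u n)) ^+ 2)%:E)%E.

Definition ell2 : set ('rV[int]_d -> R[i]) := [set u | (sqnorm u < +oo)%E].

Definition l2norm u : R := Num.sqrt (fine (sqnorm u)).

(* Sums of absolutely summable families (junk values otherwise). *)
Definition rsum (a : 'rV[int]_d -> R) : R :=
  fine (\esum_(n in [set: 'rV[int]_d]) ((EFin \o a)^\+ n))%E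
  - fine (\esum_(n in [set: 'rV[int]_d]) ((EFin \o a)^\- n))%E.

Definition csum (a : 'rV[int]_d -> R[i]) : R[i] :=
  rsum (fun n => complex.Re (a n)) +i* rsum (fun n => complex.Im (a n)).

Definition l2dot u v : R[i] := csum (fun n => u n * (v n)^*).

Definition l2open (U : set ('rV[int]_d -> R[i])) : Prop :=
  forall u, ell2 u -> U u -> exists2 r : R, 0 < r &
    forall v, ell2 v -> l2norm (v - u) < r -> U v.

(* Borel measurability with respect to the norm topology of l^2. *)
Definition l2measurable (psi : R -> 'rV[int]_d -> R[i]) : Prop :=
  forall U, l2open U -> measurable (psi @^-1` U : set (measurableTypeR R)).

(* The closed linear span of S is the whole of l^2. *)
Definition l2total (S : set ('rV[int]_d -> R[i])) : Prop :=
  forall u, ell2 u -> forall e : R, 0 < e ->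
    exists (k : nat) (c : 'I_k -> R[i]) (s : 'I_k -> 'rV[int]_d -> R[i]),
      (forall j, ell2 (s j) /\ S (s j)) /\ l2norm (u - \sum_(j < k) c j *: s j) < e.

Definition orthonormal_basis
    (b : 'rV[int]_d -> 'rV[int]_d -> R[i]) : Prop :=
  [/\ forall n, ell2 (b n),
      forall n m, l2dot (b n) (b m) = (n == m)%:R
    & l2total (range b)].

Definition dist_int (t : R) : R := inf [set `|t - k%:~R| | k in [set: int]].

Definition Omega (rho mu : R) : set 'rV[R]_d :=
  [set w : 'rV[R]_d | (forall i, 0 <= w ord0 i < 1) /\
    forall n : 'rV[int]_d, n != 0 ->
      expR (- rho * (l1 n)%:R `^ (1 / (1 + mu))) <= dist_int (idot n w)].

End Lattice.

Section Operator.
Context {R : realType} {d : nat}.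

(* The inequality f(y) - f(x) >= (y - x)^alpha is written additively, so that
   it is meaningful (and true) at x = y = 0 when f(0) = -oo; MathComp-Analysis
   sets -oo - -oo = -oo. *)
Definition holder_monotone (alpha : R) (f : R -> \bar R) : Prop :=
  [/\ forall x, (f x < +oo)%E,
      forall x, f (x + 1) = f x,
      forall x, f x = -oo%E -> exists k : int, x = k%:~R
    & forall x y, 0 <= x -> x <= y -> y < 1 ->
        (f x + ((y - x) `^ alpha)%:E <= f y)%E].

Variables (f : R -> \bar R) (w : 'rV[R]_d) (eps : R) (x : R).
Implicit Types (n m : 'rV[int]_d) (u v : 'rV[int]_d -> R[i]).

Definition laplacian u : 'rV[int]_d -> R[i] :=
  fun n => \sum_(m \in [set m | l1 (m - n) = 1%N]) u m.

Definition potential n : \bar R := f (x + idot n w).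

Definition singular : set 'rV[int]_d := [set n | potential n = -oo%E].

(* The finite part of H(x): it acts on the vectors vanishing at the singular
   site (if any) as the compression of eps * Delta + potential.  With no
   singular site these are H(x) and its natural domain. *)
Definition domH : set ('rV[int]_d -> R[i]) :=
  [set u | [/\ ell2 u, forall n, singular n -> u n = 0
             & ell2 (fun n => (fine (potential n))%:C * u n)]].

Definition opH u : 'rV[int]_d -> R[i] :=
  fun n => if n \in singular then 0
           else eps%:C * laplacian u n + (fine (potential n))%:C * u n.

(* The equation H(x) u = lam u; for lam = -oo it means that u is a multiple of
   e_n, n the singular site. *)
Definition eigeneq (lam : \bar R) u : Prop :=
  match lam with
  | r%:E => domH u /\ opH u = r%:C *: u
  | -oo => exists n (c : R[i]), singular n /\ u = c *: basisv n
  | +oo => False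
  end%E.

Definition eigenvector (lam : \bar R) u : Prop := eigeneq lam u /\ u <> 0.

Definition pure_point : Prop :=
  l2total [set u | exists lam, eigenvector lam u].

Definition simple_spectrum : Prop :=
  forall lam u v, eigenvector lam u -> eigenvector lam v ->
    exists c : R[i], v = c *: u.

End Operator.

(* Main.v *)
Require Import Defs.
From HB Require Import structures.
From mathcomp Require Import all_boot all_order all_algebra.
From mathcomp Require Import complex.
From mathcomp Require Import all_classical all_reals all_analysis.
From mathcomp Require Import zify ring lra.
Set Implicit Arguments.
Unset Strict Implicit.
Unset Printing Implicit Defensive.
Import Order.TTheory GRing.Theory Num.Theory.
Import numFieldNormedType.Exports.
Local Open Scope classical_set_scope.
Local Open Scope ring_scope.
Local Open Scope complex_scope.

(* H(x) is diagonalized by Gaussian elimination in increasing order of scale, where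
   the scale of a site n tells how close its phase x + n.w is to x modulo 1.  The
   Diophantine condition forces the sites not yet eliminated at scale j to be more
   than 2^(j+2) apart, so the exponential decay of the reduced couplings beats the
   pivots, which are only as large as a power of the phase distance.  The sign of a
   pivot is the sign of (phase - x): between two phases z1 < z2 the monotonicity of f
   dominates the change of energy, and a Sylvester-type comparison of quadratic forms
   shows that the number of negative pivots changes only by the sites whose phase
   wraps around an integer.  An energy where the last pivot vanishes gives a finite
   volume eigenvector decaying like eps^((1 - delta)|n|), and comparing two of them
   shows that the energy is strictly increasing in the phase.  Infinite volume (and
   f(0) = -oo) is reached along an ultrafilter.  Eigenvectors with distinct
   eigenvalues are orthogonal by pairing; since each psi_n is l^1-close to a basis
   vector, the family is total, and every bounded solution of the eigenvalue equation
   is a multiple of one of them. *)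

(** * Elimination and comparison of indices *)

(** No continuity of [f] is available: [f] may jump, and only lower bounds for its increments are
    known. Pivots at two phases therefore cannot be compared by perturbation; a comparison of
    quadratic forms needs only inequalities on the diagonal. It does require one common set of sites
    for both phases, hence sets defined by the larger of the two scales of a site. There is also a
    circularity: the sign of a pivot is known only near an energy that is itself the zero of a
    pivot. It is broken by stages. The energy of stage [k] comes with a window of radius [wv k]
    where all pivots of scale at most [k] are controlled; enlarging the volume moves the energy by
    at most [wv k / 8], and the much smaller window of the next stage still fits. The scales follow
    the Diophantine condition at radius [2 ^ j.+2], which gives phase distances of order
    [exp (- aa * b ^ j)] with [b = 2 ^ (1 / (1 + mu)) < 2]. As [b ^ j] is negligible against
    [2 ^ j], the total loss of decay rate converges, and errors exponentially small in [2 ^ j] stay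
    below pivots of order [exp (- alpha * aa * b ^ j)]. *)

Section Elimination.
Context {R : realFieldType} {T : eqType}.
Implicit Types (M : T -> T -> R) (C U : seq T) (u phi : T -> R) (v r : T).

Definition schur M v : T -> T -> R := fun m n => M m n - M m v * M v n / M v v.

Definition elim M C := foldl schur M C.

Definition mvec M U u m : R := \sum_(n <- U) M m n * u n.

Definition quad M U u : R := \sum_(m <- U) u m * mvec M U u m.

Fixpoint pivots (P : T -> R -> Prop) M C : Prop :=
  if C is v :: C' then P v (M v v) /\ pivots P (schur M v) C' else True.

(** The row of [r] is left free: its residual is the pivot of [r] after the elimination of [C]
    ([solves_value]), so a pivot can be studied through a decaying vector. *)
Definition solves M C r phi :=
  [/\ phi r = 1, forall n, n \notin r :: C -> phi n = 0
    & forall m, m \in C -> mvec M (r :: C) phi m = 0].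

Lemma schur_sym M v : (forall m n, M m n = M n m) ->
  forall m n, schur M v m n = schur M v n m.
Proof. by move=> sM m n; rewrite /schur (sM m n) (sM m v) (sM v n) (mulrC (M v m)). Qed.

Lemma pivots_rcons P M C v :
  pivots P M (rcons C v) <-> pivots P M C /\ P v (elim M C v v).
Proof.
elim: C M => [|a C IH] M /=; first by split=> [[]|[]].
by rewrite IH; split=> [[? []]|[[]]].
Qed.

Lemma pivots_impl P Q M C : (forall v F, v \in C -> P v F -> Q v F) ->
  pivots P M C -> pivots Q M C.
Proof.
elim: C M => [//|a C IH] M H /= [HP HC]; split; first by apply: H; rewrite ?mem_head.
by apply: IH => // v F vC; apply: H; rewrite inE vC orbT.
Qed.

Lemma mvec_perm M U U' u m : perm_eq U U' -> mvec M U u m = mvec M U' u m.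
Proof. by move=> p; rewrite /mvec (perm_big _ p). Qed.

Lemma quad_perm M U U' u : perm_eq U U' -> quad M U u = quad M U' u.
Proof.
by move=> p; rewrite /quad (perm_big _ p) /=; apply: eq_bigr => m _; rewrite (mvec_perm _ _ _ p).
Qed.

Lemma solves_perm M C C' r phi : perm_eq C C' -> solves M C r phi -> solves M C' r phi.
Proof.
move=> p [h1 h2 h3]; split=> //.
  by move=> n; rewrite inE -(perm_mem p) => h; apply: h2; rewrite inE.
move=> m; rewrite -(perm_mem p) => mC; rewrite -(h3 _ mC); apply/esym/mvec_perm.
by rewrite perm_cons.
Qed.

(** The equation of row [v] expresses [u v] through the other coordinates; substituting it into
    another row produces the Schur complement. *)
Lemma schur_mvec M v U u m : M v v != 0 -> mvec M (v :: U) u v = 0 ->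
  mvec (schur M v) U u m = mvec M (v :: U) u m.
Proof.
move=> v0; rewrite /mvec !big_cons => /eqP; rewrite addr_eq0 => /eqP e.
have -> : \sum_(n <- U) schur M v m n * u n
   = \sum_(n <- U) M m n * u n - M m v / M v v * \sum_(n <- U) M v n * u n.
  rewrite mulr_sumr -sumrB; apply: eq_bigr => n _; rewrite /schur; field.
  by [].
have -> : \sum_(n <- U) M v n * u n = - (M v v * u v) by rewrite e opprK.
by field.
Qed.

Lemma elim_mvec M C U u m : pivots (fun _ F => F != 0) M C ->
  (forall n, n \in C -> mvec M (C ++ U) u n = 0) ->
  mvec (elim M C) U u m = mvec M (C ++ U) u m.
Proof.
elim: C M => [//|v C IH] M /= [v0 hp] hz.
have hv : mvec M (v :: C ++ U) u v = 0 by apply: hz; rewrite mem_head.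
rewrite IH ?schur_mvec // => n nC; rewrite schur_mvec // hz // inE nC orbT //.
Qed.

(** Since the rows of [C] hold, eliminating them leaves the residual at [r] unchanged. The left side
    does not depend on the order of [C], so the last pivot may be computed in any order of
    elimination with nonzero pivots. *)
Lemma solves_value M C r phi : pivots (fun _ F => F != 0) M C -> solves M C r phi ->
  mvec M (r :: C) phi r = elim M C r r.
Proof.
move=> hp [h1 h2 h3].
have p : perm_eq (r :: C) (C ++ [:: r]) by rewrite cats1 perm_sym perm_rcons.
rewrite (mvec_perm _ _ _ p) -elim_mvec //; first by rewrite /mvec big_seq1 h1 mulr1.
by move=> n nC; rewrite -(mvec_perm _ _ _ p) h3.
Qed.

Lemma eq_mvec M U u u' m : {in U, u =1 u'} -> mvec M U u m = mvec M U u' m.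
Proof. by move=> h; rewrite /mvec !big_seq; apply: eq_bigr => n /h ->. Qed.

Lemma solution_aux M C r : uniq (r :: C) -> pivots (fun _ F => F != 0) M C ->
  exists phi, phi r = 1 /\ forall m, m \in C -> mvec M (rcons C r) phi m = 0.
Proof.
elim: C M => [|v C IH] M; first by move=> _ _; exists (fun _ => 1).
move=> /= /and3P [rvC vC uC] [v0 hp].
move: rvC; rewrite inE negb_or => /andP [rv rC].
have [|phi [hr hphi]] := IH (schur M v) _ hp; first by rewrite /= rC.
pose s := mvec M (rcons C r) phi v.
pose psi := fun n => if n == v then - s / M v v else phi n.
have vr : v \notin rcons C r by rewrite mem_rcons inE negb_or eq_sym rv.
have e : {in rcons C r, psi =1 phi}.
  by move=> n; rewrite /psi; case: eqP => [-> h|//]; rewrite h in vr.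
have hv : mvec M (v :: rcons C r) psi v = 0.
  rewrite /mvec big_cons -/(mvec M (rcons C r) psi v) (eq_mvec _ _ e) -/s /psi eqxx.
  by field.
exists psi; split; first by rewrite /psi (negbTE rv).
move=> m; rewrite inE => /orP [/eqP -> //|mC].
by rewrite -schur_mvec // (eq_mvec _ _ e) hphi.
Qed.

Lemma solution_exists M C r : uniq (r :: C) -> pivots (fun _ F => F != 0) M C ->
  exists phi, solves M C r phi.
Proof.
move=> uC hp; have [phi [hr h]] := solution_aux uC hp.
exists (fun n => if n \in r :: C then phi n else 0); split.
- by rewrite mem_head.
- by move=> n /negbTE ->.
- move=> m mC; rewrite -(h m mC) (@mvec_perm _ _ (rcons C r)).
    by apply: eq_mvec => n; rewrite mem_rcons => ->.
  by rewrite perm_sym perm_rcons.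
Qed.

(** * Weighted row sums and decay of solutions *)

Section Weights.
Variable g : T -> T -> R.
Hypothesis g_ge0 : forall m n, 0 <= g m n.

Fixpoint dominated r M C : Prop :=
  if C is v :: C' then
    [/\ M v v != 0, \sum_(n <- rcons C' r) `|M v n| * g v n <= `|M v v|
      & dominated r (schur M v) C']
  else True.

Lemma dominated_pivots r M C : dominated r M C -> pivots (fun _ F => F != 0) M C.
Proof. by elim: C M => [//|v C IH] M /= [? _ /IH]. Qed.

(** Induction from the end of the elimination: row [v] expresses [phi v] by the coordinates
    eliminated after it, and the weight in the row sum absorbs the growth of [h] from [v] to [n]. *)
Lemma dominated_decay r M C (h : T -> R) phi :
  h r = 1 -> (forall n, 0 <= h n) -> (forall v n, h n <= g v n * h v) ->
  dominated r M C -> (forall m, m \in C -> mvec M (rcons C r) phi m = 0) ->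
  forall n, n \in rcons C r -> `|phi n| <= `|phi r| * h n.
Proof.
move=> hr h0 hg; elim: C M => [|v C IH] M /=.
  by move=> _ _ n; rewrite inE => /eqP ->; rewrite hr mulr1.
move=> [v0 hv hd] hz.
have hzv : mvec M (v :: rcons C r) phi v = 0 by apply: hz; rewrite mem_head.
have {}IH : forall n, n \in rcons C r -> `|phi n| <= `|phi r| * h n.
  apply: IH hd _ => m mC; rewrite schur_mvec //; apply: hz; by rewrite inE mC orbT.
move=> n; rewrite inE => /orP [/eqP ->|]; last exact: IH.
move: hzv; rewrite /mvec big_cons => /eqP; rewrite addr_eq0 => /eqP e.
have v1 : 0 < `|M v v| by rewrite normr_gt0.
rewrite -(ler_pM2l v1) -normrM e normrN.
apply: le_trans (ler_norm_sum _ _ _) _.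
apply: (@le_trans _ _ (\sum_(i <- rcons C r) (`|M v i| * g v i) * (`|phi r| * h v))).
  rewrite !big_seq; apply: ler_sum => i /IH hi; rewrite normrM -mulrA ler_wpM2l //.
  apply: le_trans hi _; rewrite mulrCA ler_wpM2l //.
by rewrite -mulr_suml ler_wpM2r // mulr_ge0.
Qed.

Hypothesis g_mul : forall m v n, g m n <= g m v * g v n.

Definition rowsum M U m : R := \sum_(n <- U | n != m) `|M m n| * g m n.

(** The weight is submultiplicative and the weighted row of [v] is at most its pivot, so the
    corrections added to row [m] sum to at most the weighted entry of [M m v]. This is exactly the
    term that row [m] loses when [v] is removed. *)
Lemma rowsum_schur M v U (b : R) m : uniq (v :: U) -> 0 < b -> b <= `|M v v| ->
  rowsum M (v :: U) v <= b -> m \in U -> rowsum (schur M v) U m <= rowsum M (v :: U) m.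
Proof.
move=> /= /andP [vU uU] b0 bv hv mU.
have vm : v != m by apply: contraNneq vU => ->.
have v1 : 0 < `|M v v| by apply: lt_le_trans bv.
rewrite {2}/rowsum big_cons vm.
have -> : \sum_(j <- U | j != m) `|M m j| * g m j = rowsum M U m by [].
apply: (@le_trans _ _ (\sum_(n <- U | n != m)
   (`|M m n| * g m n + `|M m v| * g m v / `|M v v| * (`|M v n| * g v n)))).
  apply: ler_sum => n _; rewrite /schur.
  apply: (@le_trans _ _ ((`|M m n| + `|M m v| * `|M v n| / `|M v v|) * g m n)).
    rewrite ler_wpM2r // (le_trans (ler_normB _ _)) // !normrM normfV //.
  rewrite mulrDl lerD2l.
  have -> : `|M m v| * g m v / `|M v v| * (`|M v n| * g v n) =
    `|M m v| * `|M v n| / `|M v v| * (g m v * g v n) by field; rewrite gt_eqF.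
  by rewrite ler_wpM2l // divr_ge0 // mulr_ge0.
rewrite big_split /= [leLHS]addrC lerD2r -mulr_sumr -[leLHS]mulrA ler_piMr //.
  by rewrite mulr_ge0.
rewrite mulrC ler_pdivrMr // mul1r.
apply: le_trans bv; apply: le_trans hv.
rewrite /rowsum big_cons eqxx /=.
have -> : \sum_(j <- U | j != v) `|M v j| * g v j = \sum_(j <- U) `|M v j| * g v j.
  rewrite big_seq_cond [RHS]big_seq_cond; apply: eq_bigl => n.
  by case nU: (n \in U) => //=; apply: contraNneq vU => <-.
by rewrite big_mkcond; apply: ler_sum => n _; case: ifP => // _; rewrite mulr_ge0.
Qed.

End Weights.

(* The pivots of the elimination paired with the corresponding linear forms,
   so that the quadratic form of M is the sum of (form)^2 / pivot. *)
Fixpoint ldl r M C : seq (R * (T -> R)) :=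
  if C is v :: C' then
    (M v v, fun n => if n \in v :: rcons C' r then M v n else 0) :: ldl r (schur M v) C'
  else [::].

Definition form U (c : T -> R) u : R := \sum_(n <- U) c n * u n.

Lemma form_rest M (v : T) (L : seq T) U u : uniq U -> uniq L -> {subset L <= U} ->
  form U (fun n => if n \in L then M v n else 0) u = mvec M L u v.
Proof.
move=> uU uL LU; rewrite /form /mvec.
have p : perm_eq [seq n <- U | n \in L] L.
  apply: uniq_perm; rewrite ?filter_uniq // => n; rewrite mem_filter.
  by case nL: (n \in L) => //=; apply: LU.
rewrite -[RHS](perm_big _ p) /= big_filter [RHS]big_mkcond; apply: eq_bigr => n _.
by case: ifP; rewrite ?mul0r.
Qed.

Lemma quad_cons M v U u : (forall m n, M m n = M n m) -> M v v != 0 ->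
  quad M (v :: U) u = mvec M (v :: U) u v ^+ 2 / M v v + quad (schur M v) U u.
Proof.
move=> sM v0; set s := \sum_(n <- U) M v n * u n.
have e1 : mvec M (v :: U) u v = M v v * u v + s by rewrite /mvec big_cons.
have e2 : quad (schur M v) U u = \sum_(m <- U) u m * mvec M U u m - s ^+ 2 / M v v.
  have -> : s ^+ 2 / M v v = \sum_(m <- U) (M v m * u m) * (s / M v v).
    by rewrite -mulr_suml expr2 mulrA.
  rewrite -sumrB; apply: eq_bigr => m _.
  rewrite /mvec.
  have -> : \sum_(n <- U) schur M v m n * u n
     = \sum_(n <- U) M m n * u n - M m v / M v v * s.
    rewrite mulr_sumr -sumrB; apply: eq_bigr => n _; rewrite /schur; by field.
  rewrite (sM m v); by field.
have e3 : quad M (v :: U) u =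
   u v * (M v v * u v + s) + (s * u v + \sum_(m <- U) u m * mvec M U u m).
  rewrite /quad big_cons e1; congr (_ + _).
  rewrite /s mulr_suml -big_split; apply: eq_bigr => m _ /=.
  rewrite /mvec big_cons (sM m v); ring.
rewrite e3 e2 e1; by field.
Qed.

Lemma quad_ldl r M C U u : uniq U -> uniq (rcons C r) -> {subset rcons C r <= U} ->
  (forall m n, M m n = M n m) -> pivots (fun _ F => F != 0) M C ->
  quad M (rcons C r) u =
    \sum_(p <- ldl r M C) form U p.2 u ^+ 2 / p.1 + elim M C r r * u r ^+ 2.
Proof.
move=> uU; elim: C M => [|v C IH] M.
  by move=> _ _ _ _; rewrite /quad big_seq1 /mvec big_seq1 /= big_nil add0r; ring.
rewrite rcons_cons => uC sub sM [v0 hp]; rewrite quad_cons //= big_cons /=.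
rewrite -addrA -IH //.
- by rewrite form_rest.
- by move: uC => /= /andP [].
- by move=> n nC; apply: sub; rewrite inE nC orbT.
- exact: schur_sym.
Qed.

(** The forms are a triangular system with the pivots on its diagonal, solved backwards from [r]. *)
Lemma ldl_inj r M C U u : uniq U -> uniq (rcons C r) -> {subset rcons C r <= U} ->
  pivots (fun _ F => F != 0) M C -> u r = 0 ->
  (forall p, List.In p (ldl r M C) -> form U p.2 u = 0) ->
  forall n, n \in rcons C r -> u n = 0.
Proof.
move=> uU; elim: C M => [|v C IH] M.
  by move=> _ _ _ ur _ n; rewrite inE => /eqP ->.
rewrite rcons_cons => uC sub [v0 hp] ur hf.
have {}IH : forall n, n \in rcons C r -> u n = 0.
  apply: (IH (schur M v)) => //.
  - by move: uC => /= /andP [].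
  - by move=> n nC; apply: sub; rewrite inE nC orbT.
  - by move=> p hp'; apply: hf; right.
move=> n; rewrite inE => /orP [/eqP ->|]; last exact: IH.
have := hf _ (or_introl erefl); rewrite /= form_rest // /mvec big_cons big_seq big1.
  by rewrite addr0 => /eqP; rewrite mulf_eq0 (negbTE v0) /= => /eqP.
by move=> i /IH ->; rewrite mulr0.
Qed.

Lemma kernel_forms (cs : seq (T -> R)) U : uniq U -> (size cs < size U)%N ->
  exists u, (exists2 n, n \in U & u n != 0) /\
    forall c, List.In c cs -> form U c u = 0.
Proof.
move=> uU hs.
pose A := \matrix_(i < size U, j < size cs)
  (nth (fun _ => 0) cs j (tnth (in_tuple U) i)).
have : kermx A != 0.
  apply/negP => /eqP k0; have := mxrank_ker A; rewrite k0 mxrank0 => /esym/eqP.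
  by rewrite subn_eq0 leqNgt (leq_ltn_trans (rank_leq_col A) hs).
case/rowV0Pn => w /sub_kermxP wA w0.
have /existsP [i0 wi0] : [exists i, w 0 i != 0].
  apply: contraT; rewrite negb_exists => /forallP h.
  case/negP: w0; apply/eqP/rowP => i; rewrite mxE; apply/eqP; by move: (h i); rewrite negbK.
pose u n := if insub (index n U) is Some i then w 0 i else 0.
have ui (i : 'I_(size U)) : u (tnth (in_tuple U) i) = w 0 i.
  rewrite /u (tnth_nth (tnth (in_tuple U) i)) /= index_uniq //.
  by rewrite insubT //= => h; congr (w 0 _); apply: val_inj.
exists u; split; first by exists (tnth (in_tuple U) i0); rewrite ?mem_tnth ?ui.
move=> c hc.
have [j hj] : exists j : 'I_(size cs), nth (fun _ => 0) cs j = c.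
  elim: cs hc {hs A wA} => [//|a cs IH] /= [->|/IH [j <-]]; first by exists ord0.
  by exists (lift ord0 j).
have := congr1 (fun B : 'rV_ _ => B 0 j) wA; rewrite !mxE => <-.
rewrite /form big_tnth; apply: eq_bigr => i _.
by rewrite ui mxE hj mulrC.
Qed.

Definition pivot_sign (neg : pred T) v (F : R) := if neg v then F < 0 else 0 < F.

Lemma pivot_sign_neq0 neg M C : pivots (pivot_sign neg) M C -> pivots (fun _ F => F != 0) M C.
Proof.
apply: pivots_impl => v F _; rewrite /pivot_sign.
by rewrite neq_lt; case: ifP => _ ->; rewrite ?orbT.
Qed.

Lemma count_ldl neg r M C : pivots (pivot_sign neg) M C ->
  count (fun p => p.1 < 0) (ldl r M C) = count neg C /\
  count (fun p => 0 < p.1) (ldl r M C) = count (predC neg) C.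
Proof.
elim: C M => [//|v C IH] M /= [hv /IH [-> ->]].
by move: hv; rewrite /pivot_sign; case: (neg v) => h; rewrite h ltNge (ltW h).
Qed.

Lemma ldl_sign neg r M C p : pivots (pivot_sign neg) M C -> List.In p (ldl r M C) -> p.1 != 0.
Proof.
elim: C M => [//|v C IH] M /= [hv hp] [<-/=|]; last exact: IH hp.
by move: hv; rewrite /pivot_sign neq_lt; case: (neg v) => ->; rewrite ?orbT.
Qed.

Lemma in_filter_map (a : pred (R * (T -> R))) (s : seq (R * (T -> R))) p :
  List.In p s -> a p -> List.In p.2 [seq q.2 | q <- s & a q].
Proof.
elim: s => [//|q s IH] /= [->|/IH h] ap; first by rewrite ap; left.
by case: ifP => _ /=; [right|]; apply: h.
Qed.

Lemma In_cat (A : Type) (x : A) s t : List.In x s \/ List.In x t -> List.In x (s ++ t).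
Proof.
elim: s => [|a s IH] /=; first by case.
by case=> [[->|h]|h]; [left|right; apply: IH; left|right; apply: IH; right].
Qed.

Lemma sum_In_ge0 (A : Type) (s : seq A) (F : A -> R) :
  (forall p, List.In p s -> 0 <= F p) -> 0 <= \sum_(p <- s) F p.
Proof.
elim: s => [|a s IH] h; rewrite ?big_nil // big_cons addr_ge0 //; first by apply: h; left.
by apply: IH => p hp; apply: h; right.
Qed.

Lemma sum_In_eq0 (A : Type) (s : seq A) (F : A -> R) :
  (forall p, List.In p s -> F p <= 0) -> 0 <= \sum_(p <- s) F p ->
  forall p, List.In p s -> F p = 0.
Proof.
elim: s => [//|a s IH] h; rewrite big_cons => h0.
have ha : F a <= 0 by apply: h; left.
have hs : \sum_(p <- s) F p <= 0.
  rewrite -oppr_ge0 -sumrN; apply: sum_In_ge0 => p hp; rewrite oppr_ge0; apply: h; by right.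
move=> p [<-|hp]; first by lra.
by apply: (IH _ _ p hp) => [q hq|]; [apply: h; right|lra].
Qed.

(* Sylvester-type comparison: a common zero of the forms with negative pivots
   of M, of those with positive pivots of M', and of the coordinates in X
   would contradict the inequality between the quadratic forms. *)
Lemma index_comparison M M' C C' r (X : seq T) (neg neg' : pred T) :
  uniq (rcons C r) -> perm_eq C C' ->
  (forall m n, M m n = M n m) -> (forall m n, M' m n = M' n m) ->
  (forall m n, m != n -> M m n = M' m n) ->
  (forall n, n \in rcons C r -> n \notin X -> M n n <= M' n n) ->
  pivots (pivot_sign neg) M C -> pivots (pivot_sign neg') M' C' ->
  (count neg C + size X <= count neg' C)%N ->
  0 <= elim M C r r -> 0 <= elim M' C' r r.
Proof.
move=> uC pC sM sM' offd hd hp hp' hcount h0; rewrite leNgt; apply/negP => h0'.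
pose U := rcons C r.
have pU : perm_eq U (rcons C' r).
  by rewrite perm_rcons perm_sym perm_rcons perm_cons perm_sym.
have uC' : uniq (rcons C' r) by rewrite -(perm_uniq pU).
pose s1 := [seq p.2 | p <- ldl r M C & p.1 < 0].
pose s2 := [seq p.2 | p <- ldl r M' C' & 0 < p.1].
pose s3 := [seq (fun n : T => (n == x)%:R : R) | x <- X].
have [c1 c1'] := count_ldl r hp; have [c2 c2'] := count_ldl r hp'.
(* The forms number [count neg C] for the negative pivots of [M], [count (predC neg') C] for the
   positive pivots of [M'], and [size X]: at most [size C] conditions on [size C + 1] unknowns. *)
have sz : (size (s1 ++ s2 ++ s3) < size U)%N.
  rewrite !size_cat !size_map !size_filter c1 c2' -(permP pC) /U size_rcons ltnS.
  by rewrite -(count_predC neg' C) addnA addnAC leq_add2r.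
have [u [[n0 n0U u0] hu]] := kernel_forms uC sz.
have h1 : 0 <= quad M U u.
  rewrite (quad_ldl (U := U) u uC) //; last exact: pivot_sign_neq0 hp.
  apply: addr_ge0; last exact: mulr_ge0 h0 (sqr_ge0 _).
  apply: sum_In_ge0 => p hpi; have := ldl_sign hp hpi; rewrite neq_lt => /orP [hn|hn].
    rewrite hu ?expr0n ?mul0r //; apply: In_cat; left; exact: (@in_filter_map (fun p => p.1 < 0)).
  by rewrite divr_ge0 ?sqr_ge0 // ltW.
have e2 : quad M' U u = \sum_(p <- ldl r M' C') form U p.2 u ^+ 2 / p.1
    + elim M' C' r r * u r ^+ 2.
  rewrite (quad_perm _ _ pU) (quad_ldl (U := U) u uC) //; last exact: pivot_sign_neq0 hp'.
  by move=> n; rewrite (perm_mem pU).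
have h2 : quad M U u <= quad M' U u.
  rewrite /quad !big_seq; apply: ler_sum => m mU.
  rewrite -subr_ge0 -mulrBr /mvec -sumrB (bigD1_seq m) //= big1; last first.
    by move=> n nm; rewrite offd 1?eq_sym // subrr.
  rewrite addr0 -mulrBl mulrCA.
  case mX : (m \in X); last by rewrite mulr_ge0 -?expr2 ?sqr_ge0 // subr_ge0 hd ?mX.
  suff -> : u m = 0 by rewrite !mulr0.
  have /hu : List.In (fun n : T => (n == m)%:R : R) (s1 ++ s2 ++ s3).
    apply: In_cat; right; apply: In_cat; right; rewrite /s3.
    elim: X mX {hd hcount s3 sz hu} => [//|a X IH] /=.
    by rewrite inE => /orP [/eqP ->|/IH]; [left|right].
  rewrite /form (bigD1_seq m) //= big1 ?addr0 ?eqxx ?mul1r // => i /negbTE ->.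
  by rewrite mul0r.
have le0 p : List.In p (ldl r M' C') -> form U p.2 u ^+ 2 / p.1 <= 0.
  move=> hpi; have := ldl_sign hp' hpi; rewrite neq_lt => /orP [hn|hn].
    by rewrite mulr_ge0_le0 ?sqr_ge0 // invr_le0 ltW.
  rewrite hu ?expr0n ?mul0r //; apply: In_cat; right; apply: In_cat; left.
  exact: (@in_filter_map (fun p => 0 < p.1)).
have s0 : 0 <= - \sum_(p <- ldl r M' C') form U p.2 u ^+ 2 / p.1.
  by rewrite -sumrN; apply: sum_In_ge0 => p /le0; rewrite oppr_ge0.
have t0 : elim M' C' r r * u r ^+ 2 <= 0 by rewrite mulr_le0_ge0 ?sqr_ge0 // ltW.
(* A nonnegative number is now a sum of nonpositive terms, so each term vanishes; the forms together
   with the coordinate at [r] then force [u = 0]. *)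
have q0 := le_trans h1 h2; rewrite e2 in q0.
have ur : u r = 0.
  have /eqP : elim M' C' r r * u r ^+ 2 = 0 by lra.
  by rewrite mulf_eq0 (lt_eqF h0') /= sqrf_eq0 => /eqP.
case/negP: u0; apply/eqP.
apply: (@ldl_inj r M' C' U u) => //.
- by move=> n; rewrite (perm_mem pU).
- exact: pivot_sign_neq0 hp'.
- move=> p hpi; have := sum_In_eq0 le0 _ hpi => /(_ ltac:(lra)) /eqP.
  rewrite mulf_eq0 invr_eq0 (negbTE (ldl_sign hp' hpi)) orbF sqrf_eq0 => /eqP //.
- by rewrite -(perm_mem pU).
Qed.

(** * Elimination ordered by scale *)

Section Scales.
Variables (g : nat -> T -> T -> R) (ginf : T -> T -> R) (b : nat -> R) (s : T -> nat).
Hypothesis g_ge0 : forall j m n, 0 <= g j m n.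
Hypothesis g_mul : forall j m v n, g j m n <= g j m v * g j v n.
Hypothesis ginf_le : forall j m n, ginf m n <= g j m n.
Hypothesis b_gt0 : forall j, 0 < b j.

Lemma rowsum_raise M (L : seq T) i j m :
  (forall n p k, n \in L -> p \in L -> n != p -> (k < s n)%N -> (k < s p)%N ->
     b k * g k.+1 n p <= b k.+1 * g k n p) ->
  (i <= j)%N -> (forall n, n \in L -> (j <= s n)%N) -> m \in L ->
  rowsum (g i) M L m <= b i -> rowsum (g j) M L m <= b j.
Proof.
move=> hsep /subnK <-; move: (j - i)%N => k {j}.
elim: k => [//|k IH] hs mL h0; rewrite addSn.
have {}IH : rowsum (g (k + i)) M L m <= b (k + i)%N.
  by apply: IH => // n /hs; rewrite addSn => /ltnW.
rewrite -(ler_pM2l (b_gt0 (k + i))).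
apply: le_trans (_ : _ <= b (k + i).+1 * rowsum (g (k + i)) M L m) _.
  rewrite /rowsum !mulr_sumr !(big_seq_cond (fun n => n != m)); apply: ler_sum => n /andP [nL nm].
  rewrite mulrCA [leRHS]mulrCA ler_wpM2l //; apply: hsep => //; last exact: hs.
    by rewrite eq_sym.
  exact: hs.
by rewrite mulrC ler_wpM2r // ltW.
Qed.

(** Invariant: before each pivot all weighted row sums are at most the bound [b] of its scale.
    [rowsum_raise] adapts the weight when the scale grows, and by [rowsum_schur] an elimination step
    does not increase the row sums. The weight [ginf] lies below all the others, so the final decay
    rate is the same at every scale. *)
Lemma dominated_scales r M C j :
  (forall n p k, n \in rcons C r -> p \in rcons C r -> n != p ->
     (k < s n)%N -> (k < s p)%N -> b k * g k.+1 n p <= b k.+1 * g k n p) ->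
  uniq (rcons C r) -> sorted (fun m n => (s m <= s n)%N) (rcons C r) ->
  (forall n, n \in rcons C r -> (j <= s n)%N) ->
  (forall m, m \in rcons C r -> rowsum (g j) M (rcons C r) m <= b j) ->
  pivots (fun v F => b (s v) <= `|F|) M C -> dominated ginf r M C.
Proof.
elim: C M j => [//|v C IH] M j hsep; rewrite !rcons_cons => uL sL hj hrow /= [hv hp].
have tr : transitive (fun m n => (s m <= s n)%N) by move=> a c e; apply: leq_trans.
have hsv n : n \in v :: rcons C r -> (s v <= s n)%N.
  by rewrite inE => /orP [/eqP -> //|]; move: sL => /=; rewrite path_sortedE // => /andP [/allP h _] /h.
have {}hrow m : m \in v :: rcons C r -> rowsum (g (s v)) M (v :: rcons C r) m <= b (s v).
  by move=> mL; apply: (@rowsum_raise _ _ j) => //; rewrite ?hj ?mem_head ?hrow.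
have [vC uC] : v \notin rcons C r /\ uniq (rcons C r) by apply/andP; move: uL.
split; first by rewrite -normr_gt0 (lt_le_trans _ hv).
  apply: le_trans hv; apply: le_trans (hrow v (mem_head _ _)).
  rewrite /rowsum big_cons eqxx /=.
  have -> : \sum_(n <- rcons C r | n != v) `|M v n| * g (s v) v n
     = \sum_(n <- rcons C r) `|M v n| * g (s v) v n.
    rewrite big_seq_cond [RHS]big_seq_cond; apply: eq_bigl => n.
    by case nC : (n \in rcons C r) => //=; apply: contraNneq vC => <-.
  by apply: ler_sum => n _; rewrite ler_wpM2l.
apply: (IH _ (s v)) => //.
- by move=> n p k nC pC; apply: hsep; rewrite rcons_cons inE ?nC ?pC orbT.
- by move: sL => /= /path_sorted.
- by move=> n nC; apply: hsv; rewrite inE nC orbT.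
- move=> m mC; apply: le_trans (hrow m _); last by rewrite inE mC orbT.
  apply: (@rowsum_schur (g (s v)) _ _ M v (rcons C r) (b (s v))) => //.
  by apply: hrow; rewrite mem_head.
Qed.

End Scales.

End Elimination.

(** * The lattice *)

Section LatticeNorm.
Context {d : nat}.
Local Notation T := 'rV[int]_d.
Implicit Types (m n p : T).

Lemma l1_eq0 n : (l1 n == 0)%N = (n == 0).
Proof.
rewrite /l1 sum_nat_eq0; apply/forallP/eqP => [h|-> i]; last by rewrite mxE.
by apply/rowP => i; rewrite mxE; apply/eqP; rewrite -absz_eq0; exact: h i.
Qed.

Lemma l1_0 : l1 (0 : T) = 0%N.
Proof. by apply/eqP; rewrite l1_eq0. Qed.

Lemma l1_gt0 n : (0 < l1 n)%N = (n != 0).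
Proof. by rewrite lt0n l1_eq0. Qed.

Lemma l1N n : l1 (- n) = l1 n.
Proof. by apply: eq_bigr => i _; rewrite mxE abszN. Qed.

Lemma l1B m n : l1 (m - n) = l1 (n - m).
Proof. by rewrite -l1N opprB. Qed.

Lemma l1D m n : (l1 (m + n) <= l1 m + l1 n)%N.
Proof.
rewrite /l1 -big_split /=; apply: leq_sum => i _; rewrite mxE.
by move: (m ord0 i) (n ord0 i) => a b; lia.
Qed.

Lemma l1_triangle m n p : (l1 (m - p) <= l1 (m - n) + l1 (n - p))%N.
Proof. by rewrite -{1}(subrK n m) -addrA l1D. Qed.

Definition unitv (i : 'I_d) : T := delta_mx 0 i.

Definition nbrs n : seq T :=
  [seq n + unitv i | i <- enum 'I_d] ++ [seq n - unitv i | i <- enum 'I_d].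

Lemma size_nbrs n : size (nbrs n) = (2 * d)%N.
Proof.
have h (g : 'I_d -> T) : size [seq g i | i <- enum 'I_d] = d.
  by rewrite size_map size_enum_ord.
by rewrite /nbrs size_cat !h addnn mul2n.
Qed.

Lemma absz_split (z : int) : z != 0 ->
  (absz (z - 1)).+1 = absz z \/ (absz (z + 1)).+1 = absz z.
Proof. lia. Qed.

Lemma l1_pred n : n != 0 -> exists m, n \in nbrs m /\ l1 n = (l1 m).+1.
Proof.
move=> n0; have /existsP [i hi] : [exists i, n ord0 i != 0].
  apply: contraT; rewrite negb_exists => /forallP h; case/negP: n0; apply/eqP/rowP => i.
  by rewrite mxE; apply/eqP; move: (h i); rewrite negbK.
have key (m : T) : (forall j, j != i -> m ord0 j = n ord0 j) -> (`|m ord0 i|.+1 = `|n ord0 i|)%N ->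
   l1 n = (l1 m).+1.
  move=> h1 h2; rewrite /l1 (bigD1 i) //= [in RHS](bigD1 i) //= -h2 addSn; congr (_ + _).+1.
  by apply: eq_bigr => j /h1 ->.
have [e|e] := absz_split hi.
  exists (n - unitv i); split.
    by rewrite mem_cat; apply/orP; left; apply/mapP; exists i; rewrite ?mem_enum // subrK.
  apply: key => [j ji|]; rewrite !mxE eqxx ?(negbTE ji) //= ?subr0 //; by rewrite -e eqxx.
exists (n + unitv i); split.
  rewrite mem_cat; apply/orP; right; apply/mapP; exists i; rewrite ?mem_enum // addrK //.
apply: key => [j ji|]; rewrite !mxE eqxx ?(negbTE ji) //= ?addr0 // -e eqxx //.
Qed.

Lemma nbrsP m n : (n \in nbrs m) = (l1 (n - m) == 1)%N.
Proof.
apply/idP/eqP => [|h].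
  have h i : l1 (unitv i) = 1%N.
    rewrite /l1 (bigD1 i) //= big1 => [|j ji]; rewrite !mxE eqxx /=; last by rewrite (negbTE ji).
    by rewrite ?eqxx ?addn0.
  rewrite mem_cat => /orP [] /mapP [i _ ->]; first by rewrite addrC addKr h.
  by rewrite addrC addKr l1N h.
have n0 : n - m != 0 by rewrite -l1_gt0 h.
have [p [hp hl]] := l1_pred n0.
have p0 : p = 0 by apply/eqP; rewrite -l1_eq0; move: hl; rewrite h => -[<-].
move: hp; rewrite p0 !mem_cat => /orP [] /mapP [i hi]; rewrite ?add0r ?sub0r => e.
  by apply/orP; left; apply/mapP; exists i => //; rewrite -e addrC subrK.
by apply/orP; right; apply/mapP; exists i => //; rewrite -e addrC subrK.
Qed.

(** Endpoints of all walks of [k] steps from the origin, with repetitions. The list contains all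
    sites of norm [k], and its size is exactly [(2 * d) ^ k], which is enough for geometric sums. *)
Fixpoint sphere (k : nat) : seq T :=
  if k is k'.+1 then flatten [seq nbrs n | n <- sphere k'] else [:: 0].

Definition ball (k : nat) : seq T := undup (flatten [seq sphere j | j <- iota 0 k.+1]).

Lemma mem_sphere n : n \in sphere (l1 n).
Proof.
move e : (l1 n) => k; elim: k n e => [|k IH] n e /=.
  by rewrite inE -l1_eq0 e.
have [m [nm]] : exists m, n \in nbrs m /\ l1 n = (l1 m).+1.
  by apply: l1_pred; rewrite -l1_gt0 e.
rewrite e => -[/esym/IH mk]; apply/flattenP; exists (nbrs m) => //; exact: map_f.
Qed.

Lemma sphere_l1 k n : n \in sphere k -> (l1 n <= k)%N.
Proof.
elim: k n => [|k IH] n /=; first by rewrite inE => /eqP ->; rewrite l1_0.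
case/flattenP => s /mapP [m /IH mk ->]; rewrite nbrsP => /eqP h.
by rewrite -(subrK m n) (leq_trans (l1D _ _)) // h add1n ltnS.
Qed.

Lemma size_sphere k : size (sphere k) = ((2 * d) ^ k)%N.
Proof.
elim: k => [//|k IH] /=; rewrite size_flatten /shape -map_comp sumnE big_map.
rewrite (eq_bigr (fun=> (2 * d)%N)) => [|m _]; last exact: size_nbrs.
by rewrite big_const_seq count_predT iter_addn_0 IH expnS.
Qed.

Lemma mem_ball k n : (n \in ball k) = (l1 n <= k)%N.
Proof.
rewrite mem_undup; apply/flattenP/idP => [[s /mapP [j]]|h].
  by rewrite mem_iota add0n ltnS => /= jk -> /sphere_l1 h; apply: leq_trans jk.
by exists (sphere (l1 n)); rewrite ?mem_sphere //; apply: map_f; rewrite mem_iota.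
Qed.

Lemma ball_uniq k : uniq (ball k). Proof. exact: undup_uniq. Qed.

End LatticeNorm.

Lemma ler_sum_sub (R : realDomainType) (I : eqType) (U L : seq I) (F : I -> R) :
  (forall i, 0 <= F i) -> uniq U -> {subset U <= L} ->
  \sum_(i <- U) F i <= \sum_(i <- L) F i.
Proof.
move=> F0; elim: U L => [|x U IH] L.
  by move=> _ _; rewrite big_nil; apply: sumr_ge0.
move=> /= /andP [xU uU] sub; have xL : x \in L by apply: sub; rewrite mem_head.
rewrite (perm_big _ (perm_to_rem xL)) !big_cons lerD2l; apply: IH => // y yU.
have yL : y \in L by apply: sub; rewrite inE yU orbT.
have := perm_mem (perm_to_rem xL) y; rewrite yL inE => /esym.
by case: eqP => [yx|//]; rewrite -yx yU in xU.
Qed.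

Lemma geometric_sum_le (R : realFieldType) (q : R) k :
  0 <= q -> q <= 1 / 2 -> \sum_(0 <= j < k) q ^+ j <= 2.
Proof.
move=> q0 q1; elim: k => [|k IH]; first by rewrite big_geq.
rewrite big_nat_recl // expr0.
under eq_bigr do rewrite exprS.
rewrite -mulr_sumr.
have h0 : 0 <= \sum_(0 <= i < k) q ^+ i by apply: sumr_ge0 => i _; rewrite exprn_ge0.
by nra.
Qed.

Section LatticeSums.
Context {R : realFieldType} {d : nat}.
Local Notation T := 'rV[int]_d.

Lemma lattice_sum_le (q : R) (U : seq T) : 0 <= q -> q *+ (4 * d) <= 1 -> uniq U ->
  \sum_(n <- U | n != 0) q ^+ l1 n <= q *+ (4 * d).
Proof.
move=> q0 q1 uU.
pose K := \max_(n <- U) l1 n.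
have hK n : n \in U -> (l1 n <= K)%N by move=> nU; exact: (@leq_bigmax_seq _ _ xpredT (@l1 d) n nU isT).
have r0 : 0 <= q *+ (2 * d) by rewrite mulrn_wge0.
have r1 : q *+ (2 * d) <= 1 / 2.
  have e : q *+ (4 * d) = 2 * (q *+ (2 * d)) by rewrite -mulr_natl -[q *+ _]mulr_natl !natrM; ring.
  lra.
have e j : \sum_(n <- @sphere d j.+1) q ^+ j.+1 = q *+ (2 * d) * (q *+ (2 * d)) ^+ j :> R.
  rewrite big_const_seq count_predT size_sphere iter_addr_0.
  by rewrite -exprS exprMn_n.
apply: (@le_trans _ _ (\sum_(0 <= j < K) \sum_(n <- @sphere d j.+1) q ^+ j.+1)).
  have -> : \sum_(0 <= j < K) \sum_(n <- @sphere d j.+1) q ^+ j.+1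
     = \sum_(jn <- [seq (j, n) | j <- index_iota 0 K, n <- @sphere d j.+1]) q ^+ (jn.1).+1.
    by rewrite big_allpairs_dep.
  rewrite -big_filter.
  (* Tagging each site with its norm minus one embeds [U] into the list of pairs, although the lists
     [sphere] overlap; the tag [j] stands for the norm [j.+1], since 0 is excluded. *)
  have -> : \sum_(n <- [seq n <- U | n != 0]) q ^+ l1 n =
      \sum_(jn <- [seq ((l1 n).-1, n) | n <- [seq n <- U | n != 0]]) q ^+ (jn.1).+1.
    rewrite big_map !big_filter; apply: eq_bigr => n n0 /=.
    by rewrite prednK // l1_gt0.
  apply: ler_sum_sub.
  - by move=> i; rewrite exprn_ge0.
  - by rewrite map_inj_uniq ?filter_uniq // => a b [].
  - move=> jn /mapP [n]; rewrite mem_filter => /andP [n0 nU] ->.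
    apply/allpairsPdep; exists (l1 n).-1, n; split=> //.
      by rewrite mem_index_iota prednK ?l1_gt0 // hK.
    by rewrite prednK ?l1_gt0 // mem_sphere.
under eq_bigr do rewrite e.
rewrite -mulr_sumr; apply: le_trans (ler_wpM2l r0 (geometric_sum_le _ r0 r1)) _.
by rewrite mulr_natr -mulrnA mulnAC.
Qed.

Lemma count_nbrs (U : seq T) m : uniq U ->
  \sum_(n <- U) (l1 (m - n) == 1)%N%:R <= (2 * d)%:R :> R.
Proof.
move=> uU; have -> : \sum_(n <- U) (l1 (m - n) == 1)%N%:R =
   \sum_(n <- [seq n <- U | n \in nbrs m]) 1 :> R.
  rewrite big_filter [RHS]big_mkcond; apply: eq_bigr => n _.
  by rewrite nbrsP l1B; case: eqP.
apply: le_trans (ler_sum_sub (L := nbrs m) _ _ _) _ => //.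
- exact: filter_uniq.
- by move=> n; rewrite mem_filter => /andP [].
- by rewrite big_const_seq count_predT size_nbrs iter_addr_0.
Qed.

End LatticeSums.

(** * Fractional parts and shifts of phases *)

Section Frac.
Context {R : realType}.
Implicit Types z t : R.

Definition fr z : R := z - (Num.floor z)%:~R.

Lemma fr_ge0 z : 0 <= fr z. Proof. by rewrite subr_ge0 floor_le_tmp. Qed.

Lemma fr_lt1 z : fr z < 1.
Proof. by rewrite ltrBlDr addrC -intrD1 floorD1_gt. Qed.

Lemma fr_id z : 0 <= z -> z < 1 -> fr z = z.
Proof.
move=> z0 z1; rewrite /fr; have -> : Num.floor z = 0; last by rewrite subr0.
by apply: floor_def; rewrite z0 add0r.
Qed.

Lemma frDz z (k : int) : fr (z + k%:~R) = fr z.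
Proof. by rewrite /fr floorDrz ?intr_int // intrKfloor intrD opprD addrACA subrr addr0. Qed.

Lemma fr_eqz z z' (k : int) : 0 <= z' -> z' < 1 -> z = z' + k%:~R -> fr z = z'.
Proof. by move=> h0 h1 ->; rewrite frDz fr_id. Qed.

Lemma fr_split z : exists k : int, z = fr z + k%:~R.
Proof. by exists (Num.floor z); rewrite /fr subrK. Qed.

Lemma periodic_fr (X : Type) (F : R -> X) x :
  (forall x, F (x + 1) = F x) -> F (fr x) = F x.
Proof.
move=> per; have pern y (k : nat) : F (y + k%:R) = F y.
  elim: k => [|k IH]; first by rewrite addr0.
  by rewrite -natr1 addrA per.
have [[n|n] e] := fr_split x; first by rewrite [in RHS]e pern.
have -> : fr x = x + n.+1%:R by rewrite [in RHS]e NegzE mulrNz subrK.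
exact: pern.
Qed.

Lemma fr_addl z t : fr (fr z + t) = fr (z + t).
Proof. by have [k e] := fr_split z; rewrite [in RHS]e [in RHS]addrAC frDz. Qed.

(** Here [x] lies between [y] and [y + t], while the phase [A] is farther than [4 * t] from [y], and
    after the shift by [t] from [y + t]. It cannot pass [x] unless it wraps around 1, and when it
    wraps it goes from above [x] to below [x]. *)
Lemma phase_index (A s t y x : R) : 0 <= A -> A < 1 -> 0 < t -> t < s ->
  0 <= y -> y + t < 1 -> `|x - y| <= t -> `|x - (y + t)| <= t ->
  4 * s <= `|A - y| -> 4 * s <= `|(if A + t < 1 then A + t else A + t - 1) - (y + t)| ->
  ((if A + t < 1 then A + t else A + t - 1) < x) = (A < x) || ~~ (A + t < 1) /\
  ~~ ((A < x) && ~~ (A + t < 1)).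
Proof.
move=> A0 A1 t0 ts y0 yt; rewrite !ler_norml => /andP [a1 a2] /andP [b1 b2].
rewrite !ler_normr; case: (ltP (A + t) 1) => h /orP [] f1 /orP [] f2; split;
  rewrite ?andbF ?andbT ?orbF ?orbT -?leNgt //=;
  try (apply/idP/idP => h'); lra.
Qed.
End Frac.

Section Idot.
Context {R : realType} {d : nat} (w : 'rV[R]_d).
Implicit Types m n : 'rV[int]_d.

Lemma idotD m n : idot (m + n) w = idot m w + idot n w.
Proof. by rewrite /idot -big_split; apply: eq_bigr => i _; rewrite mxE intrD mulrDl. Qed.

Lemma idotN n : idot (- n) w = - idot n w.
Proof. by rewrite /idot -sumrN; apply: eq_bigr => i _; rewrite mxE intrN mulNr. Qed.

Lemma idot0 : idot 0 w = 0.
Proof. by rewrite /idot big1 // => i _; rewrite mxE mul0r. Qed.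

Lemma idotB m n : idot (m - n) w = idot m w - idot n w.
Proof. by rewrite idotD idotN. Qed.
End Idot.

(** * Finite volume *)

Section Scheme.
Context {R : realType} {d : nat}.
Local Notation T := 'rV[int]_d.
Variables (w : 'rV[R]_d) (eps alpha gi : R) (th gam : nat -> R) (g : R -> R).

(** Radius of the ball to be eliminated before a site of scale [j]. Sites of scale above [j] are
    more than [2 ^ j.+2 = 4 * kap j.+1] apart, which leaves room for nested balls. *)
Definition kap (j : nat) : nat := if j is i.+1 then 2 ^ i else 0.
Definition hh j : R := th j `^ alpha.
(** [hh j] bounds from below the increment of [g] over a distance [th j]. With the eighth, the
    energies [E - 4 * wv j] and [E + 4 * wv j] differ by no more than this increment, as [piv_local]
    requires. *)
Definition wv j : R := hh j / 8.

Hypothesis alpha_ge1 : 1 <= alpha.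
Hypothesis eps_gt0 : 0 < eps.
Hypothesis omega_sep : forall j (n : T) (k : int), n != 0 -> (l1 n <= 2 ^ j.+2)%N ->
  4 * th j <= `|idot n w - k%:~R|.
Hypothesis th_gt0 : forall j, 0 < th j.
Hypothesis th_dec : forall j, th j.+1 <= th j.
Hypothesis hh_dec : forall j, hh j.+1 <= hh j / 8.
Hypothesis g_mono : forall a b : R, 0 <= a -> a <= b -> b < 1 -> g a + (b - a) `^ alpha <= g b.
Hypothesis gi_gt0 : 0 < gi.
Hypothesis gam_ge : forall j, gi <= gam j.
Hypothesis gam_dec : forall j, gam j.+1 <= gam j.
Hypothesis gam_gain : forall j,
  wv j <= wv j.+1 * expR ((gam j - gam j.+1) * (2 ^ j.+2)%:R).
Hypothesis eps_small : (2 * d)%:R * (eps * expR (gam 0%N)) <= wv 0.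

Definition qq : R := expR (- gi).

Hypothesis qq_sum : (qq ^+ 2) *+ (4 * d) <= 1 / 2.
Hypothesis tiny : forall s (U : seq T), uniq U ->
  (forall n : T, n \in U -> n != 0 /\ (kap s < 3 * l1 n)%N) ->
  (2 * d)%:R * eps * \sum_(n <- U) qq ^+ l1 n <= wv s / 16.

Definition Msys z E (m n : T) : R :=
  if m == n then g (fr (z + idot n w)) - E else if (l1 (m - n) == 1)%N then eps else 0.

Lemma Msys_sym z E m n : Msys z E m n = Msys z E n m.
Proof. by rewrite /Msys eq_sym l1B; case: eqP => [->|]. Qed.

Lemma Msys_shift z E r m n : Msys (z + idot r w) E m n = Msys z E (m + r) (n + r).
Proof.
rewrite /Msys (inj_eq (addIr r)) idotD [idot n w + _]addrC addrA.
by rewrite opprD addrACA subrr addr0.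
Qed.

Lemma th_le i j : (i <= j)%N -> th j <= th i.
Proof.
move/subnK <-; elim: (j - i)%N => [|k IH]; rewrite ?add0n // addSn.
exact: le_trans (th_dec _) IH.
Qed.

Lemma hh_gt0 j : 0 < hh j. Proof. exact: powR_gt0. Qed.
Lemma wv_gt0 j : 0 < wv j. Proof. by rewrite divr_gt0 ?hh_gt0. Qed.

Lemma wv_dec j : wv j.+1 <= wv j / 8.
Proof. by rewrite /wv ler_pM2r // hh_dec. Qed.

Lemma qq_gt0 : 0 < qq. Proof. exact: expR_gt0. Qed.
Lemma qq_le1 : qq <= 1. Proof. by rewrite /qq -expR0 ler_expR oppr_le0 ltW. Qed.

(** Only displacements of phases enter, so the two base phases may differ. This is needed for two
    sites of which one is close in phase when seen from [x] and the other when seen from [z]. *)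
Lemma sep_gen z1 z2 (m n : T) j : m != n ->
  `|(fr (z1 + idot m w) - fr z1) - (fr (z2 + idot n w) - fr z2)| < 4 * th j ->
  (2 ^ j.+2 < l1 (m - n))%N.
Proof.
move=> mn; apply: contraTT; rewrite -leqNgt -leNgt => h.
have [k1 e1] := fr_split (z1 + idot m w); have [k2 e2] := fr_split z1.
have [k3 e3] := fr_split (z2 + idot n w); have [k4 e4] := fr_split z2.
have -> : (fr (z1 + idot m w) - fr z1) - (fr (z2 + idot n w) - fr z2)
   = idot (m - n) w - (k1 - k2 - k3 + k4)%:~R.
  rewrite idotB !intrD !intrN; lra.
by apply: omega_sep; rewrite // subr_eq0.
Qed.

(** * Pivots relative to a reference phase *)

Section Reference.
Variables (x : R) (K : nat).
Hypothesis x_ge0 : 0 <= x.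
Hypothesis x_lt1 : x < 1.

(* The scale of a phase: the first j at which it is separated from x, and K if
   there is none below K. *)
Definition sc z : nat := find (fun j => th j <= `|fr z - x|) (iota 0 K).
Definition site z (n : T) : nat := sc (z + idot n w).

Lemma sc_le z : (sc z <= K)%N.
Proof. by rewrite /sc -[leqRHS](size_iota 0) find_size. Qed.

Lemma sc_lt z j : (j < sc z)%N -> `|fr z - x| < th j.
Proof.
move=> h; have jK : (j < K)%N := leq_trans h (sc_le z).
by have := before_find 0 h; rewrite nth_iota // add0n => /negbT; rewrite -ltNge.
Qed.

Lemma sc_ge z : (sc z < K)%N -> th (sc z) <= `|fr z - x|.
Proof.
move=> h; have hf : has (fun j => th j <= `|fr z - x|) (iota 0 K).
  by rewrite has_find size_iota.
by have := nth_find 0 hf; rewrite nth_iota.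
Qed.

Lemma sc_leP z j : (j < K)%N -> th j <= `|fr z - x| -> (sc z <= j)%N.
Proof. by move=> jK h; rewrite leqNgt; apply/negP => /sc_lt; rewrite ltNge h. Qed.

Lemma site_sep z (m n : T) j : m != n -> (j < site z m)%N -> (j < site z n)%N ->
  (2 ^ j.+2 < l1 (m - n))%N.
Proof.
move=> mn /sc_lt hm /sc_lt hn; apply: (@sep_gen z z) => //.
have -> : fr (z + idot m w) - fr z - (fr (z + idot n w) - fr z)
  = (fr (z + idot m w) - x) - (fr (z + idot n w) - x) by ring.
apply: le_lt_trans (ler_normB _ _) _; have := th_gt0 j; lra.
Qed.

Lemma kap_lt j : (kap j.+1 < 2 ^ j.+2)%N.
Proof. by rewrite /= ltn_exp2l. Qed.

(** Otherwise both sites would be of scale above [j], hence more than [2 ^ j.+2] apart. Sorting by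
    scale thus places the whole ball of radius [kap] before its centre. *)
Lemma site_kap z (m n : T) : m != n -> (l1 (m - n) <= kap (site z n))%N ->
  (site z m < site z n)%N.
Proof.
move=> mn; case e : (site z n) => [|j] h.
  by move: h; rewrite /= leqn0 l1_eq0 subr_eq0 (negbTE mn).
rewrite ltnNge; apply/negP => h'.
have := @site_sep z m n j mn h' _; rewrite e => /(_ (leqnn _)).
by rewrite ltnNge (leq_trans h) // ltnW // kap_lt.
Qed.

Definition sg z : R := if x <= fr z then 1 else -1.

Definition adm z (C : seq T) := forall n m : T, n \in C -> m != n ->
  (l1 (m - n) <= kap (site z n))%N -> m \in C.

(** Scale [K] means that no separation from [x] is known, hence no bound on the pivot: only the last
    site [r] may have it. *)
Definition env z (r : T) (C : seq T) :=
  [/\ uniq (r :: C), adm z C, forall n, n \in C -> (site z n <= site z r)%N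
    & forall n, n \in C -> (site z n < K)%N].

Definition full z (r : T) (C : seq T) := (site z r < K)%N /\
  forall n, n != r -> (l1 (n - r) <= kap (site z r))%N -> n \in C.

(** The pivot is expressed by a solution so that no order of elimination has to be fixed. *)
Definition pivprop E z (r : T) C := forall phi, solves (Msys z E) C r phi ->
  wv (site z r) <= sg (z + idot r w) * mvec (Msys z E) (r :: C) phi r.

Definition gw j (m n : T) : R := expR (gam j * (l1 (m - n))%:R).
Definition ginf (m n : T) : R := expR (gi * (l1 (m - n))%:R).

Lemma gw_mul j m v n : gw j m n <= gw j m v * gw j v n.
Proof.
rewrite /gw -expRD ler_expR -mulrDr -natrD ler_wpM2l ?ler_nat ?l1_triangle //.
exact: le_trans (ltW gi_gt0) (gam_ge j).
Qed.

Lemma gw_sep (m n : T) j : (2 ^ j.+2 < l1 (m - n))%N ->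
  wv j * gw j.+1 m n <= wv j.+1 * gw j m n.
Proof.
move=> h; apply: le_trans (ler_wpM2r (expR_ge0 _) (gam_gain j)) _.
rewrite -mulrA ler_pM2l ?wv_gt0 // /gw -expRD ler_expR.
rewrite -[gam j * _](subrK (gam j.+1 * (l1 (m - n))%:R)) lerD2r -mulrBl.
by rewrite ler_wpM2l ?subr_ge0 // ler_nat ltnW.
Qed.

Lemma rowsum0 z E (L : seq T) m : uniq L -> rowsum (gw 0) (Msys z E) L m <= wv 0.
Proof.
move=> uL; apply: le_trans eps_small.
apply: (@le_trans _ _ (\sum_(n <- L) (l1 (m - n) == 1)%N%:R * (eps * expR (gam 0%N)))).
  rewrite /rowsum big_mkcond; apply: ler_sum => n _; rewrite /Msys.
  case: ifP => [nm|_]; last by rewrite mulr_ge0 // mulr_ge0 ?expR_ge0 // ltW.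
  rewrite eq_sym (negbTE nm); case: ifP => [/eqP h|_]; last by rewrite normr0 !mul0r.
  by rewrite /gw h mulr1 mul1r ger0_norm // ltW.
rewrite -mulr_suml; apply: ler_wpM2r; last exact: count_nbrs.
by rewrite mulr_ge0 ?expR_ge0 // ltW.
Qed.

Lemma sg_norm z (F b : R) : b <= sg z * F -> b <= `|F|.
Proof.
move=> h; apply: le_trans h _; rewrite /sg; case: ifP => _; rewrite ?mul1r ?mulN1r ?ler_norm //.
by rewrite -normrN ler_norm.
Qed.

Definition leS z : rel T := fun m n => (site z m <= site z n)%N.

Lemma leS_trans z : transitive (leS z). Proof. by move=> a b c; apply: leq_trans. Qed.

(* The pivot of a site v is the Schur complement of the sites eliminated before
   it, and these contain the whole ball of radius kap around v. *)
Lemma elim_pivots E z (r : T) C : env z r C ->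
  (forall v C1, v \in C -> env z v C1 -> full z v C1 -> (size C1 < size C)%N ->
     pivprop E z v C1) ->
  exists2 C', perm_eq C C' &
    dominated ginf r (Msys z E) C' /\
    pivots (fun v F => wv (site z v) <= sg (z + idot v w) * F) (Msys z E) C'.
Proof.
move=> [uC aC hs hK] hP; exists (sort (leS z) C); first by rewrite perm_sym perm_sort.
set C' := sort (leS z) C.
have pC : perm_eq C' C by rewrite perm_sort.
have memC' n : (n \in C') = (n \in C) by exact: perm_mem.
have sC' : sorted (leS z) C' by apply: sort_sorted => a b; apply: leq_total.
have uC' : uniq C' by rewrite sort_uniq; case/andP: uC.
have rC' : r \notin C' by rewrite memC'; case/andP: uC.
pose P := fun v (F : R) => wv (site z v) <= sg (z + idot v w) * F.
have dom v C1 : uniq (rcons C1 v) -> sorted (leS z) (rcons C1 v) ->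
    pivots P (Msys z E) C1 -> dominated ginf v (Msys z E) C1.
  move=> uL sL hp; apply: (@dominated_scales _ _ gw ginf wv (site z) _ _ _ _ v _ _ 0) => //.
  - by move=> j m n; apply: expR_ge0.
  - exact: gw_mul.
  - by move=> j m n; rewrite ler_expR ler_wpM2r // gam_ge.
  - exact: wv_gt0.
  - by move=> n p k _ _ np kn kp; apply: gw_sep; apply: site_sep kn kp.
  - by move=> m _; apply: rowsum0.
  - by apply: pivots_impl hp => u F _; apply: sg_norm.
(* Induction on the prefixes of the sorted list: the sites before [v] form an environment that is
   full for [v], and the hypothesis on smaller sets gives the sign and size of its pivot. *)
have main C1 C2 : C' = C1 ++ C2 -> pivots P (Msys z E) C1.
  elim/last_ind: C1 C2 => [//|C1 v IH] C2; rewrite cat_rcons => eC.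
  have hp := IH _ eC.
  have uL : uniq (rcons C1 v).
    by move: uC'; rewrite eC -cat_rcons cat_uniq => /andP [].
  have sL : sorted (leS z) (rcons C1 v).
    by move: sC'; rewrite eC -cat_rcons; case/cat_sorted2.
  apply/pivots_rcons; split=> //.
  have vC : v \in C by rewrite -memC' eC mem_cat mem_head orbT.
  have sub n : n \in C1 -> n \in C by rewrite -memC' eC mem_cat => ->.
  have lt n : n \in C -> (site z n < site z v)%N -> n \in C1.
    rewrite -memC' eC mem_cat => /orP [//|h]; rewrite ltnNge; case/negP.
    move: sC'; rewrite eC => /cat_sorted2 [_] /=; rewrite (path_sortedE (@leS_trans z)).
    by case/andP => /allP h' _; move: h; rewrite inE => /orP [/eqP ->|/h'].
  have le n : n \in C1 -> (site z n <= site z v)%N.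
    move: sL; rewrite -cats1; elim: (C1) => [//|a l IHl] /= hpth.
    move: (hpth); rewrite (path_sortedE (@leS_trans z)) => /andP [/allP h1 h2].
    rewrite inE => /orP [/eqP ->|]; last exact: IHl.
    by apply: h1; rewrite mem_cat mem_head orbT.
  have uvC1 : uniq (v :: C1) by rewrite rcons_uniq in uL.
  have hd := dom _ _ uL sL hp.
  have [phi hphi] := solution_exists uvC1 (dominated_pivots hd).
  rewrite -(solves_value (dominated_pivots hd) hphi).
  apply: (hP v C1) => //.
  - split=> //.
    + move=> n m nC1 mn h; have := site_kap mn h => hlt.
      have := aC _ _ (sub _ nC1) mn h => mC; apply: lt => //.
      by apply: leq_trans hlt (le _ nC1).
    + by move=> n /sub /hK.
  - split; first exact: hK.
    move=> n nv h; apply: lt; last exact: site_kap nv h.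
    exact: aC vC nv h.
  - by rewrite -(perm_size pC) eC size_cat /= addnS ltnS leq_addr.
have hp : pivots P (Msys z E) C' by apply: (main _ [::]); rewrite cats0.
split=> //; apply: dom => //.
  by rewrite rcons_uniq rC' uC'.
rewrite -cats1; case: (C') sC' (memC') => [//|a l] /= hl hm.
rewrite cat_path hl /= andbT; apply: hs; rewrite -hm; exact: mem_last.
Qed.

Lemma env_solution E z (r : T) C : env z r C ->
  (forall v C1, v \in C -> env z v C1 -> full z v C1 -> (size C1 < size C)%N ->
     pivprop E z v C1) ->
  (exists phi, solves (Msys z E) C r phi) /\
  (forall phi, solves (Msys z E) C r phi ->
     forall n, `|phi n| <= qq ^+ l1 (n - r)).
Proof.
move=> hE hP; have [C' pC [hd _]] := elim_pivots hE hP.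
have [uC _ _ _] := hE.
have uC' : uniq (r :: C') by rewrite -(perm_uniq (_ : perm_eq (r :: C) _)) // perm_cons.
split.
  have [phi hphi] := solution_exists uC' (dominated_pivots hd).
  by exists phi; apply: solves_perm hphi; rewrite perm_sym.
move=> phi hphi; have [h1 h2 h3] := solves_perm pC hphi => n.
case nL : (n \in r :: C'); last by rewrite h2 ?nL // normr0 exprn_ge0 // ltW // qq_gt0.
have -> : qq ^+ l1 (n - r) = `|phi r| * expR (- gi * (l1 (n - r))%:R).
  by rewrite h1 normr1 mul1r /qq -expRM_natr.
apply: (dominated_decay (g := ginf) (M := Msys z E) (C := C') (h := fun n : T => expR (- gi * (l1 (n - r))%:R))) => //.
- by rewrite subrr l1_0 mulr0 expR0.
- move=> v m; rewrite /ginf -expRD ler_expR.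
  have : (l1 (v - r))%:R <= (l1 (v - m))%:R + (l1 (m - r))%:R :> R.
    by rewrite -natrD ler_nat l1_triangle.
  by move/(ler_wpM2l (ltW gi_gt0)); rewrite mulrDr; lra.
- move=> m mC; rewrite -(h3 m mC); apply: mvec_perm; by rewrite perm_rcons.
- by rewrite mem_rcons.
Qed.

(** All base phases [z] are included, because moving a site to the origin changes the base phase. *)
Definition Piv E s := forall z r C, site z r = s -> env z r C -> full z r C -> pivprop E z r C.

Lemma env_solution_low E z r C : env z r C ->
  (forall s, (exists2 n, n \in C & site z n = s) -> Piv E s) ->
  (exists phi, solves (Msys z E) C r phi) /\
  (forall phi, solves (Msys z E) C r phi ->
     forall n, `|phi n| <= qq ^+ l1 (n - r)).
Proof.
move=> hE hP; apply: env_solution => // v C1 vC e f _.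
by apply: (hP (site z v)) => //; exists v.
Qed.

Lemma solves_extend z E (C C' : seq 'rV[int]_d) phi m : uniq (0 :: C) -> uniq (0 :: C') ->
  {subset C' <= C} -> solves (Msys z E) C' 0 phi ->
  mvec (Msys z E) (0 :: C) phi m = mvec (Msys z E) (0 :: C') phi m.
Proof.
move=> uC uC' sub [_ h2 _]; rewrite /mvec.
rewrite (bigID (fun n => n \in 0 :: C')) /= [X in _ + X]big1 ?addr0; last first.
  by move=> n /h2 ->; rewrite mulr0.
rewrite -big_filter; apply: perm_big; apply: uniq_perm; rewrite ?filter_uniq // => n.
rewrite mem_filter; case nC : (n \in 0 :: C') => //=.
by move: nC; rewrite !inE => /orP [->//|/sub ->]; rewrite orbT.
Qed.

Lemma mvec_boundary z E (C : seq 'rV[int]_d) phi n : uniq C -> n \notin C ->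
  (forall m, `|phi m| <= qq ^+ l1 m) ->
  `|\sum_(m <- C) Msys z E n m * phi m| <= (2 * d)%:R * eps.
Proof.
move=> uC nC hphi; apply: le_trans (ler_norm_sum _ _ _) _.
apply: (@le_trans _ _ (\sum_(m <- C) (l1 (n - m) == 1)%N%:R * eps)); last first.
  by rewrite -mulr_suml ler_pM2r // count_nbrs.
rewrite !big_seq; apply: ler_sum => m mC; rewrite normrM /Msys.
case: eqP => [e|_]; first by rewrite -e (negbTE nC) in mC.
case: ifP => _; last by rewrite normr0 !mul0r.
rewrite mul1r gtr0_norm // ler_piMr //; first exact: ltW.
by apply: le_trans (hphi m) _; rewrite exprn_ile1 ?qq_le1 // ltW // qq_gt0.
Qed.

Lemma F_near z E C phi : uniq (0 :: C) -> solves (Msys z E) C 0 phi ->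
  (forall m, `|phi m| <= qq ^+ l1 m) ->
  `|mvec (Msys z E) (0 :: C) phi 0 - (g (fr z) - E)| <= (2 * d)%:R * eps.
Proof.
move=> /= /andP [nC uC] [h1 _ _] hphi; rewrite /mvec big_cons h1 mulr1.
rewrite {1}/Msys eqxx idot0 addr0 addrAC subrr add0r.
exact: mvec_boundary.
Qed.

(** Green's identity: the rows of [phi] are paired with [phi'] and the symmetry of the matrix is
    used. There remain the energy difference times the inner product [s], close to 1 by decay, and
    the rows of [phi'] in [C] outside [C'], where only hopping of size at most [2 * d * eps]
    survives. *)
Lemma compare z E E' C C' phi phi' : uniq (0 :: C) -> uniq (0 :: C') ->
  {subset C' <= C} -> solves (Msys z E) C 0 phi -> solves (Msys z E') C' 0 phi' ->
  (forall m, `|phi m| <= qq ^+ l1 m) -> (forall m, `|phi' m| <= qq ^+ l1 m) ->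
  exists2 s, `|s - 1| <= 1 / 2 &
   `|mvec (Msys z E) (0 :: C) phi 0 - mvec (Msys z E') (0 :: C') phi' 0 - (E' - E) * s|
     <= (2 * d)%:R * eps * \sum_(n <- C | n \notin C') qq ^+ l1 n.
Proof.
move=> uC uC' sub hphi hphi' dphi dphi'.
have [p1 p2 p3] := hphi; have [q1 q2 q3] := hphi'.
have [zC uC0] := andP uC.
pose s := \sum_(n <- 0 :: C) phi n * phi' n.
exists s.
  rewrite /s big_cons p1 q1 mulr1 addrAC subrr add0r.
  apply: le_trans (ler_norm_sum _ _ _) _; apply: le_trans qq_sum.
  apply: (@le_trans _ _ (\sum_(n <- C | n != 0) (qq ^+ 2) ^+ l1 n)); last first.
    apply: lattice_sum_le => //; first by rewrite exprn_ge0 // ltW // qq_gt0.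
    by apply: le_trans qq_sum _; lra.
  rewrite [leRHS]big_seq_cond (eq_bigl (fun n => n \in C)); last first.
    by move=> n; case nC : (n \in C) => //=; apply: contraNneq zC => <-.
  rewrite [leLHS]big_seq; apply: ler_sum => n _.
  by rewrite normrM -exprM mulnC exprM expr2 ler_pM // exprMn.
have e1 : \sum_(m <- 0 :: C) phi' m * mvec (Msys z E) (0 :: C) phi m
   = mvec (Msys z E) (0 :: C) phi 0.
  by rewrite big_cons q1 mul1r big_seq big1 ?addr0 // => m /p3 ->; rewrite mulr0.
have e2 m : m \in 0 :: C -> mvec (Msys z E) (0 :: C) phi' m =
    mvec (Msys z E') (0 :: C') phi' m + (E' - E) * phi' m.
  move=> mC; rewrite -(solves_extend (E := E') _ uC uC' sub) // /mvec.
  rewrite (bigD1_seq m) //= [in RHS](bigD1_seq m) //= {1 3}/Msys eqxx.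
  rewrite [in LHS](eq_bigr (fun n => Msys z E' m n * phi' n)); first by ring.
  by move=> n nm; rewrite /Msys eq_sym (negbTE nm).
have e3 : mvec (Msys z E) (0 :: C) phi 0 =
   \sum_(n <- 0 :: C) phi n * (mvec (Msys z E') (0 :: C') phi' n + (E' - E) * phi' n).
  rewrite -e1 /mvec; under eq_bigr do rewrite mulr_sumr.
  rewrite exchange_big /= !big_seq; apply: eq_bigr => n nC.
  rewrite -e2 // /mvec mulr_sumr; apply: eq_bigr => m _.
  by rewrite Msys_sym; ring.
have -> : mvec (Msys z E) (0 :: C) phi 0 - mvec (Msys z E') (0 :: C') phi' 0 - (E' - E) * s
  = \sum_(n <- C | n \notin C') phi n * mvec (Msys z E') (0 :: C') phi' n.
  rewrite e3; under eq_bigr do rewrite mulrDr.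
  rewrite big_split /=.
  have -> : \sum_(n <- 0 :: C) phi n * ((E' - E) * phi' n) = (E' - E) * s.
    by rewrite /s mulr_sumr; apply: eq_bigr => n _; ring.
  rewrite addrAC addrK big_cons p1 mul1r addrAC subrr add0r.
  rewrite (bigID (fun n => n \in C')) /= [X in X + _]big1 ?add0r // => n /q3 ->.
  by rewrite mulr0.
apply: le_trans (ler_norm_sum _ _ _) _; rewrite mulr_sumr.
rewrite big_seq_cond [leRHS]big_seq_cond; apply: ler_sum => n /andP [nC nC'].
rewrite normrM mulrC ler_pM //; apply: mvec_boundary => //.
by rewrite inE negb_or nC' andbT; apply: contraNneq zC => <-.
Qed.

Lemma compare_tiny z E C C' phi phi' s : uniq (0 :: C) -> uniq (0 :: C') ->
  {subset C' <= C} -> solves (Msys z E) C 0 phi -> solves (Msys z E) C' 0 phi' ->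
  (forall m, `|phi m| <= qq ^+ l1 m) -> (forall m, `|phi' m| <= qq ^+ l1 m) ->
  (forall n, n != 0 -> n \notin C' -> (kap s < 3 * l1 n)%N) ->
  `|mvec (Msys z E) (0 :: C) phi 0 - mvec (Msys z E) (0 :: C') phi' 0| <= wv s / 16.
Proof.
move=> uC uC' sub h h' dphi dphi' hs.
have [t _ ht] := compare uC uC' sub h h' dphi dphi'.
rewrite subrr mul0r subr0 in ht; apply: le_trans ht _.
have [zC uC0] := andP uC.
rewrite -big_filter; apply: tiny; rewrite ?filter_uniq // => n.
rewrite mem_filter => /andP [nC' nC].
have n0 : n != 0 by apply: contraNneq zC => <-.
by split=> //; apply: hs.
Qed.

(** With equal sets the boundary sum of [compare] is empty: the last pivot decreases in the energy,
    with a slope between -3/2 and -1/2. *)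
Lemma compare_slope z E E' C phi phi' : uniq (0 :: C) ->
  solves (Msys z E) C 0 phi -> solves (Msys z E') C 0 phi' ->
  (forall m, `|phi m| <= qq ^+ l1 m) -> (forall m, `|phi' m| <= qq ^+ l1 m) ->
  exists s, [/\ 1 / 2 <= s, s <= 3 / 2 & mvec (Msys z E) (0 :: C) phi 0
    = mvec (Msys z E') (0 :: C) phi' 0 + (E' - E) * s].
Proof.
move=> uC h h' dphi dphi'.
have [t t1 ht] := compare uC uC (fun _ => id) h h' dphi dphi'.
exists t; move: t1; rewrite ler_norml => /andP [a b]; split; try lra.
move: ht; rewrite big_seq_cond big_pred0; last by move=> n; case: (n \in C).
by rewrite mulr0 normr_le0 => /eqP; lra.
Qed.

Lemma site_shift z (r n : T) : site (z + idot r w) n = site z (n + r).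
Proof. by rewrite /site idotD [idot n w + _]addrC addrA. Qed.

Definition shiftl (r : T) (C : seq T) := [seq n - r | n <- C].

Lemma mem_shiftl r C n : (n \in shiftl r C) = (n + r \in C).
Proof. by rewrite -[n in LHS](addrK r) (mem_map (addIr (- r))). Qed.

Lemma site_ge z (r : T) : site (z + idot r w) 0 = site z r.
Proof. by rewrite site_shift add0r. Qed.

Lemma pivprop_shift E z r C :
  (env (z + idot r w) 0 (shiftl r C) -> full (z + idot r w) 0 (shiftl r C) ->
    pivprop E (z + idot r w) 0 (shiftl r C)) ->
  env z r C -> full z r C -> pivprop E z r C.
Proof.
move=> hP [uC aC sC kC] [rK fC] phi [h1 h2 h3].
have uC' : uniq (0 :: shiftl r C).
  move: uC; rewrite /= mem_shiftl add0r => /andP [-> uC] /=.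
  by rewrite map_inj_uniq //; apply: addIr.
have e m u : mvec (Msys (z + idot r w) E) (0 :: shiftl r C) (fun n => u (n + r)) m
   = mvec (Msys z E) (r :: C) u (m + r).
  rewrite /mvec !big_cons Msys_shift add0r; congr (_ + _).
  by rewrite big_map; apply: eq_bigr => n _; rewrite Msys_shift subrK.
have := hP _ _ (fun n => phi (n + r)).
rewrite site_ge idot0 addr0 e add0r; apply.
- split=> //.
  + move=> n m; rewrite !mem_shiftl => nC mn; rewrite site_shift => h.
    by apply: aC nC _ _; rewrite ?(inj_eq (addIr r)) // opprD addrACA subrr addr0.
  + by move=> n; rewrite mem_shiftl !site_shift add0r => /sC.
  + by move=> n; rewrite mem_shiftl site_shift => /kC.
- split; first by rewrite site_ge.
  move=> n n0; rewrite subr0 site_ge mem_shiftl => h.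
  by apply: fC; rewrite ?addrK // -subr_eq0 addrK.
- split; first by rewrite add0r.
  + move=> n nC; apply: h2; move: nC; rewrite !inE mem_shiftl.
    by rewrite -[n == 0](inj_eq (addIr r)) add0r.
  + by move=> m; rewrite mem_shiftl e => /h3.
Qed.

Lemma fr_x : fr x = x. Proof. exact: fr_id. Qed.

Definition mxs z (n : T) : nat := maxn (site x n) (site z n).

(** The same sites serve the phases [x] and [z], as the comparison of indices requires. The margin
    is twice [kap]: a site [m] in the ball around [n] may lie farther out by the [kap] of [n], and
    the second [kap] pays for the margin of [m], whose scale is smaller. *)
Definition Cset z (N : nat) : seq T :=
  [seq n <- ball N | (n != 0) && (l1 n + 2 * kap (mxs z n) <= N)%N].

Lemma mem_Cset z N n : (n \in Cset z N) = (n != 0) && (l1 n + 2 * kap (mxs z n) <= N)%N.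
Proof.
rewrite mem_filter mem_ball andbC; case: (n != 0); rewrite ?andbF //=.
by apply/andP/idP => [[_ ->//]|h]; split=> //; apply: leq_trans (leq_addr _ _) h.
Qed.

Lemma uniq_Cset z N : uniq (0 :: Cset z N).
Proof. by rewrite /= mem_Cset eqxx /= filter_uniq // ball_uniq. Qed.

(** * Sites seen from two close phases *)

Section Near.
Variables (z : R) (j : nat).
Hypothesis z_near : `|fr z - x| < th j.
Hypothesis jK : (j < K)%N.

Lemma mxs_near n i : (i < mxs z n)%N -> (i <= j)%N ->
  exists y, `|fr (y + idot n w) - fr y| < 2 * th i.
Proof.
move=> h ij; have hj := th_le ij; move: h; rewrite leq_max => /orP [/sc_lt h|/sc_lt h].
  by exists x; rewrite fr_x; have := th_gt0 i; lra.
exists z.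
have -> : fr (z + idot n w) - fr z = (fr (z + idot n w) - x) - (fr z - x) by ring.
apply: le_lt_trans (ler_normB _ _) _; rewrite mulrDl mul1r ltrD // (lt_le_trans z_near) //.
Qed.

Lemma mxs_far n i : n != 0 -> (i < mxs z n)%N -> (i <= j)%N -> (2 ^ i.+2 < l1 n)%N.
Proof.
move=> n0 h ij; have [y hy] := mxs_near h ij.
have := @sep_gen y y n 0 i n0; rewrite subr0 idot0 addr0 subrr subr0; apply.
by apply: lt_trans hy _; have := th_gt0 i; lra.
Qed.

Lemma mxs_sep m n i : m != n -> (i < mxs z m)%N -> (i < mxs z n)%N -> (i <= j)%N ->
  (2 ^ i.+2 < l1 (m - n))%N.
Proof.
move=> mn hm hn ij; have [y hy] := mxs_near hm ij; have [y' hy'] := mxs_near hn ij.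
apply: (@sep_gen y y') => //.
by apply: le_lt_trans (ler_normB _ _) _; lra.
Qed.

Lemma mxs_le n : n != 0 -> (l1 n <= 2 ^ j.+2)%N -> (mxs z n <= j)%N.
Proof.
move=> n0 h; rewrite leqNgt; apply/negP => h'.
by have := mxs_far n0 h' (leqnn j); rewrite ltnNge h.
Qed.

Lemma kap_le_l1 n : n != 0 -> (l1 n <= 2 ^ j.+2)%N -> (kap (mxs z n) <= l1 n)%N.
Proof.
move=> n0 h; have := mxs_le n0 h; case e : (mxs z n) => [//|i] ij.
have := @mxs_far n i n0; rewrite e => /(_ (leqnn _) (ltnW ij)) h'.
by apply: leq_trans (ltnW h'); apply: ltnW (kap_lt i).
Qed.

Lemma kap2 i : (2 * kap i <= kap i.+1)%N.
Proof. by case: i => [//|i] /=; rewrite expnS. Qed.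

Lemma Cset_closed N n m : (N <= 2 ^ j.+2)%N -> n \in Cset z N -> m != n ->
  (l1 (m - n) <= kap (mxs z n))%N -> m \in Cset z N.
Proof.
move=> Nj; rewrite !mem_Cset => /andP [n0 hn] mn h.
have nj : (l1 n <= 2 ^ j.+2)%N.
  by apply: leq_trans Nj; apply: leq_trans hn; rewrite leq_addr.
have := mxs_le n0 nj; move: h hn; case e : (mxs z n) => [|i] h hn ij.
  by move: h; rewrite leqn0 l1_eq0 subr_eq0 (negbTE mn).
have m0 : m != 0.
  apply/eqP => m0; have := @mxs_far n i n0; rewrite e => /(_ (leqnn _) (ltnW ij)).
  by rewrite ltnNge -l1N -sub0r -m0 (leq_trans h) // ltnW // kap_lt.
rewrite m0 /=.
have mi : (mxs z m <= i)%N.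
  rewrite leqNgt; apply/negP => hm; have := @mxs_sep m n i mn hm.
  rewrite e => /(_ (leqnn _) (ltnW ij)).
  by rewrite ltnNge (leq_trans h) // ltnW // kap_lt.
have hk : (2 * kap (mxs z m) <= kap i.+1)%N.
  apply: leq_trans (kap2 i); rewrite leq_mul2l /=.
  by move: mi; case: (mxs z m) => [//|a]; case: (i) => [//|b] /=; rewrite ltnS leq_exp2l.
have ht : (l1 m <= l1 n + kap i.+1)%N.
  by rewrite -(subrK n m) addnC (leq_trans (l1D _ _)) // leq_add2r.
by apply: leq_trans (leq_add ht hk) _; rewrite -addnA addnn -mul2n.
Qed.

Lemma near_scale : (j < sc z)%N.
Proof.
rewrite ltnNge; apply/negP => h.
have := sc_ge (leq_ltn_trans h jK); have := th_le h; move: z_near; lra.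
Qed.

Lemma Cset_env N y : (y = x \/ y = z) -> (N <= 2 ^ j.+2)%N ->
  env y 0 (Cset z N) /\ forall n, n \in Cset z N -> (site y n <= j)%N.
Proof.
move=> hy Nj.
have le n : (site y n <= mxs z n)%N.
  by case: hy => ->; rewrite /mxs ?leq_maxl ?leq_maxr.
have hs n : n \in Cset z N -> (site y n <= j)%N.
  rewrite mem_Cset => /andP [n0 hn]; apply: leq_trans (le n) _; apply: mxs_le => //.
  by apply: leq_trans Nj; apply: leq_trans hn; rewrite leq_addr.
split=> //; split; first exact: uniq_Cset.
- move=> n m nC mn h; apply: Cset_closed nC mn _ => //; apply: leq_trans h _.
  by move: (le n); case: (site y n) => [//|a]; case: (mxs z n) => [//|b] /=; rewrite ltnS leq_exp2l.
- move=> n /hs h; apply: leq_trans h _; rewrite /site idot0 addr0.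
  case: hy => ->; last exact: ltnW near_scale.
  rewrite leqNgt; apply/negP => h; have := sc_ge (ltn_trans h jK).
  by rewrite fr_x subrr normr0 leNgt th_gt0.
- by move=> n /hs h; apply: leq_ltn_trans h jK.
Qed.

(** In this range the [kap] of a site is at most its norm, so norm plus margin is at most three
    times the norm. This is the origin of the 3 in the hypothesis [tiny]. *)
Lemma Cset_compl N n : n != 0 -> n \notin Cset z N -> (N <= 2 ^ j.+2)%N -> (N < 3 * l1 n)%N.
Proof.
rewrite mem_Cset => n0; rewrite n0 /= -ltnNge => h Nj.
case: (leqP (l1 n) N) => hN; last by apply: leq_trans hN _; rewrite leq_pmull.
apply: leq_trans h _; rewrite [leqRHS]mulSn leq_add2l leq_mul2l /= kap_le_l1 //.
exact: leq_trans Nj.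
Qed.

End Near.

Lemma fr_shift_cases (u t : R) : 0 <= t -> t < 1 ->
  fr (u + t) = if fr u + t < 1 then fr u + t else fr u + t - 1.
Proof.
move=> t0 t1; rewrite -fr_addl; have u0 := fr_ge0 u; have u1 := fr_lt1 u.
case: ltP => h; first by rewrite fr_id // addr_ge0.
by apply: (@fr_eqz _ _ _ 1) => //; rewrite ?mulr1z; lra.
Qed.

Lemma far_phase y (n : T) j : n != 0 -> (l1 n <= 2 ^ j.+2)%N ->
  4 * th j <= `|fr (y + idot n w) - fr y|.
Proof.
move=> n0 h; rewrite leNgt; apply/negP => h'.
have := @sep_gen y y n 0 j n0; rewrite subr0 idot0 addr0 subrr subr0 => /(_ h').
by rewrite ltnNge h.
Qed.

Definition negphase y (n : T) : bool := fr (y + idot n w) < x.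

Lemma sg_pivot_sign y E C :
  pivots (fun v F => wv (site y v) <= sg (y + idot v w) * F) (Msys y E) C ->
  pivots (pivot_sign (negphase y)) (Msys y E) C.
Proof.
apply: pivots_impl => v F _; rewrite /pivot_sign /negphase /sg leNgt.
by have := wv_gt0 (site y v); case: (ltP (fr (y + idot v w)) x) => _ /=; lra.
Qed.

(** Where the phase does not wrap, the potential grows by at least [(y2 - y1) ^ alpha], hence by
    more than the energy or as much. Where it wraps, the diagonal may drop, but each such site turns
    from a positive into a negative pivot, which is exactly the loss that [index_comparison]
    tolerates through [X]. *)
Lemma index_sites j (y1 y2 E1 E2 : R) C C1 C2 : 0 <= y1 -> y1 < y2 -> y2 < 1 ->
  x = y1 \/ x = y2 -> y2 - y1 < th j -> E2 - E1 <= (y2 - y1) `^ alpha ->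
  uniq (0 :: C) -> (forall n, n \in C -> (l1 n <= 2 ^ j.+2)%N) ->
  perm_eq C C1 -> perm_eq C C2 ->
  pivots (pivot_sign (negphase y1)) (Msys y1 E1) C1 ->
  pivots (pivot_sign (negphase y2)) (Msys y2 E2) C2 ->
  0 <= elim (Msys y1 E1) C1 0 0 -> 0 <= elim (Msys y2 E2) C2 0 0.
Proof.
move=> y10 y12 y21 hx tj hE uC hC pC1 pC2 hp1 hp2.
set t := y2 - y1 in tj hE.
have t0 : 0 < t by rewrite subr_gt0.
have t1 : t < 1 by rewrite /t; lra.
have [zC uC0] := andP uC.
have ey1 : fr y1 = y1 by apply: fr_id => //; lra.
have ey2 : fr y2 = y2 by apply: fr_id => //; lra.
have tx1 : `|x - y1| <= t.
  by rewrite ler_norml /t; apply/andP; case: hx => ->; split; lra.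
have tx2 : `|x - y2| <= t.
  by rewrite ler_norml /t; apply/andP; case: hx => ->; split; lra.
have sh n : fr (y2 + idot n w) = if fr (y1 + idot n w) + t < 1
    then fr (y1 + idot n w) + t else fr (y1 + idot n w) + t - 1.
  rewrite -fr_shift_cases // ?ltW //; congr fr; rewrite /t; ring.
pose cr n := ~~ (fr (y1 + idot n w) + t < 1).
pose X := [seq n <- C | cr n].
have far y n : n \in C -> 4 * th j <= `|fr (y + idot n w) - fr y|.
  move=> nC; apply: far_phase (hC _ nC); by apply: contraNneq zC => <-.
have thj := th_gt0 j.
have neg n : n \in C -> negphase y2 n = negphase y1 n || cr n /\ ~~ (negphase y1 n && cr n).
  move=> nC; have := far y1 n nC; have := far y2 n nC; rewrite ey1 ey2 /negphase /cr sh.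
  have dt : y2 = y1 + t by rewrite /t; ring.
  move=> f2 f1; apply: (@phase_index _ (fr (y1 + idot n w)) (th j) t y1 x);
    rewrite ?fr_ge0 ?fr_lt1 -?dt //.
apply: (@index_comparison _ _ (Msys y1 E1) (Msys y2 E2) C1 C2 0 X (negphase y1) (negphase y2)) => //.
- rewrite rcons_uniq -(perm_mem pC1) -(perm_uniq pC1); exact: uC.
- by rewrite -(permPl pC1).
- exact: Msys_sym.
- exact: Msys_sym.
- by move=> m n mn; rewrite /Msys (negbTE mn).
- move=> n; rewrite mem_rcons inE mem_filter -(perm_mem pC1) /Msys eqxx => nC nX.
  have nc : fr (y1 + idot n w) + t < 1.
    case/orP: nC => [/eqP ->|nC]; first by rewrite idot0 addr0 ey1 /t; lra.
    by move: nX; rewrite nC andbT negbK.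
  have hA : fr (y1 + idot n w) <= fr (y1 + idot n w) + t by rewrite lerDl ltW.
  have := g_mono (fr_ge0 (y1 + idot n w)) hA nc; rewrite sh nc.
  have -> : fr (y1 + idot n w) + t - fr (y1 + idot n w) = t by ring.
  by move: hE; lra.
- rewrite size_filter.
  have -> : count (negphase y1) C1 = count (negphase y1) C by apply/esym/permP.
  have -> : count (negphase y2) C1 = count (negphase y2) C by apply/esym/permP.
  rewrite -count_predUI.
  rewrite [X in (_ + X)%N](@eq_in_count _ _ pred0) ?count_pred0 ?addn0.
    by rewrite -(@eq_in_count _ (negphase y2)) // => n /neg [].
  by move=> n /neg [_ /negbTE].
Qed.

Lemma index_Cset j (z y1 y2 E1 E2 : R) N phi1 phi2 : `|fr z - x| < th j -> (j < K)%N ->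
  (N <= 2 ^ j.+2)%N -> 0 <= y1 -> y1 < y2 -> y2 < 1 ->
  (y1 = x /\ y2 = z) \/ (y1 = z /\ y2 = x) ->
  y2 - y1 < th j -> E2 - E1 <= (y2 - y1) `^ alpha ->
  (forall s, (s <= j)%N -> Piv E1 s) -> (forall s, (s <= j)%N -> Piv E2 s) ->
  solves (Msys y1 E1) (Cset z N) 0 phi1 -> solves (Msys y2 E2) (Cset z N) 0 phi2 ->
  0 <= mvec (Msys y1 E1) (0 :: Cset z N) phi1 0 ->
  0 <= mvec (Msys y2 E2) (0 :: Cset z N) phi2 0.
Proof.
move=> zj jK Nj y10 y12 y21 hy tj hE P1 P2 h1 h2.
have o1 : y1 = x \/ y1 = z by case: hy => -[-> _]; [left|right].
have o2 : y2 = x \/ y2 = z by case: hy => -[_ ->]; [right|left].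
have [e1 s1] := Cset_env zj jK o1 Nj; have [e2 s2] := Cset_env zj jK o2 Nj.
have [C1 p1 [d1 q1]] := @elim_pivots E1 _ _ _ e1 (fun v C1 vC e f _ =>
   P1 _ (s1 v vC) y1 v C1 erefl e f).
have [C2 p2 [d2 q2]] := @elim_pivots E2 _ _ _ e2 (fun v C1 vC e f _ =>
   P2 _ (s2 v vC) y2 v C1 erefl e f).
have f1 : mvec (Msys y1 E1) (0 :: Cset z N) phi1 0 = elim (Msys y1 E1) C1 0 0.
  rewrite -(solves_value (dominated_pivots d1) (solves_perm p1 h1)).
  by apply: mvec_perm; rewrite perm_cons.
have f2 : mvec (Msys y2 E2) (0 :: Cset z N) phi2 0 = elim (Msys y2 E2) C2 0 0.
  rewrite -(solves_value (dominated_pivots d2) (solves_perm p2 h2)).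
  by apply: mvec_perm; rewrite perm_cons.
rewrite f1 f2; apply: (@index_sites j _ _ _ _ (Cset z N)) => //.
- by case: hy => -[-> ->]; [left|right].
- exact: uniq_Cset.
- move=> n; rewrite mem_Cset => /andP [_ h].
  by apply: leq_trans Nj; apply: leq_trans h; rewrite leq_addr.
- exact: sg_pivot_sign.
- exact: sg_pivot_sign.
Qed.

Lemma Msys_fr z E : Msys (fr z) E = Msys z E.
Proof. by apply/funext => m; apply/funext => n; rewrite /Msys fr_addl. Qed.

Lemma fr_fr (z : R) : fr (fr z) = fr z.
Proof. by rewrite fr_id ?fr_ge0 ?fr_lt1. Qed.

Lemma site_fr z : site (fr z) = site z.
Proof. by apply/funext => n; rewrite /site /sc fr_addl. Qed.

Lemma low_solution z j y N E' : `|fr z - x| < th j -> (j < K)%N -> (N <= 2 ^ j.+2)%N ->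
  y = x \/ y = z -> (forall s, (s <= j)%N -> Piv E' s) ->
  exists2 phi, solves (Msys y E') (Cset z N) 0 phi & forall m, `|phi m| <= qq ^+ l1 m.
Proof.
move=> zj jK Nj hy hP; have [e s] := Cset_env zj jK hy Nj.
have [[phi h1] h2] := @env_solution_low E' _ _ _ e (fun s' h =>
  let: ex_intro2 n nC hn := h in hP s' (eq_ind _ (fun k => (k <= j)%N) (s n nC) _ hn)).
by exists phi => // m; have := h2 _ h1 m; rewrite subr0.
Qed.

Lemma Cset_sub z N : {subset Cset z N <= Cset x N}.
Proof.
move=> n; rewrite !mem_Cset => /andP [-> h] /=; apply: leq_trans h.
rewrite leq_add2l leq_mul2l /= /mxs maxnn.
move: (leq_maxl (site x n) (site z n)).
by case: (site x n) => [//|a]; case: (maxn _ _) => [//|b] /=; rewrite ltnS leq_exp2l.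
Qed.

Lemma kap_le_pow j : (kap j.+1 <= 2 ^ j.+2)%N.
Proof. exact: ltnW (kap_lt j). Qed.

Lemma x_near j : `|fr x - x| < th j.
Proof. by rewrite fr_x subrr normr0. Qed.

(** At energy [E] the last pivot at [x] is small, and its slope is at least 1/2 in absolute value,
    so it is positive at [E - 4 * w1] and negative at [E + 4 * w1]. The comparison of indices
    transports this sign to [z] at the energy shifted the other way, as [8 * w1] is at most the
    increment of the potential. Returning to [E] adds at least [2 * w1] with the right sign. *)
Lemma piv_local j E phi0 z C phi : (j.+1 < K)%N -> 0 <= z -> z < 1 ->
  th j.+1 <= `|z - x| -> `|z - x| < th j ->
  (forall E', `|E' - E| <= 4 * wv j.+1 -> forall s, (s <= j)%N -> Piv E' s) ->
  solves (Msys x E) (Cset x (kap j.+1)) 0 phi0 ->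
  `|mvec (Msys x E) (0 :: Cset x (kap j.+1)) phi0 0| <= 3 / 2 * wv j.+1 ->
  uniq (0 :: C) -> (forall n, n != 0 -> (l1 n <= kap j.+1)%N -> n \in C) ->
  solves (Msys z E) C 0 phi -> (forall m, `|phi m| <= qq ^+ l1 m) ->
  wv j.+1 <= (if x <= z then 1 else -1) * mvec (Msys z E) (0 :: C) phi 0.
Proof.
move=> jK z0 z1 zge zlt hlow h0 F0 uC fC hphi dphi.
have fz : fr z = z by apply: fr_id.
have zj : `|fr z - x| < th j by rewrite fz.
have jK' : (j < K)%N := ltnW jK.
have kj := kap_le_pow j.
set w1 := wv j.+1 in F0 hlow *.
have w0 : 0 < w1 := wv_gt0 _.
pose C' := Cset z (kap j.+1).
have uC' : uniq (0 :: C') := uniq_Cset _ _.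
have sub : {subset C' <= C}.
  move=> n; rewrite mem_Cset => /andP [n0 h]; apply: fC => //.
  by apply: leq_trans h; rewrite leq_addr.
have hE : `|E - E| <= 4 * w1 by rewrite subrr normr0 mulr_ge0 // ltW.
have hEp : `|(E + 4 * w1) - E| <= 4 * w1.
  by rewrite addrAC subrr add0r ger0_norm // mulr_ge0 // ltW.
have hEm : `|(E - 4 * w1) - E| <= 4 * w1.
  by rewrite addrAC subrr add0r normrN ger0_norm // mulr_ge0 // ltW.
have d0 : forall m, `|phi0 m| <= qq ^+ l1 m.
  have [e s] := Cset_env (x_near j) jK' (or_introl erefl) kj.
  have [_ h2] := @env_solution_low E _ _ _ e (fun s' h =>
    let: ex_intro2 n nC hn := h in
    hlow _ hE s' (eq_ind _ (fun k => (k <= j)%N) (s n nC) _ hn)).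
  by move=> m; have := h2 _ h0 m; rewrite subr0.
have [phx hx dx] := low_solution zj jK' kj (or_introl erefl) (hlow _ hE).
have [phz hz dz] := low_solution zj jK' kj (or_intror erefl) (hlow _ hE).
(* Passing from the set attached to [x] to the smaller one common to [x] and [z] costs at most
   [w1 / 16]. *)
have Fx : `|mvec (Msys x E) (0 :: C') phx 0| <= (3 / 2 + 1 / 16) * w1.
  have := compare_tiny (s := j.+1) (uniq_Cset _ _) uC' (@Cset_sub z _) h0 hx d0 dx
    (fun n n0 nC => Cset_compl zj n0 nC kj).
  move: F0; rewrite -/w1 !ler_norml => /andP [a1 a2] /andP [b1 b2]; apply/andP; split; lra.
have Fz : `|mvec (Msys z E) (0 :: C) phi 0 - mvec (Msys z E) (0 :: C') phz 0| <= w1 / 16.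
  exact: (compare_tiny (s := j.+1) uC uC' sub hphi hz dphi dz
    (fun n n0 nC => Cset_compl zj n0 nC kj)).
have h8 : 8 * w1 <= `|z - x| `^ alpha.
  have -> : 8 * w1 = hh j.+1 by rewrite /w1 /wv; field.
  by apply: ge0_ler_powR; rewrite ?nnegrE // ?(ltW (th_gt0 _)) // (le_trans ler01).
move: Fx Fz; rewrite !ler_norml => /andP [fx1 fx2] /andP [fz1 fz2].
case: (leP x z) => hxz.
- have xz : x < z.
    rewrite lt_neqAle hxz andbT; apply: contraTneq zge => ->.
    by rewrite subrr normr0 -ltNge.
  rewrite ger0_norm ?subr_ge0 // in h8; rewrite ger0_norm ?subr_ge0 // in zlt.
  have [p1 g1 e1] := low_solution zj jK' kj (or_introl erefl) (hlow _ hEm).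
  have [p2 g2 e2] := low_solution zj jK' kj (or_intror erefl) (hlow _ hEp).
  have [s [s1 s2 hs]] := compare_slope uC' hx g1 dx e1.
  have [t [t1 t2 ht]] := compare_slope uC' hz g2 dz e2.
  have := @index_Cset j z x z (E - 4 * w1) (E + 4 * w1) (kap j.+1) p1 p2 zj jK' kj x_ge0 xz z1
    (or_introl (conj erefl erefl)) zlt _ (hlow _ hEm) (hlow _ hEp) g1 g2.
  rewrite -/C'.
  have q1 : E + 4 * w1 - (E - 4 * w1) <= (z - x) `^ alpha by lra.
  move/(_ q1).
  move: ht hs fx1 fz1 fx2 fz2.
  move: (mvec _ _ p2 0) (mvec _ _ p1 0) (mvec _ _ phz 0) (mvec _ _ phx 0) (mvec _ _ phi 0).
  move=> a b c e f ht hs fx1 fz1 fx2 fz2 hi.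
  have hb : 0 <= b by nra.
  have := hi hb; nra.
- rewrite ltr0_norm ?subr_lt0 // opprB in h8; rewrite ltr0_norm ?subr_lt0 // opprB in zlt.
  have [p1 g1 e1] := low_solution zj jK' kj (or_introl erefl) (hlow _ hEp).
  have [p2 g2 e2] := low_solution zj jK' kj (or_intror erefl) (hlow _ hEm).
  have [s [s1 s2 hs]] := compare_slope uC' hx g1 dx e1.
  have [t [t1 t2 ht]] := compare_slope uC' hz g2 dz e2.
  have := @index_Cset j z z x (E - 4 * w1) (E + 4 * w1) (kap j.+1) p2 p1 zj jK' kj z0 hxz x_lt1
    (or_intror (conj erefl erefl)) zlt _ (hlow _ hEm) (hlow _ hEp) g2 g1.
  rewrite -/C'.
  have q1 : E + 4 * w1 - (E - 4 * w1) <= (x - z) `^ alpha by lra.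
  move/(_ q1).
  move: ht hs fx1 fz1 fx2 fz2.
  move: (mvec _ _ p2 0) (mvec _ _ p1 0) (mvec _ _ phz 0) (mvec _ _ phx 0) (mvec _ _ phi 0).
  move=> a b c e f ht hs fx1 fz1 fx2 fz2 hi.
  have hb : b < 0 by nra.
  have ha : a < 0 by rewrite ltNge; apply/negP => /hi; rewrite leNgt hb.
  nra.
Qed.

(** Decay on [C] involves pivots of sites of the same scale [s], but their environments are strictly
    smaller than [C]: hence an induction on the size, after such a site is moved to the origin. *)
Lemma piv_by_size E s :
  (forall z C phi, 0 <= z -> z < 1 -> sc z = s -> env z 0 C -> full z 0 C ->
     solves (Msys z E) C 0 phi -> (forall m, `|phi m| <= qq ^+ l1 m) ->
     wv s <= (if x <= z then 1 else -1) * mvec (Msys z E) (0 :: C) phi 0) ->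
  (forall s', (s' < s)%N -> Piv E s') -> Piv E s.
Proof.
move=> hloc hlow.
have main N z C : (size C < N)%N -> site z 0 = s -> env z 0 C -> full z 0 C ->
    pivprop E z 0 C.
  elim: N z C => [//|N IH] z C hN hs he hf phi hphi.
  move: (he) (hf) => [uC aC sC kC] [kz fC].
  have [_ dphi] : (exists phi, solves (Msys z E) C 0 phi) /\
    (forall phi, solves (Msys z E) C 0 phi -> forall n, `|phi n| <= qq ^+ l1 (n - 0)).
    apply: env_solution => // v C1 vC e f sz.
    case: (ltngtP (site z v) s) => hv.
    + exact: (hlow _ hv _ _ _ erefl e f).
    + by have := sC _ vC; rewrite hs leqNgt hv.
    + apply: (pivprop_shift _ e f) => e' f'; apply: IH => //; last by rewrite site_ge.
      by rewrite size_map; apply: leq_trans sz _.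
  have := hloc (fr z) C phi (fr_ge0 z) (fr_lt1 z).
  rewrite Msys_fr hs idot0 addr0 /sg; apply => //.
  + by rewrite -hs /site idot0 addr0 /sc fr_fr.
  + by rewrite /env /adm site_fr.
  + by rewrite /full site_fr.
  + by move=> m; have := dphi _ hphi m; rewrite subr0.
move=> z r C hs he hf; apply: (pivprop_shift _ he hf) => he' hf'.
by apply: (main (size C).+1) => //; rewrite ?size_map ?site_ge.
Qed.

Lemma piv_step j E phi0 : (j.+1 < K)%N ->
  (forall E', `|E' - E| <= 4 * wv j.+1 -> forall s, (s <= j)%N -> Piv E' s) ->
  solves (Msys x E) (Cset x (kap j.+1)) 0 phi0 ->
  `|mvec (Msys x E) (0 :: Cset x (kap j.+1)) phi0 0| <= 3 / 2 * wv j.+1 ->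
  Piv E j.+1.
Proof.
move=> jK hlow h0 F0.
apply: piv_by_size => [z C phi z0 z1 hs [uC _ _ _] [_ fC] hphi dphi|s hs]; last first.
  by apply: hlow => //; rewrite subrr normr0 mulr_ge0 // ltW // wv_gt0.
have fz : fr z = z by apply: fr_id.
apply: (@piv_local j E phi0 z C phi) => //.
- by have := @sc_ge z; rewrite fz hs => /(_ jK).
- by have := @sc_lt z j; rewrite fz hs => /(_ (leqnn _)).
- move=> n n0 hn; apply: fC => //; by rewrite subr0 /site idot0 addr0 hs.
Qed.

Lemma eps_wv0 : (2 * d)%:R * eps <= wv 0.
Proof.
apply: le_trans eps_small; rewrite ler_wpM2l // ler_peMr ?ltW // -expR0 ltr_expR.
exact: lt_le_trans gi_gt0 (gam_ge 0).
Qed.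

(** At scale 0 the potential decides: it differs from [g x] by at least [8 * wv 0], against an error
    [wv 0] in the energy and one of [2 * d * eps <= wv 0] from the hopping. *)
Lemma piv_base E : (0 < K)%N -> `|E - g x| <= wv 0 -> Piv E 0.
Proof.
move=> K0 hE; apply: piv_by_size => // z C phi z0 z1 hs [uC _ _ _] _ hphi dphi.
have fz : fr z = z by apply: fr_id.
have hz : th 0 <= `|z - x| by have := @sc_ge z; rewrite fz hs => /(_ K0).
have := F_near uC hphi dphi; rewrite fz => hF.
have h8 : 8 * wv 0 <= `|z - x| `^ alpha.
  have -> : 8 * wv 0 = hh 0 by rewrite /wv; field.
  by apply: ge0_ler_powR; rewrite ?nnegrE // ?(ltW (th_gt0 _)) // (le_trans ler01).
have w0 := wv_gt0 0; have e0 := eps_wv0.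
move: hE hF; rewrite !ler_norml => /andP [a1 a2] /andP [b1 b2].
case: (leP x z) => hxz.
  rewrite ger0_norm ?subr_ge0 // in h8; have := g_mono x_ge0 hxz z1; lra.
rewrite ltr0_norm ?subr_lt0 // opprB in h8; have := g_mono z0 (ltW hxz) x_lt1; lra.
Qed.

(** [E] is a Dirichlet eigenvalue on [0 :: Cset x (kap k)] with eigenvector [phi]. The pivots are
    controlled in a whole window because the next stage moves the energy and [piv_local] shifts
    it. *)
Definition stage k E phi :=
  [/\ solves (Msys x E) (Cset x (kap k)) 0 phi,
      mvec (Msys x E) (0 :: Cset x (kap k)) phi 0 = 0
    & forall E', `|E' - E| <= wv k -> forall s, (s <= k)%N -> Piv E' s].

Lemma stage0 : (0 < K)%N -> stage 0 (g x) (fun n => (n == 0)%:R).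
Proof.
move=> K0; have C0 : Cset x (kap 0) = [::].
  case e : (Cset _ _) => [//|a l]; have : a \in Cset x (kap 0) by rewrite e mem_head.
  by rewrite mem_Cset leqn0 addn_eq0 l1_eq0 => /andP [/negbTE ->].
rewrite /stage C0; split.
- by split=> [|n|//]; rewrite ?eqxx // inE => /norP [/negbTE ->].
- by rewrite /mvec big_seq1 /Msys !eqxx idot0 addr0 fr_x subrr mul0r.
- by move=> E' hE s; rewrite leqn0 => /eqP ->; apply: piv_base.
Qed.

Lemma lipschitz_root (G : R -> R) (a b L : R) : a <= b ->
  (forall u v, a <= u <= b -> a <= v <= b -> `|G u - G v| <= L * `|u - v|) ->
  0 <= G a -> G b <= 0 -> exists2 c, a <= c <= b & G c = 0.
Proof.
move=> ab hG Ga Gb.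
have cG : {within `[a, b]%classic, continuous G}.
  (* Nothing is known about [G] outside the interval; composing with this 1-Lipschitz retraction
     gives a continuous function on the line. *)
  pose cl u := Num.max a (Num.min b u).
  have hcl u : a <= cl u <= b by rewrite /cl le_max lexx ge_max ab ge_min lexx.
  have cl_id u : a <= u <= b -> cl u = u.
    by move=> /andP [h1 h2]; rewrite /cl min_r // max_r.
  have cl_cases u : [\/ u < a /\ cl u = a, a <= u <= b /\ cl u = u | b < u /\ cl u = b].
    case: (ltP u a) => h1; first by constructor 1; rewrite /cl max_l // ge_min (ltW h1) orbT.
    case: (leP u b) => h2; first by constructor 2; rewrite ?cl_id ?h1 ?h2.
    by constructor 3; rewrite /cl min_l ?ltW // max_r.
  have cl_lip u v : `|cl u - cl v| <= `|u - v|.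
    case: (lerP u v) => uv; rewrite ler_norml.
      by case: (cl_cases u) => -[h1 ->]; case: (cl_cases v) => -[h2 ->]; lra.
    by case: (cl_cases u) => -[h1 ->]; case: (cl_cases v) => -[h2 ->]; lra.
  apply: (@subspace_eq_continuous _ _ _ (G \o cl)).
    by move=> u; rewrite inE /= in_itv /= => h; rewrite cl_id.
  apply: continuous_subspaceT => u.
  apply/(@cvgrPdist_le _ R^o) => e e0.
  have L1 : 0 < `|L| + 1 by rewrite ltr_wpDl.
  near=> v; apply: le_trans (hG _ _ (hcl u) (hcl v)) _.
  apply: (@le_trans _ _ ((`|L| + 1) * `|u - v|)).
    apply: (@le_trans _ _ (`|L| * `|cl u - cl v|)); first by rewrite ler_wpM2r // ler_norm.
    by rewrite ler_pM // lerDl.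
  rewrite mulrC -ler_pdivlMr //; near: v.
  by apply: cvgr_dist_le => //; rewrite divr_gt0.
have [|c hc Gc] := IVT ab cG (v := 0); last by exists c; rewrite // -in_itv.
by rewrite ge_min Gb orbT le_max Ga.
Unshelve. all: by end_near. Qed.

Lemma wv_half k : 8 * wv k.+1 <= wv k.
Proof. by have := wv_dec k; lra. Qed.

Lemma stage_step k E phi : (k.+1 < K)%N -> stage k E phi -> exists E' phi', stage k.+1 E' phi'.
Proof.
move=> kK [h1 h2 h3]; have kK' := ltnW kK; have w0 := wv_gt0 k; have w1 := wv_gt0 k.+1.
have w8 := wv_half k.
have nx := x_near k; have kj := kap_le_pow k.
pose C := Cset x (kap k.+1); have uC : uniq (0 :: C) := uniq_Cset _ _.
have sol E' : `|E' - E| <= wv k ->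
    {ph | solves (Msys x E') C 0 ph /\ forall m, `|ph m| <= qq ^+ l1 m}.
  move=> hE; apply: cid.
  by have [ph a b] := low_solution nx kK' kj (or_introl erefl) (h3 _ hE); exists ph.
(* The last pivot on the enlarged set as a function of the energy; outside the window, where no
   solution is at hand, 0 is a default value. *)
pose G E' := if pselect (`|E' - E| <= wv k) is left h
  then mvec (Msys x E') (0 :: C) (sval (sol E' h)) 0 else 0.
have GP E' : `|E' - E| <= wv k -> exists ph, [/\ solves (Msys x E') C 0 ph,
    (forall m, `|ph m| <= qq ^+ l1 m) & G E' = mvec (Msys x E') (0 :: C) ph 0].
  move=> h; rewrite /G; case: pselect => // h'; exists (sval (sol E' h')).
  by case: (svalP (sol E' h')).
have slope E1 E2 : `|E1 - E| <= wv k -> `|E2 - E| <= wv k ->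
    exists s, [/\ 1 / 2 <= s, s <= 3 / 2 & G E1 = G E2 + (E2 - E1) * s].
  move=> /GP [p1 [a1 b1 ->]] /GP [p2 [a2 b2 ->]].
  exact: compare_slope uC a1 a2 b1 b2.
have EE : `|E - E| <= wv k by rewrite subrr normr0 ltW.
have GE : `|G E| <= wv k / 16.
  have [ph [a b ->]] := GP E EE.
  have -> : mvec (Msys x E) (0 :: C) ph 0 = mvec (Msys x E) (0 :: C) ph 0
     - mvec (Msys x E) (0 :: Cset x (kap k)) phi 0 by rewrite h2 subr0.
  have dphi : forall m, `|phi m| <= qq ^+ l1 m.
    have kj' : (kap k <= 2 ^ k.+2)%N.
      by apply: leq_trans kj; apply: leq_trans (kap2 k); rewrite leq_pmull.
    have [e s] := Cset_env nx kK' (or_introl erefl) kj'.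
    have [_ hd] := @env_solution_low E _ _ _ e (fun s' h =>
      let: ex_intro2 n nC hn := h in
      h3 _ EE s' (eq_ind _ (fun k' => (k' <= k)%N) (s n nC) _ hn)).
    by move=> m; have := hd _ h1 m; rewrite subr0.
  apply: (compare_tiny (s := k) uC (uniq_Cset _ _) _ a h1 b dphi).
    move=> n; rewrite !mem_Cset => /andP [-> h] /=; apply: leq_trans h _.
    by apply: leq_trans (kap2 k); rewrite leq_pmull.
  move=> n n0 nC; apply: (Cset_compl nx n0 nC).
  by apply: leq_trans kj; apply: leq_trans (kap2 k); rewrite leq_pmull.
have near u : E - wv k / 8 <= u <= E + wv k / 8 -> `|u - E| <= wv k.
  by rewrite ler_norml => /andP [a b]; apply/andP; split; lra.
(* The enlargement of the set changes the pivot by at most [wv k / 16]; with a slope of at least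
   1/2, a zero lies within [wv k / 8]. *)
have [E' hE' GE'] : exists2 c, E - wv k / 8 <= c <= E + wv k / 8 & G c = 0.
  have hm : `|(E - wv k / 8) - E| <= wv k by apply: near; lra.
  have hp : `|(E + wv k / 8) - E| <= wv k by apply: near; lra.
  move: GE; rewrite ler_norml => /andP [a b].
  apply: (@lipschitz_root G _ _ (3 / 2)); first by lra.
  - move=> u v /near hu /near hv; have [s [s1 s2 ->]] := slope _ _ hu hv.
    rewrite addrAC subrr add0r normrM mulrC distrC ler_wpM2r //.
    by rewrite ger0_norm //; lra.
  - have [s [s1 s2 ->]] := slope _ _ hm EE; nra.
  - have [s [s1 s2 ->]] := slope _ _ hp EE; nra.
have hE'' := near _ hE'.
have [ph [a b e]] := GP E' hE''; exists E', ph; split=> //; first by rewrite -e.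
move=> E2 hE2.
(* The new window [wv k.+1] and the shift [4 * wv k.+1] of [piv_step] must stay in the old window,
   together with the displacement [wv k / 8] of the zero. They do, since [8 * wv k.+1 <= wv k]. *)
have near2 E3 c : `|E3 - E2| <= c * wv k.+1 -> c <= 5 -> `|E3 - E| <= wv k.
  move: hE2 hE'; rewrite !ler_norml => /andP [c1 c2] /andP [c3 c4] /andP [c5 c6] c7.
  by apply/andP; split; nra.
have hE2' : `|E2 - E| <= wv k by apply: (near2 _ 0); rewrite ?subrr ?normr0 ?mul0r.
move=> s; rewrite leq_eqVlt ltnS => /orP [/eqP ->|]; last exact: h3.
have [ph2 [a2 b2 e2]] := GP E2 hE2'.
apply: (@piv_step k E2 ph2) => //.
  move=> E3 hE3; apply: h3; apply: near2 hE3 _; lra.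
rewrite -e2; have [t [t1 t2 ->]] := slope _ _ hE2' hE''.
rewrite GE' add0r normrM mulrC distrC; apply: ler_pM => //.
by rewrite ger0_norm //; lra.
Qed.

Lemma stage_exists k : (k < K)%N -> exists E phi, stage k E phi.
Proof.
elim: k => [|k IH] kK; first by exists (g x), (fun n => (n == 0)%:R); apply: stage0.
by have [E [phi h]] := IH (ltnW kK); apply: stage_step h.
Qed.

Lemma stage_decay k E phi : (k < K)%N -> stage k E phi ->
  (forall m, `|phi m| <= qq ^+ l1 m) /\ `|E - g x| <= (2 * d)%:R * eps.
Proof.
move=> kK [h1 h2 h3].
have EE : `|E - E| <= wv k by rewrite subrr normr0 ltW // wv_gt0.
have kj' : (kap k <= 2 ^ k.+2)%N.
  by apply: leq_trans (kap_le_pow k); apply: leq_trans (kap2 k); rewrite leq_pmull.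
have [e s] := Cset_env (x_near k) kK (or_introl erefl) kj'.
have [_ hd] := @env_solution_low E _ _ _ e (fun s' h =>
  let: ex_intro2 n nC hn := h in
  h3 _ EE s' (eq_ind _ (fun k' => (k' <= k)%N) (s n nC) _ hn)).
have dphi m : `|phi m| <= qq ^+ l1 m by have := hd _ h1 m; rewrite subr0.
split=> //; have := F_near (uniq_Cset _ _) h1 dphi.
by rewrite h2 sub0r opprB fr_x.
Qed.

End Reference.

Lemma wv_le i j : (i <= j)%N -> wv j <= wv i.
Proof.
move/subnK <-; elim: (j - i)%N => [|k IH]; rewrite ?add0n // addSn.
apply: le_trans IH; have := wv_half (k + i); have := wv_gt0 (k + i).+1; lra.
Qed.

(** At energy [Ex] the pivot of the phase [y] is at least [wv t], because [y] is separated from [x]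
    at some scale [t <= s]; at [Ey] it vanishes. The slope turns this into a gap of the energies, at
    least [2 / 3 * (15 / 16) * wv t]. *)
Lemma stage_mono x y K k s Ex Ey phx phy : 0 <= x -> x < y -> y < 1 ->
  (k < K)%N -> (s + 4 <= k)%N -> th s <= y - x ->
  stage x K k Ex phx -> stage y K k Ey phy -> wv s / 2 <= Ey - Ex.
Proof.
move=> x0 xy y1 kK sk ths [_ _ hx] [hy1 hy2 hy3].
have x1 : x < 1 by apply: lt_trans y1.
have y0 : 0 <= y by apply: le_trans x0 (ltW xy).
have fy : fr y = y by apply: fr_id.
have sK : (s < K)%N by apply: leq_trans kK; rewrite ltnS; apply: leq_trans sk; rewrite leq_addr.
have sy : (sc x K y <= s)%N by apply: sc_leP => //; rewrite fy ger0_norm // subr_ge0 ltW.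
set t := sc x K y in sy *.
have tK : (t < K)%N by apply: leq_ltn_trans sK.
have wt : wv s <= wv t by apply: wv_le.
have kk : (kap k <= 2 ^ k.+2)%N.
  by apply: leq_trans (kap_le_pow k); apply: leq_trans (kap2 k); rewrite leq_pmull.
have dy : forall m, `|phy m| <= qq ^+ l1 m.
  have st : stage y K k Ey phy by split.
  by have [] := stage_decay y0 y1 kK st.
have EE : `|Ex - Ex| <= wv k by rewrite subrr normr0 ltW // wv_gt0.
have hP i : (i <= t)%N -> Piv x K Ex i.
  move=> it; have ik : (i <= k)%N.
    by apply: leq_trans it _; apply: leq_trans sy _; apply: leq_trans sk; rewrite leq_addr.
  exact: hx EE _ ik.
have e0 : site x K y 0 = t by rewrite /site idot0 addr0.
have [C [phi [[uC subC far hphi dphi] hF]]] : exists C phi, [/\ uniq (0 :: C),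
   {subset C <= Cset y K y (kap k)}, (forall n, n != 0 -> n \notin C -> (kap t < 3 * l1 n)%N),
   solves (Msys y Ex) C 0 phi & (forall m, `|phi m| <= qq ^+ l1 m)] /\
   wv t <= mvec (Msys y Ex) (0 :: C) phi 0.
  case et : t => [|j].
    pose phi (n : T) : R := (n == 0)%:R.
    have hphi : solves (Msys y Ex) [::] 0 phi.
      split=> //; first by rewrite /phi eqxx.
      by move=> n; rewrite /phi mem_seq1 => /negbTE ->.
    exists [::], phi; split; first split=> //.
    - by move=> n n0 _; rewrite /= muln_gt0 l1_gt0.
    - move=> m; rewrite /phi; case: eqP => [->|_]; first by rewrite l1_0 normr1.
      by rewrite normr0 exprn_ge0 // ltW // qq_gt0.
    - have := hP 0%N (leq0n _) y 0 [::] _ _ _ phi hphi; rewrite idot0 addr0 /sg fy (ltW xy) mul1r.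
      rewrite e0 et; apply=> //.
      split; first by rewrite e0.
      by move=> n n0; rewrite e0 et subr0 leqn0 l1_eq0 (negbTE n0).
  have yj : `|fr y - x| < th j by apply: (@sc_lt x K); rewrite -/t et.
  have jK : (j < K)%N by rewrite -ltnS -et ltnW.
  (* With this radius the set contains the ball of radius [kap j.+1] and omits, besides the origin,
     only sites outside it. *)
  pose N := (3 * kap j.+1)%N.
  have Nj : (N <= 2 ^ j.+2)%N by rewrite /N /= 2!expnS mulnA leq_mul2r orbT.
  have [e hs] := Cset_env x0 x1 yj jK (or_intror erefl) Nj.
  have [phi h1 h2] := low_solution x0 x1 yj jK Nj (or_intror erefl)
    (fun i ij => hP i (leq_trans ij (leq_trans (leqnSn j) (eq_leq (esym et))))).
  have inC n : n != 0 -> (l1 n <= kap j.+1)%N -> n \in Cset x K y N.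
    move=> n0 hn; rewrite mem_Cset n0 /=.
    have hn' : (l1 n <= 2 ^ j.+2)%N by apply: leq_trans hn _; apply: kap_le_pow.
    have hk := kap_le_l1 K x0 x1 yj n0 hn'.
    by rewrite /N [leqRHS]mulSn leq_add // leq_mul2l /= (leq_trans hk).
  exists (Cset x K y N), phi; split; first split=> //.
  - exact: uniq_Cset.
  - move=> n; rewrite !mem_Cset => /andP [n0 hn]; rewrite n0 /=.
    have ln : (l1 n <= N)%N by apply: leq_trans hn; rewrite leq_addr.
    (* Here the gap 4 between [s] and [k] is used: [3 * N = 9 * 2 ^ j <= 2 ^ (j + 4) <= kap k]. *)
    have kN : (3 * N <= kap k)%N.
      have : (t + 4 <= k)%N by apply: leq_trans sk; rewrite leq_add2r.
      rewrite et; case: (k) => [//|k'] /=; rewrite addSn ltnS => jk.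
      apply: (@leq_trans (2 ^ (j + 4))); last by rewrite leq_exp2l.
      by rewrite /N /= mulnA expnD mulnC leq_mul2l orbT.
    have hk := kap_le_l1 K y0 y1 (x_near y0 y1 k) n0.
    have hk' : (kap (mxs y K y n) <= l1 n)%N.
      apply: hk; apply: leq_trans ln _; apply: leq_trans kk; apply: leq_trans kN.
      by rewrite leq_pmull.
    apply: leq_trans kN; apply: (@leq_trans (3 * l1 n)); last by rewrite leq_mul2l.
    by rewrite [leqRHS]mulSn leq_add2l leq_mul2l.
  - move=> n n0 nC; have := Cset_compl x0 x1 yj n0 nC Nj.
    by apply: leq_ltn_trans; rewrite leq_pmull.
  - have := hP t (leqnn _) y 0 (Cset x K y N) e0 e _ phi h1.
    rewrite e0 idot0 addr0 /sg fy (ltW xy) mul1r et; apply.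
    by split; rewrite e0 // => n n0; rewrite subr0 et; apply: inC.
have [r r1 hr] := compare (uniq_Cset _ _ _ _) uC subC hy1 hphi dy dphi.
have ht : (2 * d)%:R * eps * \sum_(n <- Cset y K y (kap k) | n \notin C) qq ^+ l1 n <= wv t / 16.
  rewrite -big_filter; apply: tiny.
    by rewrite filter_uniq //; have /andP [] := uniq_Cset y K y (kap k).
  move=> n; rewrite mem_filter mem_Cset => /andP [nC /andP [n0 _]]; split=> //; exact: far.
have := le_trans hr ht; move: r1; rewrite hy2 !ler_norml => /andP [r1 r2] /andP [r3 r4].
have wt0 := wv_gt0 t; move: hF wt r1 r2 r3 r4; move: (mvec _ _ phi 0) => F hF wt r1 r2 r3 r4.
have hq : 15 / 16 * wv t <= (Ey - Ex) * r by lra.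
have hp : 0 < Ey - Ex by nra.
nra.
Qed.

End Scheme.

(** * Choice of the constants *)

Section Constants.
Context {R : realType}.
Variables (d : nat) (alpha delta rho mu : R).
Hypotheses (hd : (1 <= d)%N) (halpha : 1 <= alpha) (hdelta0 : 0 < delta)
  (hdelta1 : delta < 1) (hrho : 0 < rho) (hmu : 0 < mu).

(** In [aa], the first summand is the Diophantine bound at radius [2 ^ j.+2], as
    [(2 ^ j.+2) ^ sp = bb ^ j.+2]; the second makes [hh] drop by a factor of at least [exp 3 >= 8]
    per scale. The ratio of consecutive [hh] is [exp (4 * c0 * bb ^ j)]; spread over the distance
    [2 ^ j.+2] it costs [c0 * rr ^ j] of the decay rate. *)
Let sp := 1 / (1 + mu).
Let bb := 2 `^ sp : R.
Let aa := rho * bb ^+ 2 + 3 / (bb - 1).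
Let rr := bb / 2.
Let c0 := alpha * aa * (bb - 1) / 4.

Definition thc j : R := 1 / 4 * expR (- aa * bb ^+ j).
(** The limiting rate plus all losses still to come, the tail of a geometric series. *)
Definition gamc gi j : R := gi + c0 * rr ^+ j / (1 - rr).
(** A rate strictly between the claimed [(1 - delta) * - ln eps] and [- ln eps], so that
    [eps * exp gi = eps ^ (delta / 2)] still tends to 0 and beats the constants in [eps_small_c]. *)
Definition gic eps : R := (1 - delta / 2) * - ln eps.

Lemma sp_gt0 : 0 < sp. Proof. by rewrite divr_gt0 // addr_gt0. Qed.
Lemma sp_lt1 : sp < 1. Proof. by rewrite ltr_pdivrMr ?addr_gt0 // mul1r ltrDl. Qed.
Lemma bbE : bb = expR (sp * ln 2). Proof. by rewrite /bb /powR pnatr_eq0. Qed.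
Lemma ln2_gt0 : 0 < ln (2 : R). Proof. by rewrite ln_gt0 // ltr1n. Qed.
Lemma bb_gt1 : 1 < bb.
Proof. by rewrite bbE -[ltLHS]expR0 ltr_expR mulr_gt0 ?sp_gt0 ?ln2_gt0. Qed.
Lemma bb_lt2 : bb < 2.
Proof. by rewrite bbE -[ltRHS]lnK ?posrE // ltr_expR gtr_pMl ?ln2_gt0 ?sp_lt1. Qed.
Lemma bb_gt0 : 0 < bb. Proof. exact: lt_trans bb_gt1. Qed.
Lemma bbX_ge1 j : 1 <= bb ^+ j. Proof. by rewrite exprn_ege1 // ltW // bb_gt1. Qed.
Lemma aa_gt0 : 0 < aa.
Proof.
apply: addr_gt0; first by rewrite mulr_gt0 // exprn_gt0 // bb_gt0.
by rewrite divr_gt0 // subr_gt0 bb_gt1.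
Qed.
Lemma aa_bb : 3 <= aa * (bb - 1).
Proof.
have b0 : 0 < bb - 1 by rewrite subr_gt0 bb_gt1.
rewrite -ler_pdivrMr // /aa lerDr mulr_ge0 ?exprn_ge0 ?ltW // bb_gt0 //.
Qed.
Lemma alpha_gt0 : 0 < alpha. Proof. exact: lt_le_trans halpha. Qed.
Lemma rr_gt0 : 0 < rr. Proof. by rewrite divr_gt0 ?bb_gt0. Qed.
Lemma rr_lt1 : rr < 1. Proof. by rewrite ltr_pdivrMr // mul1r bb_lt2. Qed.
Lemma c0_gt0 : 0 < c0.
Proof.
by rewrite divr_gt0 // mulr_gt0 ?subr_gt0 ?bb_gt1 // mulr_gt0 ?aa_gt0 ?alpha_gt0.
Qed.

Lemma thc_gt0 j : 0 < thc j. Proof. by rewrite mulr_gt0 ?expR_gt0 ?divr_gt0. Qed.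

Lemma thc_dec j : thc j.+1 <= thc j.
Proof.
rewrite ler_pM2l ?divr_gt0 // ler_expR !mulNr lerN2 ler_pM2l ?aa_gt0 //.
by rewrite exprS ler_peMl ?ltW ?bb_gt1 // exprn_gt0 // bb_gt0.
Qed.

Lemma hhc j : hh alpha thc j = (1 / 4) `^ alpha * expR (- (alpha * aa * bb ^+ j)).
Proof.
rewrite /hh /thc powRM ?expR_ge0 ?divr_ge0 //; congr (_ * _).
by rewrite /powR expR_eq0 expRK; congr expR; ring.
Qed.

Lemma hhc_step j : hh alpha thc j = hh alpha thc j.+1 * expR (4 * c0 * bb ^+ j).
Proof.
rewrite !hhc -[RHS]mulrA -[in RHS]expRD; congr (_ * expR _); rewrite /c0 exprS; by field.
Qed.

Lemma expR3 : 8 <= expR 3 :> R.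
Proof.
have -> : expR 3 = expR 1 ^+ 3 :> R by rewrite -expRM_natl mulr1.
have h : 2 <= expR 1 :> R by apply: le_trans (expR_ge1Dx _).
by apply: le_trans (_ : 2 ^+ 3 <= _); [rewrite -natrX|apply: lerXn2r; rewrite ?nnegrE ?expR_ge0].
Qed.

Lemma hhc_dec j : hh alpha thc j.+1 <= hh alpha thc j / 8.
Proof.
rewrite (hhc_step j) ler_pdivlMr // ler_wpM2l ?powR_ge0 //.
apply: le_trans expR3 _; rewrite ler_expR.
have -> : 4 * c0 = alpha * (aa * (bb - 1)) by rewrite /c0; field.
apply: le_trans aa_bb _.
have h0 : 0 <= aa * (bb - 1) by apply: le_trans aa_bb.
apply: le_trans (_ : alpha * (aa * (bb - 1)) <= _); first by rewrite ler_peMl.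
by rewrite ler_peMr ?bbX_ge1 // mulr_ge0 // ltW // alpha_gt0.
Qed.

Lemma wvc_gain gi j : wv alpha thc j <=
  wv alpha thc j.+1 * expR ((gamc gi j - gamc gi j.+1) * (2 ^ j.+2)%:R).
Proof.
rewrite /wv mulrAC ler_pM2r // (hhc_step j) ler_pM2l ?powR_gt0 ?thc_gt0 // ler_expR le_eqVlt.
apply/orP; left; apply/eqP.
have r1 : 1 - rr != 0 by rewrite subr_eq0 eq_sym lt_eqF // rr_lt1.
have -> : gamc gi j - gamc gi j.+1 = c0 * rr ^+ j by rewrite /gamc exprS; field.
by rewrite /rr expr_div_n natrX 2!exprS; field; rewrite ?expf_neq0.
Qed.

Lemma gamc_dec gi j : gamc gi j.+1 <= gamc gi j.
Proof.
rewrite /gamc lerD2l ler_pM2r ?invr_gt0 ?subr_gt0 ?rr_lt1 // ler_pM2l ?c0_gt0 //.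
by rewrite exprS ler_piMl ?exprn_ge0 ?ltW ?rr_gt0 ?rr_lt1.
Qed.

Lemma gamc_ge gi j : gi <= gamc gi j.
Proof.
rewrite lerDl; apply: divr_ge0; last by rewrite subr_ge0 ltW // rr_lt1.
by rewrite mulr_ge0 ?exprn_ge0 // ltW ?c0_gt0 ?rr_gt0.
Qed.

Lemma thc_sep (w : 'rV[R]_d) j n (k : int) : Omega rho mu w -> n != 0 ->
  (l1 n <= 2 ^ j.+2)%N -> 4 * thc j <= `|idot n w - k%:~R|.
Proof.
move=> [_ hw] n0 hn; apply: (@le_trans _ _ (dist_int (idot n w))); last first.
  apply: ge_inf; last by exists k.
  by exists 0 => _ [m _ <-].
apply: le_trans (hw n n0).
rewrite (_ : 4 * thc j = expR (- aa * bb ^+ j)); last by rewrite /thc; field.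
rewrite ler_expR !mulNr lerN2.
rewrite -/sp.
apply: (@le_trans _ _ (rho * bb ^+ 2 * bb ^+ j)); last first.
  rewrite ler_pM2r ?exprn_gt0 ?bb_gt0 // /aa lerDl; apply: divr_ge0 => //.
  by rewrite subr_ge0 ltW // bb_gt1.
rewrite -mulrA -exprD ler_pM2l // add2n.
have -> : bb ^+ j.+2 = (2 ^ j.+2)%:R `^ sp.
  rewrite /bb -powR_mulrn ?powR_ge0 // -!powRrM mulrC powRrM powR_mulrn ?natrX //.
by rewrite ge0_ler_powR ?nnegrE ?ler_nat // ltW // sp_gt0.
Qed.

Lemma expRN_le (y : R) : 0 < y -> expR (- y) <= 1 / y.
Proof.
move=> y0; rewrite expRN div1r lef_pV2 ?posrE ?expR_gt0 //.
by apply: le_trans (expR_ge1Dx y); rewrite lerDr.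
Qed.

Let w0 := wv alpha thc 0.
Let D : R := (2 * d)%:R.
(** Each summand is a lower bound imposed on [- ln eps]: the first for [eps_small_c], the second for
    [tiny_c], the next two for [eps_le] and [q_half], the last for positivity. *)
Definition biglog : R := 2 / delta * (D * expR (c0 / (1 - rr)) / w0) + 24 * alpha * aa
  + 64 * D + 32 * D / w0 + 1.
Definition eps0c : R := expR (- biglog).

Lemma eps0c_gt0 : 0 < eps0c. Proof. exact: expR_gt0. Qed.

Section Eps.
Variable eps : R.
Hypothesis (eps_gt0 : 0 < eps) (eps_lt : eps < eps0c).
Let L := - ln eps.
Let gi := gic eps.
Let q := qq gi.

Lemma D_ge2 : 2 <= D. Proof. by rewrite ler_nat leq_pmulr. Qed.
Lemma w0_gt0 : 0 < w0. Proof. by rewrite divr_gt0 ?powR_gt0 ?thc_gt0. Qed.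

Lemma L_gt : biglog < L.
Proof. by rewrite ltrNr -ltr_expR lnK ?posrE. Qed.

Lemma L_ge : [/\ 2 / delta * (D * expR (c0 / (1 - rr)) / w0) <= L, 24 * alpha * aa <= L,
  64 * D <= L, 32 * D / w0 <= L & 1 <= L].
Proof.
have := L_gt; rewrite /biglog.
have t1 : 0 <= 2 / delta * (D * expR (c0 / (1 - rr)) / w0).
  apply: mulr_ge0; first by rewrite divr_ge0 // ltW.
  by apply: divr_ge0; [rewrite mulr_ge0 ?expR_ge0|exact/ltW/w0_gt0].
have t2 : 0 <= 24 * alpha * aa.
  by rewrite !mulr_ge0 ?ltW ?aa_gt0 ?alpha_gt0.
have t3 : 0 <= 64 * D by rewrite mulr_ge0.
have t4 : 0 <= 32 * D / w0.
  by apply: divr_ge0; [rewrite mulr_ge0|exact/ltW/w0_gt0].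
move: (2 / delta * _) (24 * alpha * _) (64 * D) (32 * D / w0) t1 t2 t3 t4.
by move=> t1 t2 t3 t4 h1 h2 h3 h4 h; split; lra.
Qed.

Lemma gi_geL : L / 2 <= gi.
Proof.
have [_ _ _ _ h] := L_ge; rewrite /gi /gic -/L.
have : 0 <= (1 - delta) * L by rewrite mulr_ge0 ?subr_ge0 ?(ltW hdelta1) //; lra.
by lra.
Qed.

Lemma gic_gt0 : 0 < gi.
Proof. have [_ _ _ _ h] := L_ge; have := gi_geL; lra. Qed.

Lemma epsE : eps = expR (- L). Proof. by rewrite opprK lnK ?posrE. Qed.

Lemma eps_le : D * eps <= w0 / 16 /\ D * eps <= 1 / 64.
Proof.
have [_ _ h3 h4 h5] := L_ge; have L0 : 0 < L by lra.
have := expRN_le L0; rewrite -epsE => h.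
have w1 := w0_gt0; have D2 := D_ge2.
have D0 : 0 < D by lra.
have hL : D * eps <= D / L by rewrite ler_pM2l // -[leRHS]div1r.
split; apply: le_trans hL _.
  by move: h4; rewrite ler_pdivrMr // => h4; rewrite ler_pdivrMr //; lra.
by rewrite ler_pdivrMr //; lra.
Qed.

Lemma eps_small_c : (2 * d)%:R * (eps * expR (gamc gi 0)) <= w0.
Proof.
have [h1 _ _ _ h5] := L_ge; have L0 : 0 < L by lra.
have -> : eps * expR (gamc gi 0) = expR (- (delta / 2 * L)) * expR (c0 / (1 - rr)).
  rewrite /gamc expr0 mulr1 /gi /gic -/L {1}epsE -!expRD; congr expR; lra.
have y0 : 0 < delta / 2 * L by rewrite mulr_gt0 // divr_gt0.
have h := expRN_le y0.
rewrite mulrCA mulrC -/D.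
have w1 := w0_gt0.
have A0 : 0 < D * expR (c0 / (1 - rr)) by rewrite mulr_gt0 ?expR_gt0 // (lt_le_trans _ D_ge2).
move: h1 A0; set A := D * expR _ => h1 A0.
apply: (@le_trans _ _ (1 / (delta / 2 * L) * A)).
  by rewrite mulrC ler_pM2r.
rewrite mul1r mulrC ler_pdivrMr //.
have : A / w0 <= delta / 2 * L.
  have -> : A / w0 = delta / 2 * (2 / delta * (A / w0)) by field; rewrite !gt_eqF.
  by rewrite ler_pM2l // divr_gt0.
by rewrite ler_pdivrMr // mulrC.
Qed.

Lemma q_gt0 : 0 < q. Proof. exact: expR_gt0. Qed.

Lemma q_half : expR (- (gi / 2)) * D <= 1 / 16.
Proof.
have [_ _ h3 _ h5] := L_ge; have gL := gi_geL.
have y0 : 0 < gi / 2 by lra.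
have := expRN_le y0; have D2 := D_ge2 => h.
apply: (@le_trans _ _ (1 / (gi / 2) * D)); first by rewrite ler_pM2r //; lra.
by rewrite mulrAC mul1r ler_pdivrMr //; lra.
Qed.

Lemma q_le : q *+ (4 * d) <= 1 / 8.
Proof.
have h := q_half; have D2 := D_ge2.
have h' : q <= expR (- (gi / 2)) by rewrite ler_expR lerN2; have := gic_gt0; lra.
have -> : q *+ (4 * d) = 2 * (q * D).
  by rewrite -mulr_natr /D !natrM; ring.
have : q * D <= expR (- (gi / 2)) * D by rewrite ler_pM2r //; lra.
by lra.
Qed.

Lemma q_le1 : q <= 1.
Proof. by rewrite /q /qq -expR0 ler_expR oppr_le0 ltW // gic_gt0. Qed.

Lemma q2_le : q ^+ 2 *+ (4 * d) <= 1 / 2.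
Proof.
have h := q_le; have q0 := q_gt0; have q1 := q_le1.
apply: (@le_trans _ _ (q *+ (4 * d))); last by lra.
by rewrite lerMn2r expr2 ler_piMl ?orbT // ltW.
Qed.

Lemma tiny_c s (U : seq 'rV[int]_d) : uniq U ->
  (forall n : 'rV[int]_d, n \in U -> n != 0 /\ (kap s < 3 * l1 n)%N) ->
  (2 * d)%:R * eps * \sum_(n <- U) q ^+ l1 n <= wv alpha thc s / 16.
Proof.
move=> uU hU; have [_ h2 _ _ _] := L_ge; have gL := gi_geL.
(* The decay is split as [q = p ^ 3 * p ^ 3]: one factor is summed over the lattice, the other
   yields [p ^ kap s] because [kap s < 3 * l1 n]. *)
pose p := expR (- (gi / 6)).
have p0 : 0 < p := expR_gt0 _.
have p1 : p <= 1 by rewrite /p -expR0 ler_expR oppr_le0 divr_ge0 // ltW // gic_gt0.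
have qp : q = p ^+ 3 * p ^+ 3 by rewrite -exprD /p -expRM_natl /q /qq; congr expR; field.
have p3 : p ^+ 3 = expR (- (gi / 2)) by rewrite /p -expRM_natl; congr expR; field.
have hp3 : (p ^+ 3) *+ (4 * d) <= 1.
  have := q_half; rewrite -p3 => h.
  have -> : (p ^+ 3) *+ (4 * d) = 2 * (p ^+ 3 * D) by rewrite -mulr_natr /D !natrM; ring.
  by lra.
have sum1 : \sum_(n <- U) q ^+ l1 n <= p ^+ kap s.
  apply: (@le_trans _ _ (p ^+ kap s * \sum_(n <- U | n != 0) (p ^+ 3) ^+ l1 n)).
    rewrite mulr_sumr big_seq [leRHS]big_seq_cond.
    rewrite [leRHS](eq_bigl (fun n => n \in U)).
      apply: ler_sum => n /hU [_ hn]; rewrite qp exprMn ler_pM2r ?exprn_gt0 //.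
      rewrite -exprM; apply: ler_wiXn2l => //; [exact: ltW|exact: ltnW].
    by move=> n; case nU : (n \in U) => //=; have [] := hU n nU.
  rewrite -[leRHS]mulr1 ler_pM2l ?exprn_gt0 //.
  by apply: le_trans (lattice_sum_le _ hp3 uU) hp3; rewrite exprn_ge0 // ltW.
have [e1 _] := eps_le.
have De : 0 <= (2 * d)%:R * eps by rewrite mulr_ge0 // ltW.
apply: le_trans (ler_wpM2l De sum1) _.
apply: le_trans (_ : w0 / 16 * p ^+ kap s <= _); first by rewrite ler_pM2r // exprn_gt0.
rewrite mulrAC ler_pM2r // /w0 /wv mulrAC ler_pM2r // !hhc expr0 mulr1 -[leLHS]mulrA.
rewrite ler_pM2l ?powR_gt0 ?divr_gt0 // /p -expRM_natl -expRD ler_expR.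
rewrite -subr_ge0.
(* Here [bb < 2] enters: the exponent of the pivots grows at most linearly in [kap s]. *)
have hb : bb ^+ s <= 1 + 2 * (kap s)%:R.
  case: s {hU sum1} => [|s] /=; first by rewrite expr0 mulr0 addr0.
  apply: (@le_trans _ _ (2 ^+ s.+1)).
    by apply: lerXn2r; rewrite ?nnegrE ?ltW ?bb_gt0 ?bb_lt2.
  by rewrite exprS natrX lerDr.
have k0 : 0 <= (kap s)%:R :> R by [].
have aa0 : 0 < alpha * aa by rewrite mulr_gt0 ?alpha_gt0 ?aa_gt0.
have := ler_wpM2l (ltW aa0) hb.
have g12 : 12 * (alpha * aa) <= gi by lra.
have := ler_wpM2r k0 g12; rewrite mulrDr; lra.
Qed.

Lemma q_powR m : q ^+ m <= eps `^ ((1 - delta) * m%:R).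
Proof.
rewrite /q /qq -expRM_natl /powR gt_eqF // ler_expR.
have [_ _ _ _ h5] := L_ge; have -> : ln eps = - L by rewrite opprK.
have h : 0 <= m%:R * (delta / 2 * L).
  by rewrite mulr_ge0 // mulr_ge0 ?divr_ge0 ?(ltW hdelta0) //; lra.
by rewrite /gi /gic -/L; lra.
Qed.

(** The choice of [gic] gives [q ^ 2 = eps * eps ^ (1 - delta)], and the spare factor [eps] absorbs
    [4 * d]. *)
Lemma q2_powR : q ^+ 2 *+ (4 * d) < eps `^ (1 - delta).
Proof.
have e : eps `^ (1 - delta) = expR (- ((1 - delta) * L)).
  by rewrite /powR gt_eqF //; congr expR; rewrite mulrN opprK.
have -> : q ^+ 2 *+ (4 * d) = (2 * (D * eps)) * expR (- ((1 - delta) * L)).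
  have -> : q ^+ 2 = eps * expR (- ((1 - delta) * L)).
    rewrite /q /qq -expRM_natl {1}epsE -expRD; congr expR; rewrite /gi /gic -/L; by field.
  by rewrite -mulr_natr /D !natrM; ring.
have [_ h] := eps_le; rewrite e gtr_pMl ?expR_gt0 //; lra.
Qed.

End Eps.
End Constants.

(** * Infinite volume *)

Section UltraLimits.
Context {R : realType} {I : Type}.
Implicit Types (U : set_system I) (u : I -> R).

Lemma ultra_bounded U u (C : R) : UltraFilter U -> U [set i | `|u i| <= C] ->
  exists l : R, u @ U --> l.
Proof.
move=> UU hC; have PU : ProperFilter U by apply: ultra_proper.
have hI : (u @ U) `[- C, C]%classic.
  by apply: (@filterS _ U _ [set i | `|u i| <= C]) => // i /= h; rewrite in_itv /= -ler_norml.
have [p [_ hp]] := @segment_compact R (- C) C (u @ U) _ hI.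
exists p => B Bp /=.
have [//|nB] := in_ultra_setVsetC (u @^-1` B) UU.
have [y [h1 h2]] := hp (~` B) B nB Bp.
by case: (h1 h2).
Qed.

Lemma ultra_unique U u (l l' : R) : UltraFilter U -> u @ U --> l -> u @ U --> l' -> l = l'.
Proof. move=> UU; have PU : ProperFilter U by apply: ultra_proper.
exact: cvg_unique. Qed.

Lemma ultra_norm_le U u (l C : R) : UltraFilter U -> U [set i | `|u i| <= C] ->
  u @ U --> l -> `|l| <= C.
Proof.
move=> UU h hl; have PU : ProperFilter U by apply: ultra_proper.
have hn : (fun i => `|u i|) @ U --> `|l| by apply: cvg_norm.
exact: cvgr_to_le hn h.
Qed.

Lemma ultra_cvg_dist U u (l : R) : UltraFilter U ->
  u @ U --> l <-> forall e : R, 0 < e -> U [set i | `|u i - l| < e].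
Proof.
move=> UU; have PU : ProperFilter U by apply: ultra_proper.
split.
  move=> /cvgrPdist_lt h e e0; apply: filterS (h e e0) => i /=.
  by rewrite distrC.
move=> h; apply/cvgrPdist_lt => e e0; apply: filterS (h e e0) => i /=.
by rewrite distrC.
Qed.

Lemma ultra_eq0 U u (l : R) : UltraFilter U -> U [set i | u i = 0] -> u @ U --> l -> l = 0.
Proof.
move=> UU h hl; apply/eqP; rewrite -normr_le0.
by apply: ultra_norm_le hl; apply: filterS h => i /= ->; rewrite normr0.
Qed.
End UltraLimits.

Lemma nbrs_uniq {d : nat} (n : 'rV[int]_d) : uniq (nbrs n).
Proof.
have inj : injective (@unitv d).
  move=> i j /rowP /(_ i); rewrite !mxE !eqxx /=.
  by case: eqP => //.
rewrite cat_uniq; apply/and3P; split.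
- by rewrite map_inj_uniq ?enum_uniq // => i j /addrI /inj.
- apply/hasPn => m /mapP [i _ ->]; apply/negP => /mapP [j _] /addrI.
  by move=> /rowP /(_ i); rewrite !mxE !eqxx /=; case: (i == j).
- by rewrite map_inj_uniq ?enum_uniq // => i j /addrI /oppr_inj /inj.
Qed.

Section InfiniteVolume.
Context {R : realType} {d : nat}.
Local Notation T := 'rV[int]_d.
Variables (eps q : R).

(* Normalized solution (phi 0 = 1) of the eigenvalue equation for the diagonal V,
   with Dirichlet condition at the sites where V = -oo. *)
Definition localized_sol (V : T -> \bar R) (E : R) (phi : T -> R) :=
  [/\ phi 0 = 1, forall n, `|phi n| <= q ^+ l1 n,
      forall n, V n = -oo%E -> phi n = 0
    & forall n, V n != -oo%E ->
        (fine (V n) - E) * phi n + eps * \sum_(m <- nbrs n) phi m = 0].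

(** The ultrafilter is arbitrary because the lemma serves twice: for growing volumes and, in
    [phi_continuous], for phases tending to a given one. Where the diagonal tends to [-oo], the
    equation itself forces [phi] to 0, its hopping term being bounded. *)
Lemma limit_solution (I : Type) (U : set_system I) (V : T -> \bar R)
    (Vi : I -> T -> R) (Ei : I -> R) (phi : I -> T -> R) (C : R) :
  UltraFilter U -> 0 <= q -> q <= 1 ->
  (forall n, V n != -oo%E -> (fun i => Vi i n) @ U --> fine (V n)) ->
  (forall n, V n = -oo%E -> forall A : R, U [set i | Vi i n < A]) ->
  U [set i | `|Ei i| <= C] ->
  (forall i, phi i 0 = 1) -> (forall i n, `|phi i n| <= q ^+ l1 n) ->
  (forall n, U [set i | (Vi i n - Ei i) * phi i n + eps * \sum_(m <- nbrs n) phi i m = 0]) ->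
  exists E psi, [/\ Ei @ U --> E, forall n, (fun i => phi i n) @ U --> psi n
    & localized_sol V E psi].
Proof.
move=> UU q0 q1 hV hS hE h0 hq heq; have PU : ProperFilter U by apply: ultra_proper.
have [E cE] := ultra_bounded UU hE.
have /choice [psi cpsi] n : exists l : R, (fun i => phi i n) @ U --> l.
  by apply: (ultra_bounded (C := q ^+ l1 n)) => //; apply: filterS filterT => i _ /=.
have csum n : (fun i => \sum_(m <- nbrs n) phi i m) @ U --> \sum_(m <- nbrs n) psi m.
  elim: (nbrs n) => [|m s IH].
    under eq_fun do rewrite big_nil.
    by rewrite big_nil; apply: cvg_cst.
  under eq_fun do rewrite big_cons.
  by rewrite big_cons; apply: cvgD.
exists E, psi; split=> //; split.
- apply: (ultra_unique UU (cpsi 0)).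
  by under eq_fun do rewrite h0; apply: cvg_cst.
- by move=> n; apply: ultra_norm_le (cpsi n); apply: filterS filterT => i _ /=.
- move=> n Vn; apply/eqP; rewrite -normr_le0; apply/ler_addgt0Pr => e e0; rewrite add0r.
  apply: (ultra_norm_le UU _ (cpsi n)).
  pose S := `|eps| * (size (nbrs n))%:R.
  have S0 : 0 <= S by rewrite mulr_ge0.
  apply: filterS (filterI (filterI (hS n Vn (- (S / e + C))) hE) (heq n)).
  move=> i [[/= hA hEi] he].
  have hs : `|\sum_(m <- nbrs n) phi i m| <= (size (nbrs n))%:R.
    apply: le_trans (ler_norm_sum _ _ _) _.
    apply: le_trans (_ : \sum_(m <- nbrs n) 1 <= _); last first.
      by rewrite big_const_seq count_predT iter_addr_0.
    by apply: ler_sum => m _; apply: le_trans (hq i m) _; rewrite exprn_ile1.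
  have hd : S / e < - (Vi i n - Ei i).
    by move: hEi; rewrite ler_norml => /andP [h1 h2]; lra.
  have SE : 0 <= S / e by rewrite divr_ge0 // ltW.
  have e1 : `|Vi i n - Ei i| * `|phi i n| <= S.
    rewrite -normrM; have -> : (Vi i n - Ei i) * phi i n = - (eps * \sum_(m <- nbrs n) phi i m) by lra.
    by rewrite normrN normrM ler_wpM2l.
  rewrite ltr0_norm in e1; last by lra.
  rewrite leNgt; apply/negP => hlt.
  have : S < - (Vi i n - Ei i) * `|phi i n|.
    have -> : S = S / e * e by field; rewrite gt_eqF.
    apply: (@le_lt_trans _ _ (S / e * `|phi i n|)); first by rewrite ler_wpM2l // ltW.
    by rewrite ltr_pM2r // (lt_trans e0).
  by rewrite ltNge e1.
- move=> n Vn; apply: (ultra_eq0 UU (heq n)).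
  apply: cvgD; first by apply: cvgM => //; apply: cvgB => //; apply: hV.
  by apply: cvgM => //; apply: cvg_cst.
Qed.

End InfiniteVolume.

(** If some preimage [A] is not in [F], the complement of [A] can be adjoined to [F], and an
    ultrafilter containing both contradicts the hypothesis. *)
Lemma ultra_cvg {R : realType} {I : Type} (F : set_system I) (u : I -> R) (l : R) :
  ProperFilter F ->
  (forall U, UltraFilter U -> F `<=` U -> u @ U --> l) -> u @ F --> l.
Proof.
move=> PF h B Bl; apply: contrapT => nFB; set A := u @^-1` B.
have PG : ProperFilter (within (~` A) F).
  apply: Build_ProperFilter => G0.
  suff FA : F A by [].
  by apply: (filterS _ (G0 : F [set i | ~ A i -> False])) => i hi; apply: contrapT => /hi.
have [U [UU subU]] := ultraFilterLemma PG.
have PU : ProperFilter U by apply: ultra_proper.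
have UA : U A by apply: (h U UU _ B Bl) => C FC; apply: subU; apply: filterS FC.
have UnA : U (~` A).
  by apply: subU; exact: withinT.
by have [i []] := filter_ex (filterI UA UnA).
Qed.

Section StageEquation.
Context {R : realType} {d : nat}.
Local Notation T := 'rV[int]_d.

Lemma mvec_nbrs (w : 'rV[R]_d) eps g z E (C : seq T) phi n : uniq C -> n \in C ->
  (forall m, m \notin C -> phi m = 0) ->
  mvec (Msys w eps g z E) C phi n =
    (g (fr (z + idot n w)) - E) * phi n + eps * \sum_(m <- nbrs n) phi m.
Proof.
move=> uC nC h; rewrite /mvec (bigD1_seq n) //= {1}/Msys eqxx; congr (_ + _).
rewrite mulr_sumr.
rewrite (eq_bigr (fun m => if m \in nbrs n then eps * phi m else 0)); last first.
  by move=> m mn; rewrite /Msys eq_sym (negbTE mn) nbrsP l1B; case: ifP; rewrite ?mul0r.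
rewrite -big_mkcondr /= -big_filter.
rewrite [RHS](bigID (fun m => m \in C)) /= [X in _ = _ + X]big1 ?addr0; last first.
  by move=> m /h ->; rewrite mulr0.
rewrite -[RHS]big_filter; apply: perm_big; apply: uniq_perm; rewrite ?filter_uniq ?nbrs_uniq //.
move=> m; rewrite !mem_filter; case mn : (m \in nbrs n); rewrite ?andbF //= !andbT.
suff -> : m != n by [].
by apply/eqP => e; move: mn; rewrite nbrsP e subrr l1_0.
Qed.

(** The ratios [a / b] and [(b - a) / b] lie in [0, 1], where a power [alpha >= 1] does not increase
    them, and they sum to 1. *)
Lemma powR_superadd (a b alpha : R) : 1 <= alpha -> 0 <= a -> a <= b ->
  a `^ alpha + (b - a) `^ alpha <= b `^ alpha.
Proof.
move=> h1 a0 ab; have al0 : alpha != 0 by rewrite gt_eqF // (lt_le_trans _ h1).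
have [b0|b0] := eqVneq b 0.
  have -> : a = 0 by apply/eqP; rewrite eq_le a0 -b0 ab.
  by rewrite b0 subrr powR0 // addr0.
have bp : 0 < b by rewrite lt_neqAle eq_sym b0 (le_trans a0).
have key c : 0 <= c -> c <= b -> c `^ alpha <= b `^ alpha * (c / b).
  move=> c0 cb; have [->|cn] := eqVneq c 0; first by rewrite powR0 // mul0r mulr0.
  have cp : 0 < c by rewrite lt_neqAle eq_sym cn.
  rewrite -[c in leLHS](divfK b0) [_ * b]mulrC powRM ?divr_ge0 ?(ltW bp) //.
  rewrite ler_pM2l ?powR_gt0 //; apply: ge1r_powR => //.
  by rewrite divr_gt0 // ler_pdivrMr // mul1r.
apply: le_trans (lerD (key a a0 ab) (key (b - a) _ _)) _; rewrite ?subr_ge0 //.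
  by rewrite lerBlDr lerDl.
by rewrite -mulrDr -mulrDl addrC subrK divff // mulr1.
Qed.
End StageEquation.

(** * Removal of the finite volume and of the truncation *)

Section LimitConstruction.
Context {R : realType} {d : nat}.
Local Notation T := 'rV[int]_d.
Variables (alpha delta rho mu : R).
Hypotheses (hd : (1 <= d)%N) (halpha : 1 <= alpha) (hdelta0 : 0 < delta)
  (hdelta1 : delta < 1) (hrho : 0 < rho) (hmu : 0 < mu).
Variable eps : R.
Hypotheses (eps_gt0 : 0 < eps) (eps_lt : eps < eps0c d alpha delta rho mu).
Variable w : 'rV[R]_d.
Hypothesis hw : Omega rho mu w.
Variable f : R -> \bar R.
Hypothesis hf : holder_monotone alpha f.

Let th := thc rho mu.
Let gi := gic delta eps.
Let gam := gamc alpha rho mu gi.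
Let q := qq gi.

Lemma f_frac z : f (fr z) = f z.
Proof. by apply: periodic_fr; case: hf. Qed.

Lemma f_ninfty z : f z = -oo%E -> fr z = 0.
Proof.
by case: hf => _ _ h _ /h [k ->]; rewrite -(add0r k%:~R) frDz fr_id.
Qed.

(* Truncation of f from below; it keeps the Holder monotonicity because
   t^alpha is superadditive for alpha >= 1. *)
Definition trunc (k : nat) (z : R) : R :=
  if f z is r%:E then Num.max r (- k%:R + z `^ alpha) else - k%:R + z `^ alpha.

Lemma trunc_mono k a b : 0 <= a -> a <= b -> b < 1 ->
  trunc k a + (b - a) `^ alpha <= trunc k b.
Proof.
move=> a0 ab b1; case: hf => fin _ _ mono; have := mono a b a0 ab b1.
have hs := powR_superadd halpha a0 ab.
have := fin a; have := fin b; rewrite /trunc.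
case: (f a) => [r||] //; case: (f b) => [s||] // _ _.
- rewrite -EFinD lee_fin => h; rewrite addr_maxl ge_max le_max h /=.
  by rewrite le_max -addrA lerD2l hs orbT.
- by move=> _; rewrite le_max -addrA lerD2l hs orbT.
- by move=> _; rewrite -addrA lerD2l.
Qed.

Lemma trunc_le k z : 0 <= z -> z < 1 -> f z = -oo%E -> trunc k z <= - k%:R + 1.
Proof.
move=> z0 z1 h; rewrite /trunc h lerD2l.
have [->|zn] := eqVneq z 0; first by rewrite powR0 // gt_eqF // (lt_le_trans _ halpha).
by apply: le_trans (ge1r_powR _ halpha) _; rewrite ?ltW // lt_neqAle eq_sym zn z0 ?ltW.
Qed.

Lemma trunc_eq k z : 0 <= z -> z < 1 -> f z != -oo%E -> 1 - fine (f z) <= k%:R ->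
  trunc k z = fine (f z).
Proof.
move=> z0 z1; case: hf => /(_ z) fin _ _ _; rewrite /trunc; move: fin.
case: (f z) => [r||] //= _ _ hk; rewrite max_l //.
have : z `^ alpha <= 1.
  apply: (@le_trans _ _ (1 `^ alpha)); last by rewrite powR1.
  by apply: ge0_ler_powR; rewrite ?nnegrE ?(ltW z1) // (le_trans ler01).
by lra.
Qed.

Let sepT j n k := @thc_sep R d rho mu hrho hmu w j n k hw.
Let decT := thc_dec hrho hmu.
Let hdecT := hhc_dec halpha hrho hmu.
Let gainT j := @wvc_gain R alpha rho mu hmu gi j.
Let gdecT j := @gamc_dec R alpha rho mu halpha hrho hmu gi j.
Let ggeT j := @gamc_ge R alpha rho mu halpha hrho hmu gi j.
Let epsT := eps_small_c hd halpha hdelta0 hrho hmu eps_gt0 eps_lt.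
Let giT := gic_gt0 halpha hdelta0 hdelta1 hrho hmu eps_gt0 eps_lt.
Let q2T := q2_le hd halpha hdelta0 hdelta1 hrho hmu eps_gt0 eps_lt.
Let tinyT := tiny_c hd halpha hdelta0 hdelta1 hrho hmu eps_gt0 eps_lt.

Definition tstage k x E phi := stage w eps alpha th (trunc k) x k.+1 k E phi.

Lemma tstage_exists k x : 0 <= x -> x < 1 -> exists E phi, tstage k x E phi.
Proof.
move=> x0 x1; exact: (stage_exists halpha eps_gt0 sepT (thc_gt0 rho mu) decT hdecT
  (@trunc_mono k) giT ggeT gdecT gainT epsT q2T tinyT x0 x1 (ltnSn k)).
Qed.

Lemma tstage_decay k x E phi : 0 <= x -> x < 1 -> tstage k x E phi ->
  (forall m, `|phi m| <= q ^+ l1 m) /\ `|E - trunc k x| <= (2 * d)%:R * eps.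
Proof.
move=> x0 x1; exact: (stage_decay eps_gt0 sepT (thc_gt0 rho mu) decT
  giT ggeT gdecT gainT epsT x0 x1 (ltnSn k)).
Qed.

Lemma tstage_mono k s x y Ex Ey phx phy : 0 <= x -> x < y -> y < 1 ->
  (s + 4 <= k)%N -> th s <= y - x -> tstage k x Ex phx -> tstage k y Ey phy ->
  wv alpha th s / 2 <= Ey - Ex.
Proof.
move=> x0 xy y1 sk hs; exact: (stage_mono eps_gt0 sepT (thc_gt0 rho mu) decT hdecT
  giT ggeT gdecT gainT epsT q2T tinyT x0 xy y1 (ltnSn k) sk hs).
Qed.

Lemma mem_Cset_large k x n : 0 <= x -> x < 1 -> (3 * l1 n < k)%N ->
  n \in 0 :: Cset w th x k.+1 x (kap k).
Proof.
move=> x0 x1 hk; rewrite inE mem_Cset; have [//|n0 /=] := eqVneq n 0.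
have hn : (l1 n <= 2 ^ k.+2)%N.
  apply: leq_trans (ltnW (ltn_expl k.+2 (ltnSn 1))).
  by apply: leq_trans (_ : k <= _)%N; rewrite ?(leq_trans _ (leqnSn _)) //; apply: leq_trans (ltnW hk); rewrite leq_pmull.
have hkap : (kap (mxs w th x k.+1 x n) <= l1 n)%N.
  apply: (@kap_le_l1 _ _ _ _ sepT (thc_gt0 rho mu) decT x k.+1 x0 x1 x k) => //.
  by apply: x_near => //; apply: thc_gt0.
apply: (@leq_trans (3 * l1 n)); first by rewrite [leqRHS]mulSn leq_add2l leq_mul2l.
case: k hk {hn hkap} => [//|k] /=; rewrite ltnS => h; apply: leq_trans h _.
exact/ltnW/ltn_expl.
Qed.

Lemma tstage_equation k x E phi n : 0 <= x -> x < 1 -> tstage k x E phi ->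
  (3 * l1 n < k)%N ->
  (trunc k (fr (x + idot n w)) - E) * phi n + eps * \sum_(m <- nbrs n) phi m = 0.
Proof.
move=> x0 x1 [[h1 h2 h3] h4 _] hk; have hn := mem_Cset_large x0 x1 hk.
rewrite -(mvec_nbrs w eps (trunc k) x E (uniq_Cset w th x k.+1 x (kap k)) hn h2).
by move: hn; rewrite inE => /orP [/eqP ->|/h3].
Qed.

Lemma thc_small (t : R) : 0 < t -> exists s, th s <= t.
Proof.
move=> t0; have [s hs] : exists s : nat, t^-1 <= s%:R.
  exists (Num.truncn t^-1).+1; apply: ltW; exact: truncnS_gt.
exists s; rewrite /th /thc; set bb := 2 `^ _; set aa := _ + 3 / _.
have b1 := bb_gt1 hmu; rewrite -/bb in b1.
have ha : 3 <= aa * (bb - 1) := aa_bb hrho hmu.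
have bern : 1 + (bb - 1) * s%:R <= bb ^+ s.
  elim: s {hs} => [|s IH]; first by rewrite mulr0 addr0 expr0.
  rewrite exprS -natr1.
  have h0 : 0 <= (bb - 1) * s%:R by rewrite mulr_ge0 // subr_ge0 ltW.
  have : bb * (1 + (bb - 1) * s%:R) <= bb * bb ^+ s by rewrite ler_pM2l //; lra.
  nra.
have a0 : 0 < aa := aa_gt0 hrho hmu.
have s0 : 0 < s%:R :> R by apply: lt_le_trans hs; rewrite invr_gt0.
have hy : s%:R <= aa * bb ^+ s.
  have : aa * (1 + (bb - 1) * s%:R) <= aa * bb ^+ s by rewrite ler_pM2l.
  have : 3 * s%:R <= aa * (bb - 1) * s%:R by rewrite ler_pM2r.
  nra.
have y0 : 0 < aa * bb ^+ s by apply: lt_le_trans hy.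
have := expRN_le y0; rewrite mulNr => h.
have h1 : 1 / (aa * bb ^+ s) <= t.
  rewrite ler_pdivrMr // mulrC; apply: le_trans (_ : s%:R * t <= _); last by rewrite ler_pM2r.
  by rewrite -ler_pdivrMr // div1r.
have e0 := expR_ge0 (- (aa * bb ^+ s)); lra.
Qed.

(* The volumes and the truncations are removed together, along one ultrafilter
   that does not depend on the phase, so that the monotonicity of the finite
   volume energies survives. *)
Theorem infinite_volume : exists (E : R -> \bar R) (phi : R -> T -> R),
  [/\ forall x, (E x < +oo)%E, forall x, E (x + 1) = E x,
      forall x y, 0 <= x -> x < y -> y < 1 -> (E x < E y)%E
    & forall x, phi (x + 1) = phi x] /\
  forall x, (f x = -oo%E -> E x = -oo%E /\ phi x = fun n => (n == 0)%:R) /\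
    (f x != -oo%E -> exists2 r : R, E x = r%:E &
       localized_sol eps q (fun n => f (x + idot n w)) r (phi x) /\ `|r - fine (f x)| <= 1).
Proof.
have PF : ProperFilter (\oo : set_system nat) by exact: eventually_filter.
have [U [UU subU]] := ultraFilterLemma PF.
have Uge N : U [set k | (N <= k)%N] by apply: subU; exists N.
have PU : ProperFilter U by apply: ultra_proper.
have /choice [F hF] (kx : nat * R) : exists Ephi : R * (T -> R),
    0 <= kx.2 -> kx.2 < 1 -> tstage kx.1 kx.2 Ephi.1 Ephi.2.
  case: kx => k x /=; case: (boolP ((0 <= x) && (x < 1))) => [/andP [x0 x1]|h].
    by have [E [ph h]] := tstage_exists k x0 x1; exists (E, ph).
  by exists (0, fun=> 0) => x0 x1; rewrite x0 x1 in h.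
have De1 : (2 * d)%:R * eps <= 1.
  have [_ h] := eps_le hd halpha hdelta0 hrho hmu eps_gt0 eps_lt; lra.
have lim x : 0 <= x -> x < 1 -> f x != -oo%E -> exists (E : R) (psi : T -> R),
    [/\ (fun k => (F (k, x)).1) @ U --> E,
       localized_sol eps q (fun n => f (x + idot n w)) E psi & `|E - fine (f x)| <= 1].
  move=> x0 x1 fx.
  have hst k : tstage k x (F (k, x)).1 (F (k, x)).2 by apply: (hF (k, x)).
  have hE : U [set k | `|(F (k, x)).1 - fine (f x)| <= 1].
    pose N := (Num.truncn (1 - fine (f x))).+1.
    apply: filterS (Uge N) => k /= hk.
    have [_ h] := tstage_decay x0 x1 (hst k).
    rewrite trunc_eq // in h; first exact: le_trans h De1.
    by apply: le_trans (ltW (truncnS_gt _)) _; rewrite ler_nat.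
  have hE' : U [set k | `|(F (k, x)).1| <= 1 + `|fine (f x)|].
    apply: filterS hE => k /= h.
    rewrite -[X in `|X|](subrK (fine (f x))); apply: le_trans (ler_normD _ _) _.
    by rewrite lerD2r.
  have fin z : f (fr z) != -oo%E -> forall k, ((Num.truncn (1 - fine (f (fr z)))).+1 <= k)%N ->
      trunc k (fr z) = fine (f (fr z)).
    move=> hz k hk; apply: trunc_eq => //; rewrite ?fr_ge0 ?fr_lt1 //.
    by apply: le_trans (ltW (truncnS_gt _)) _; rewrite ler_nat.
  have qp : 0 <= q by apply: expR_ge0.
  have [n hn|n hn A|k|k n|n|E [psi [h1 h2 h3]]] := @limit_solution R d eps q nat U
    (fun n => f (x + idot n w)) (fun k n => trunc k (fr (x + idot n w)))
    (fun k => (F (k, x)).1) (fun k => (F (k, x)).2) (1 + `|fine (f x)|) UU qp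
    (q_le1 halpha hdelta0 hdelta1 hrho hmu eps_gt0 eps_lt) _ _ hE' _ _ _.
  - rewrite -f_frac in hn; apply/ultra_cvg_dist => e e0.
    apply: filterS (Uge (Num.truncn (1 - fine (f (fr (x + idot n w))))).+1) => k /= hk.
    by rewrite (fin _ hn k hk) f_frac subrr normr0.
  - rewrite -f_frac in hn; apply: filterS (Uge (Num.truncn (1 - A)).+1) => k /= hk.
    apply: le_lt_trans (trunc_le k (fr_ge0 _) (fr_lt1 _) hn) _.
    have : 1 - A < k%:R by apply: lt_le_trans (truncnS_gt _) _; rewrite ler_nat.
    by lra.
  - by have [[]] := hst k.
  - by have [h _] := tstage_decay x0 x1 (hst k); apply: h.
  - by apply: filterS (Uge (3 * l1 n).+1) => k /= hk; apply: tstage_equation (hst k) hk.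
  exists E, psi; split=> //.
  apply: (ultra_norm_le UU hE); apply: cvgB => //; exact: cvg_cst.
have /choice [Ex hEx] (x : R) : exists Ephi : R * (T -> R),
    0 <= x -> x < 1 -> f x != -oo%E -> [/\ (fun k => (F (k, x)).1) @ U --> Ephi.1,
       localized_sol eps q (fun n => f (x + idot n w)) Ephi.1 Ephi.2 & `|Ephi.1 - fine (f x)| <= 1].
  case: (boolP [&& 0 <= x, x < 1 & f x != -oo%E]) => [/and3P [x0 x1 fx]|h].
    by have [E [psi h]] := lim x x0 x1 fx; exists (E, psi).
  by exists (0, fun=> 0) => x0 x1 fx; rewrite x0 x1 fx in h.
pose E x : \bar R := if f (fr x) == -oo%E then -oo%E else (Ex (fr x)).1%:E.
pose phi x : T -> R := if f (fr x) == -oo%E then fun n => (n == 0)%:R else (Ex (fr x)).2.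
have fr1 x : fr (x + 1) = fr x by rewrite -(frDz x 1) mulr1z.
exists E, phi; split; first split.
- by move=> x; rewrite /E; case: ifP => _; rewrite ?ltNyr ?ltry.
- by move=> x; rewrite /E fr1.
- move=> x y x0 xy y1; have x1 := lt_trans xy y1; have y0 := le_trans x0 (ltW xy).
  rewrite /E !fr_id //.
  have fy : f y != -oo%E.
    apply/eqP => /f_ninfty; rewrite fr_id // => y00.
    by move: xy; rewrite y00 ltNge x0.
  rewrite (negbTE fy); case: eqP => [_|/eqP fx]; first by rewrite ltNyr.
  rewrite lte_fin; have [cx _ _] := hEx x x0 x1 fx; have [cy _ _] := hEx y y0 y1 fy.
  have yx : 0 < y - x by rewrite subr_gt0.
  have [s hs] := thc_small yx.
  (* The finite volume gap depends on [y - x] through [s] but not on [k], so the inequality stays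
     strict in the limit. *)
  rewrite -subr_gt0; apply: (@lt_le_trans _ _ (wv alpha th s / 2)).
    rewrite divr_gt0 // divr_gt0 // powR_gt0 //; exact: thc_gt0.
  apply: (cvgr_to_ge (cvgB cy cx)); apply: filterS (Uge (s + 4)%N) => k /= hk.
  exact: (tstage_mono x0 xy y1 hk hs (hF (k, x) x0 x1) (hF (k, y) y0 y1)).
- by move=> x; rewrite /phi fr1.
move=> x; split=> [fx|fx].
  by rewrite /E /phi f_frac fx eqxx.
have fx' : f (fr x) != -oo%E by rewrite f_frac.
have [_ h1 h2] := hEx (fr x) (fr_ge0 x) (fr_lt1 x) fx'.
exists (Ex (fr x)).1; rewrite /E /phi (negbTE fx') //.
rewrite f_frac in h2; split=> //.
have -> : (fun n => f (x + idot n w)) = (fun n => f (fr x + idot n w)); last exact: h1.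
by apply/funext => n; rewrite -f_frac -fr_addl f_frac.
Qed.
End LimitConstruction.

(** * Families in l^2 *)

Section Summation.
Context {R : realType} {d : nat}.
Local Notation T := 'rV[int]_d.
Implicit Types (a : T -> R) (u v : T -> R[i]).

(** A bound on all finite subfamilies, the form in which lattice estimates arise; for nonnegative
    [a] it bounds the unordered sum. *)
Definition sums_le a (B : R) := forall U : seq T, uniq U -> \sum_(n <- U) a n <= B.

Definition bsum a (N : nat) : R := \sum_(n <- ball N) a n.

Lemma sums_le_ge0 a B : sums_le a B -> 0 <= B.
Proof. by move=> /(_ [::] isT); rewrite big_nil. Qed.

Lemma sums_leW a B B' : B <= B' -> sums_le a B -> sums_le a B'.
Proof. by move=> BB h U uU; apply: le_trans (h U uU) BB. Qed.

Lemma sums_le_eq a b B : (forall n, a n <= b n) -> sums_le b B -> sums_le a B.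
Proof. by move=> ab h U uU; apply: le_trans (h U uU); apply: ler_sum. Qed.

Lemma sums_leD a b A B : sums_le a A -> sums_le b B -> sums_le (fun n => a n + b n) (A + B).
Proof. by move=> ha hb U uU; rewrite big_split lerD ?ha ?hb. Qed.

Lemma sums_leZ a A c : 0 <= c -> sums_le a A -> sums_le (fun n => c * a n) (c * A).
Proof. by move=> c0 ha U uU; rewrite -mulr_sumr ler_wpM2l ?ha. Qed.

Lemma sums_le_shift a A p : sums_le a A -> sums_le (fun n => a (n + p)) A.
Proof.
move=> ha U uU; have := ha [seq n + p | n <- U]; rewrite big_map; apply.
by rewrite map_inj_uniq //; apply: addIr.
Qed.

Lemma sums_le_sqr a A : (forall n, 0 <= a n) -> sums_le a A -> sums_le (fun n => a n ^+ 2) (A ^+ 2).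
Proof.
move=> a0 ha U uU; apply: (@le_trans _ _ ((\sum_(n <- U) a n) ^+ 2)).
  elim: U uU => [|n U IH] /=; first by rewrite !big_nil expr0n.
  move=> /andP [_ uU]; rewrite !big_cons sqrrD -addrA lerD2l.
  apply: le_trans (IH uU) _; rewrite lerDr mulrn_wge0 // mulr_ge0 //.
  exact: sumr_ge0.
by apply: lerXn2r; rewrite ?nnegrE ?ha ?sumr_ge0 // (sums_le_ge0 ha).
Qed.

Lemma ball_subset N N' : (N <= N')%N -> {subset @ball d N <= @ball d N'}.
Proof. by move=> NN n; rewrite !mem_ball => /leq_trans; apply. Qed.

Lemma sub_ball (U : seq T) : exists N, {subset U <= @ball d N}.
Proof.
exists (\max_(n <- U) l1 n)%N => n nU; rewrite mem_ball.
exact: (@leq_bigmax_seq _ _ xpredT (@l1 d) n nU isT).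
Qed.

Lemma esum_sums_le a B : (forall n, 0 <= a n) -> sums_le a B ->
  exists s : R, [/\ (\esum_(n in [set: T]) (a n)%:E = s%:E)%E, bsum a @ \oo --> s,
     s <= B & sums_le a s].
Proof.
move=> a0 ha; set S := (\esum_(n in _) _)%E.
have S0 : (0 <= S)%E by apply: esum_ge0 => n _; rewrite lee_fin.
have fsE (A : set T) : finite_set A -> (\sum_(i \in A) (a i)%:E = (\sum_(i <- finmap.enum_fset (fset_set A)) a i)%R%:E)%E.
  by move=> fA; rewrite fsbig_finite // sumEFin.
have SB : (S <= B%:E)%E.
  apply: ge_ereal_sup => _ [A [fA _] <-].
  by rewrite fsE // lee_fin ha // finmap.fset_uniq.
have [s eS] : exists s : R, S = s%:E.
  by exists (fine S); rewrite fineK // ge0_fin_numE // (le_lt_trans SB) ?ltry.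
have sU : sums_le a s.
  move=> U uU; rewrite -lee_fin -eS; apply: esum_ge; exists [set` U]; first by split=> //; exact: finite_seq.
  by rewrite -fsbig_seq // sumEFin.
exists s; split=> //; last by rewrite -lee_fin -eS.
apply/cvgrPdist_le => e e0.
have /ereal_sup_gt [_ [A [fA _] <-]] : ((s - e)%:E < S)%E by rewrite eS lte_fin ltrBlDr ltrDl.
rewrite fsE // lte_fin => hA.
have [N hN] := sub_ball (finmap.enum_fset (fset_set A)).
exists N => // k /= Nk; rewrite ger0_norm; last by rewrite subr_ge0; apply: sU; apply: ball_uniq.
have : \sum_(i <- finmap.enum_fset (fset_set A)) a i <= bsum a k.
  by apply: ler_sum_sub => //; rewrite ?finmap.fset_uniq // => n /hN; apply: ball_subset.
by move: hA; lra.
Qed.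

Lemma rsum_cvg a B : sums_le (fun n => `|a n|) B -> bsum a @ \oo --> rsum a.
Proof.
move=> ha.
have [||sp [ep cp _ _]] := @esum_sums_le (fun n => Num.max (a n) 0) B _ _.
- by move=> n; rewrite le_max lexx orbT.
- by apply: (sums_le_eq _ ha) => n; rewrite ge_max ler_norm normr_ge0.
have [||sm [em cm _ _]] := @esum_sums_le (fun n => Num.max (- a n) 0) B _ _.
- by move=> n; rewrite le_max lexx orbT.
- by apply: (sums_le_eq _ ha) => n; rewrite ge_max normr_ge0 -normrN ler_norm.
have -> : rsum a = sp - sm.
  rewrite /rsum; congr (_ - _).
    rewrite -[RHS]/(fine sp%:E) -ep; congr fine; apply: eq_esum => n _ /=.
    by rewrite funeposE /= EFin_max.
  rewrite -[RHS]/(fine sm%:E) -em; congr fine; apply: eq_esum => n _ /=.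
  by rewrite funenegE /= EFin_max.
have -> : bsum a = (fun N => bsum (fun n => Num.max (a n) 0) N - bsum (fun n => Num.max (- a n) 0) N).
  apply/funext => N; rewrite /bsum -sumrB; apply: eq_bigr => n _.
  by rewrite !maxEle; case: (lerP (a n) 0) => h; case: (lerP (- a n) 0) => h'; lra.
exact: cvgB.
Qed.

Lemma rsum_unique a B s : sums_le (fun n => `|a n|) B -> bsum a @ \oo --> s -> rsum a = s.
Proof. by move=> ha; apply: (cvg_unique _ (rsum_cvg ha)). Qed.

Lemma sqnorm_sums_le u B : sums_le (fun n => cabs (u n) ^+ 2) B ->
  exists s : R, [/\ sqnorm u = s%:E, bsum (fun n => cabs (u n) ^+ 2) @ \oo --> s, s <= B
    & sums_le (fun n => cabs (u n) ^+ 2) s].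
Proof. by apply: esum_sums_le => n; rewrite sqr_ge0. Qed.

Lemma ell2_sums_le u B : sums_le (fun n => cabs (u n) ^+ 2) B -> ell2 u.
Proof. by move=> /sqnorm_sums_le [s [e _ _ _]]; rewrite /ell2 /= e ltry. Qed.

Lemma l2norm_le u r : 0 <= r -> sums_le (fun n => cabs (u n) ^+ 2) (r ^+ 2) -> l2norm u <= r.
Proof.
move=> r0 /sqnorm_sums_le [s [e _ h _]]; rewrite /l2norm e /=.
by rewrite -[leRHS]ger0_norm // -sqrtr_sqr ler_sqrt ?sqr_ge0.
Qed.

Lemma sums_le_ell2 u : ell2 u ->
  exists2 B, sums_le (fun n => cabs (u n) ^+ 2) B & fine (sqnorm u) = B.
Proof.
move=> hu; exists (fine (sqnorm u)) => // U uU.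
have h0 : (0 <= sqnorm u)%E by apply: esum_ge0 => n _; rewrite lee_fin sqr_ge0.
rewrite -lee_fin fineK; last by rewrite ge0_fin_numE.
apply: esum_ge; exists [set` U]; first by split=> //; exact: finite_seq.
by rewrite -fsbig_seq // sumEFin.
Qed.

Lemma sums_le_tail a B e : (forall n, 0 <= a n) -> sums_le a B -> 0 < e ->
  exists N, forall U : seq T, uniq U -> (forall n, n \in U -> n \notin ball N) ->
    \sum_(n <- U) a n <= e.
Proof.
move=> a0 ha e0; have [s [_ cs _ hs]] := esum_sums_le a0 ha.
move/cvgrPdist_le : cs => /(_ e e0) [N _ hN]; exists N => U uU hU.
have := hN N (leqnn N); rewrite ler_norml => /andP [_ h].
have := hs (ball N ++ U); rewrite cat_uniq ball_uniq uU /= andbT big_cat /=.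
have -> : ~~ has (mem (ball N)) U by apply/hasPn => n /hU.
by move=> /(_ isT); move: h; rewrite /bsum; lra.
Qed.

End Summation.

Section AbsoluteSums.
Context {R : realType} {d : nat}.
Local Notation T := 'rV[int]_d.
Implicit Types (a b : T -> R).

Definition abs_summable a := exists B, sums_le (fun n => `|a n|) B.

Lemma abs_summable_le a b : (forall n, `|a n| <= `|b n|) -> abs_summable b -> abs_summable a.
Proof. by move=> ab [B hB]; exists B; apply: (sums_le_eq _ hB). Qed.

Lemma abs_summableD a b : abs_summable a -> abs_summable b -> abs_summable (fun n => a n + b n).
Proof.
move=> [A hA] [B hB]; exists (A + B); apply: (sums_le_eq _ (sums_leD hA hB)) => n.
exact: ler_normD.
Qed.

Lemma abs_summableZ c a : abs_summable a -> abs_summable (fun n => c * a n).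
Proof.
move=> [A hA]; exists (`|c| * A); apply: (sums_le_eq _ (sums_leZ (normr_ge0 c) hA)) => n.
by rewrite normrM.
Qed.

Lemma abs_summable_shift a p : abs_summable a -> abs_summable (fun n => a (n + p)).
Proof. by move=> [A hA]; exists A; apply: (sums_le_shift p hA). Qed.

Lemma abs_summable_sum (s : seq T) (F : T -> T -> R) : (forall p, abs_summable (F p)) ->
  abs_summable (fun n => \sum_(p <- s) F p n).
Proof.
move=> h; elim: s => [|p s IH].
  exists 0 => U _; rewrite big1 // => n _; by rewrite big_nil normr0.
by apply: abs_summable_le (abs_summableD (h p) IH) => n; rewrite big_cons.
Qed.

Lemma abs_summable_sqr a : abs_summable a -> exists B, sums_le (fun n => a n ^+ 2) B.
Proof.
move=> [A hA]; exists (A ^+ 2); apply: (sums_le_eq _ (sums_le_sqr _ hA)) => n //.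
by rewrite real_normK // num_real.
Qed.

Lemma rsum_lim a : abs_summable a -> bsum a @ \oo --> rsum a.
Proof. by move=> [B hB]; apply: rsum_cvg hB. Qed.

Lemma rsum_eq a s : abs_summable a -> bsum a @ \oo --> s -> rsum a = s.
Proof. by move=> [B hB]; apply: rsum_unique hB. Qed.

Lemma rsumD a b : abs_summable a -> abs_summable b ->
  rsum (fun n => a n + b n) = rsum a + rsum b.
Proof.
move=> ha hb; apply: rsum_eq; first exact: abs_summableD.
rewrite (_ : bsum _ = fun N => bsum a N + bsum b N); last first.
  by apply/funext => N; rewrite /bsum big_split.
by apply: cvgD; apply: rsum_lim.
Qed.

Lemma rsumZ c a : abs_summable a -> rsum (fun n => c * a n) = c * rsum a.
Proof.
move=> ha; apply: rsum_eq; first exact: abs_summableZ.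
rewrite (_ : bsum _ = fun N => c * bsum a N); last first.
  by apply/funext => N; rewrite /bsum mulr_sumr.
by apply: cvgM; [apply: cvg_cst|apply: rsum_lim].
Qed.

Lemma rsum0 : rsum (fun _ : T => 0) = 0 :> R.
Proof.
rewrite -[RHS](mul0r (rsum (fun _ : T => 0 : R))) -rsumZ; last first.
  by exists 0 => U _; rewrite big1 // => n _; rewrite normr0.
by congr rsum; apply/funext => n; rewrite mul0r.
Qed.

Lemma rsum_sum (s : seq T) (F : T -> T -> R) : (forall p, abs_summable (F p)) ->
  rsum (fun n => \sum_(p <- s) F p n) = \sum_(p <- s) rsum (F p).
Proof.
move=> h; elim: s => [|p s IH].
  by rewrite big_nil -[RHS]rsum0; congr rsum; apply/funext => n; rewrite big_nil.
rewrite big_cons -IH -rsumD //; last exact: abs_summable_sum.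
by congr rsum; apply/funext => n; rewrite big_cons.
Qed.

Lemma rsum_shift a (p : T) : rsum (fun n => a (n + p)) = rsum a.
Proof.
have bij : set_bij [set: T] [set: T] (fun n => n + p).
  split=> //; first by move=> m n _ _ /addIr.
  by move=> n _; exists (n - p) => //; rewrite subrK.
rewrite /rsum; congr (fine _ - fine _);
  rewrite [RHS](@reindex_esum R T T setT setT (fun n => n + p) _ bij);
  by apply: eq_esum => n _; rewrite !(funeposE, funenegE).
Qed.

Lemma rsum_tail a b e N : (forall n, `|a n| <= b n) ->
  (forall U : seq T, uniq U -> (forall n, n \in U -> n \notin ball N) -> \sum_(n <- U) b n <= e) ->
  abs_summable a -> `|rsum a - bsum a N| <= e.
Proof.
move=> ab hU ha; have h : (fun M => `|bsum a M - bsum a N|) @ \oo --> `|rsum a - bsum a N|.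
  by apply: cvg_norm; apply: cvgB; [apply: rsum_lim|apply: cvg_cst].
apply: (cvgr_to_le h); exists N => // M /= NM.
pose W := [seq n <- ball M | n \notin @ball d N].
have -> : bsum a M - bsum a N = \sum_(n <- W) a n.
  rewrite /bsum (bigID (fun n => n \in @ball d N)) /= big_filter addrC.
  rewrite (_ : \sum_(n <- ball M | n \in ball N) a n = \sum_(n <- ball N) a n) ?addrK //.
  rewrite -big_filter; apply: perm_big; apply: uniq_perm; rewrite ?filter_uniq ?ball_uniq //.
  by move=> n; rewrite mem_filter !mem_ball; case: leqP => //= h1; rewrite (leq_trans h1 NM).
apply: le_trans (ler_norm_sum _ _ _) _; apply: le_trans (_ : \sum_(n <- W) b n <= e).
  by apply: ler_sum => n _.
apply: hU; rewrite ?filter_uniq ?ball_uniq // => n.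
by rewrite mem_filter => /andP [].
Qed.

(** Dominated convergence along any filter: outside a large ball the sums are small uniformly in the
    parameter, and inside there are finitely many terms. *)
Lemma rsum_dominated (X : Type) (F : set_system X) (a : X -> T -> R) (a0 b : T -> R) B :
  Filter F -> sums_le b B -> (forall x n, `|a x n| <= b n) -> (forall n, `|a0 n| <= b n) ->
  (forall n, (fun x => a x n) @ F --> a0 n) -> (fun x => rsum (a x)) @ F --> rsum a0.
Proof.
move=> FF hB ha ha0 hc.
have b0 n : 0 <= b n by apply: le_trans (ha0 n).
have sa c : (forall n, `|c n| <= b n) -> abs_summable c.
  by move=> h; exists B; apply: (sums_le_eq _ hB).
have hN N : (fun x => bsum (a x) N) @ F --> bsum a0 N.
  rewrite /bsum; elim: (ball N) => [|n s IH].
    by rewrite big_nil; under eq_fun do rewrite big_nil; apply: cvg_cst.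
  by rewrite big_cons; under eq_fun do rewrite big_cons; apply: cvgD.
apply/cvgrPdist_le => e e0.
have e4 : 0 < e / 4 by rewrite divr_gt0.
have [N hNt] := sums_le_tail b0 hB e4.
have e2 : 0 < e / 2 by rewrite divr_gt0.
move/cvgrPdist_le : (hN N) => /(_ _ e2); apply: filterS => x hx.
have h1 := rsum_tail (ha x) hNt (sa _ (ha x)).
have h2 := rsum_tail ha0 hNt (sa _ ha0).
have -> : rsum a0 - rsum (a x) = (rsum a0 - bsum a0 N) + (bsum a0 N - bsum (a x) N)
  - (rsum (a x) - bsum (a x) N) by ring.
apply: le_trans (ler_normB _ _) _; apply: le_trans (lerD (ler_normD _ _) h1) _.
lra.
Qed.

End AbsoluteSums.

Section ComplexModulus.
Context {R : realType} {d : nat}.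
Local Notation T := 'rV[int]_d.
Implicit Types (x y : R[i]) (u v : T -> R[i]).

Lemma cabsM x y : cabs (x * y) = cabs x * cabs y. Proof. exact: Normc.normcM. Qed.

Lemma cabsD x y : cabs (x + y) <= cabs x + cabs y. Proof. exact: le_normcD. Qed.

Lemma cabs_ge0 x : 0 <= cabs x. Proof. by case: x => a b; apply: sqrtr_ge0. Qed.

Lemma cabs0 : cabs (0 : R[i]) = 0. Proof. exact: Normc.normc0. Qed.

Lemma cabs_real (r : R) : cabs r%:C = `|r|.
Proof. by rewrite /cabs /= expr0n /= addr0 sqrtr_sqr. Qed.

Lemma sqr_cabs x : cabs x ^+ 2 = complex.Re x ^+ 2 + complex.Im x ^+ 2.
Proof. by case: x => a b; rewrite /cabs /= sqr_sqrtr // addr_ge0 ?sqr_ge0. Qed.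

Lemma cabs_sum (I : Type) (s : seq I) (F : I -> R[i]) :
  cabs (\sum_(i <- s) F i) <= \sum_(i <- s) cabs (F i).
Proof.
elim: s => [|i s IH]; first by rewrite !big_nil cabs0.
by rewrite !big_cons; apply: le_trans (cabsD _ _) _; rewrite lerD2l.
Qed.

End ComplexModulus.

(** * Real solutions of the eigenvalue equation *)

Section Pairing.
Context {R : realType} {d : nat}.
Local Notation T := 'rV[int]_d.
Implicit Types (u c : T -> R).

Lemma nbrs_sum (V : nmodType) (F : T -> V) n :
  \sum_(m <- nbrs n) F m = \sum_(p <- nbrs 0) F (n + p).
Proof.
rewrite /nbrs !big_cat !big_map /=; congr (_ + _); apply: eq_bigr => i _.
  by rewrite add0r.
by rewrite sub0r.
Qed.

Lemma nbrs_sumN (V : nmodType) (F : T -> V) :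
  \sum_(p <- nbrs 0) F (- p) = \sum_(p <- nbrs 0) F p.
Proof.
rewrite /nbrs !big_cat !big_map /= addrC; congr (_ + _); apply: eq_bigr => i _.
  by rewrite sub0r opprK add0r.
by rewrite sub0r add0r.
Qed.

Variables (eps : R) (V : T -> \bar R).

Definition real_sol (r : R) u :=
  (forall n, V n = -oo%E -> u n = 0) /\
  forall n, V n != -oo%E -> (fine (V n) - r) * u n + eps * \sum_(m <- nbrs n) u m = 0.

Lemma real_sol_comb r a b u c : real_sol r u -> real_sol r c ->
  real_sol r (fun n => a * u n + b * c n).
Proof.
move=> [u0 hu] [c0 hc]; split=> n hn; first by rewrite u0 // c0 // !mulr0 addr0.
rewrite big_split /= -!mulr_sumr.
have := hu n hn; have := hc n hn; set s := \sum_(_ <- _) _; set t := \sum_(_ <- _) _ => h1 h2.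
have -> : (fine (V n) - r) * (a * u n + b * c n) + eps * (a * t + b * s) =
  a * ((fine (V n) - r) * u n + eps * t) + b * ((fine (V n) - r) * c n + eps * s) by ring.
by rewrite h1 h2 !mulr0 addr0.
Qed.

(* Self-adjointness: the hopping terms cancel after a translation of the sum. *)
Lemma real_sol_orthogonal r E M u c : (forall n, `|u n| <= M) -> abs_summable c ->
  real_sol r u -> real_sol E c -> r != E -> rsum (fun n => u n * c n) = 0.
Proof.
move=> hM hc [u0 hu] [c0 hcE] rE.
have sB (v a : T -> R) : (forall n, `|v n| <= M) -> abs_summable a -> abs_summable (fun n => v n * a n).
  move=> hv ha; apply: (abs_summable_le _ (abs_summableZ M ha)) => n.
  by rewrite !normrM ler_wpM2r // (le_trans (hv n)) // ler_norm.
have s1 (p : T) : abs_summable (fun n => u (n + p) * c n).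
  by apply: (sB (fun n : T => u (n + p)) c) => // n; apply: hM.
have s2 (p : T) : abs_summable (fun n => u n * c (n + p)).
  by apply: (sB u (fun n : T => c (n + p))) => //; apply: abs_summable_shift.
pose L1 := fun n => \sum_(p <- nbrs 0) u (n + p) * c n.
pose L2 := fun n => \sum_(p <- nbrs 0) u n * c (n + p).
have e12 : rsum L1 = rsum L2.
  rewrite !rsum_sum // -[RHS]nbrs_sumN; apply: eq_bigr => p _.
  rewrite -[RHS](rsum_shift _ p); congr rsum; apply/funext => n; by rewrite addrK.
have key : (r - E) * rsum (fun n => u n * c n) = eps * rsum L1 + - eps * rsum L2.
  have S1 : abs_summable L1 by apply: abs_summable_sum.
  have S2 : abs_summable L2 by apply: abs_summable_sum.
  rewrite -!rsumZ // -?rsumD; try exact: abs_summableZ; try exact: sB.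
  congr rsum; apply/funext => n; rewrite /L1 /L2 -mulr_suml -mulr_sumr.
  have h1 := hcE n; have h2 := hu n; rewrite nbrs_sum in h1; rewrite nbrs_sum in h2; move: h1 h2.
  move: (\sum_(p <- nbrs 0) u (n + p)) (\sum_(p <- nbrs 0) c (n + p)) => t s h1 h2.
  have [Vn|Vn] := eqVneq (V n) -oo%E.
    by rewrite (u0 n Vn) (c0 n Vn) !mul0r !mulr0 addr0.
  move/(_ Vn) in h1; move/(_ Vn) in h2.
  have -> : eps * (t * c n) + - eps * (u n * s) = c n * (eps * t) - u n * (eps * s) by ring.
  have -> : eps * t = - ((fine (V n) - r) * u n) by apply/eqP; rewrite -addr_eq0 addrC h2.
  have -> : eps * s = - ((fine (V n) - E) * c n) by apply/eqP; rewrite -addr_eq0 addrC h1.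
  by ring.
move: key; rewrite e12 -mulrDl subrr mul0r => /eqP; rewrite mulf_eq0 subr_eq0 (negbTE rE) /=.
by move/eqP.
Qed.

End Pairing.

(** * Completeness and simplicity for a localized family *)

Section LocalizedFamily.
Context {R : realType} {d : nat}.
Local Notation T := 'rV[int]_d.
Variables (eps : R) (V : T -> \bar R) (En : T -> \bar R) (g : T -> T -> R).
(* The family is indexed so that g n is concentrated at the site - n. *)
Hypothesis g_close : forall n, sums_le (fun m => `|g n m - (m == - n)%:R|) (1 / 4).
Hypothesis En_inj : injective En.
Hypothesis g_sol : forall n, (exists2 r, En n = r%:E & real_sol eps V r (g n)) \/
  [/\ En n = -oo%E, V (- n) = -oo%E & forall m, g n m = (m == - n)%:R].
Hypothesis g_norm : forall n, rsum (fun m => g n m ^+ 2) = 1.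

Lemma delta_sums_le (k : T) : sums_le (fun m => `|(m == k)%:R| : R) 1.
Proof.
move=> U uU; have [kU|kU] := boolP (k \in U).
  rewrite (bigD1_seq k) //= eqxx normr1 big1 ?addr0 // => m mk.
  by rewrite (negbTE mk) normr0.
rewrite big_seq big1 // => m mU; case: eqP => [e|_]; last by rewrite normr0.
by move: kU; rewrite -e mU.
Qed.

Lemma g_summable n : abs_summable (g n).
Proof.
exists (1 / 4 + 1); apply: (sums_le_eq _ (sums_leD (g_close n) (delta_sums_le (- n)))) => m.
by rewrite -[X in `|X|](subrK (m == - n)%:R); apply: ler_normD.
Qed.

Lemma g_le n m : `|g n m| <= 5 / 4.
Proof.
have := sums_leD (g_close n) (delta_sums_le (- n)).
move=> /(_ [:: m] isT); rewrite !big_seq1.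
have := ler_normD (g n m - (m == - n)%:R) (m == - n)%:R; rewrite subrK.
lra.
Qed.

Lemma rsum_delta (u : T -> R) k : rsum (fun m => u m * (m == k)%:R) = u k.
Proof.
apply: rsum_eq.
  exists (`|u k| * 1); apply: (sums_le_eq _ (sums_leZ (normr_ge0 (u k)) (delta_sums_le k))) => m.
  by rewrite normrM; case: eqP => [->//|_]; rewrite normr0 !mulr0.
apply/cvgrPdist_le => e e0; exists (l1 k) => // N /= hN.
rewrite /bsum (bigD1_seq k) ?ball_uniq ?mem_ball //= eqxx mulr1 big1 ?addr0 ?subrr ?normr0 ?ltW //.
by move=> m mk; rewrite (negbTE mk) mulr0.
Qed.

Lemma summable_mulg (u : T -> R) M n : (forall m, `|u m| <= M) ->
  abs_summable (fun m => u m * g n m).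
Proof.
move=> hu; apply: (abs_summable_le _ (abs_summableZ M (g_summable n))) => m.
by rewrite !normrM ler_wpM2r // (le_trans (hu m)) // ler_norm.
Qed.

(* By [g_close], orthogonality to the family shrinks the sup norm by a factor 4. *)
Lemma family_complete_bounded (u : T -> R) M : (forall m, `|u m| <= M) ->
  (forall n, rsum (fun m => u m * g n m) = 0) -> forall m, u m = 0.
Proof.
move=> hu hg.
have step (B : R) : 0 <= B -> (forall m, `|u m| <= B) -> forall m, `|u m| <= B * (1 / 4).
  move=> B0 hB m.
  have s1 : abs_summable (fun p => - 1 * (u p * g (- m) p)).
    by apply: abs_summableZ; apply: summable_mulg hu.
  have s2 : abs_summable (fun p => u p * (p == m)%:R).
    exists (B * 1); apply: (sums_le_eq _ (sums_leZ B0 (delta_sums_le m))) => p.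
    by rewrite normrM ler_wpM2r.
  have -> : u m = rsum (fun p => u p * ((p == m)%:R - g (- m) p)).
    rewrite -(rsum_delta u m) -[LHS]addr0 -[X in _ + X](mulr0 (-1)) -(hg (- m)).
    rewrite -rsumZ; last by apply: summable_mulg hu.
    rewrite -rsumD //; congr rsum; apply/funext => p; ring.
  have hs U : uniq U -> \sum_(p <- U) `|u p * ((p == m)%:R - g (- m) p)| <= B * (1 / 4).
    apply: (sums_le_eq _ (sums_leZ B0 (g_close (- m)))) => p.
    by rewrite normrM opprK distrC ler_wpM2r.
  have sm : abs_summable (fun p => u p * ((p == m)%:R - g (- m) p)) by exists (B * (1 / 4)).
  apply: (cvgr_to_le (cvg_norm (rsum_lim sm))); apply: nearW => N.
  by apply: le_trans (ler_norm_sum _ _ _) _; apply: hs; apply: ball_uniq.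
have M0 : 0 <= M by apply: le_trans (hu 0).
have it k : forall m, `|u m| <= M * (1 / 4) ^+ k.
  elim: k => [|k IH] m; first by rewrite expr0 mulr1.
  rewrite (_ : M * (1 / 4) ^+ k.+1 = M * (1 / 4) ^+ k * (1 / 4)); last by rewrite exprS; ring.
  by apply: (step (M * (1 / 4) ^+ k)) => //; rewrite mulr_ge0 ?exprn_ge0 //; lra.
move=> m; apply/eqP; rewrite -normr_le0.
have c0 : (fun k => M * (1 / 4) ^+ k) @ \oo --> M * (0 : R).
  apply: cvgM; first exact: cvg_cst.
  by apply: cvg_expr; rewrite ger0_norm //; lra.
rewrite mulr0 in c0.
apply: (cvgr_to_ge c0); apply: nearW => k; exact: it.
Qed.

Lemma family_orthogonal (u : T -> R) M r n : (forall m, `|u m| <= M) ->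
  real_sol eps V r u -> En n != r%:E -> rsum (fun m => u m * g n m) = 0.
Proof.
move=> hu su hE; case: (g_sol n) => [[r' e sg]|[_ Vn gE]].
  apply: (real_sol_orthogonal hu (g_summable n) su sg).
  by apply: contra hE => /eqP ->; rewrite e.
case: su => u0 _.
rewrite (_ : (fun m => _) = fun m => u m * (m == - n)%:R) ?rsum_delta ?u0 //.
by apply/funext => m; rewrite gE.
Qed.

Lemma family_orthonormal n k : rsum (fun m => g n m * g k m) = (n == k)%:R.
Proof.
case: eqVneq => [->|nk]; first by rewrite -[RHS](g_norm k); congr rsum; apply/funext => m.
have Enk : En n != En k by apply: contra nk => /eqP /En_inj ->.
case: (g_sol n) => [[r e sg]|[En_oo Vn gn]].
  by apply: (family_orthogonal (g_le n) sg); rewrite eq_sym -e.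
case: (g_sol k) => [[r e [g0 _]]|[Ek _ _]]; last by rewrite En_oo Ek eqxx in Enk.
rewrite (_ : (fun m => _) = fun m => g k m * (m == - n)%:R) ?rsum_delta ?g0 //.
by apply/funext => m; rewrite gn mulrC.
Qed.

(** If [r] is the energy of [g n], subtracting from [u] its component along [g n] leaves a bounded
    solution orthogonal to the whole family, hence 0. For any other [r] already [u] is orthogonal to
    the family. *)
Lemma family_simple r : exists t : T -> R, forall u M, (forall m, `|u m| <= M) ->
  real_sol eps V r u -> exists a, forall m, u m = a * t m.
Proof.
have [[n hn]|hn] := pselect (exists n, En n = r%:E); last first.
  exists (fun=> 0) => u M hu su; exists 0 => m; rewrite mulr0.
  apply: (family_complete_bounded hu) => n; apply: (family_orthogonal hu su).
  by apply/eqP => e; apply: hn; exists n.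
have sgn : real_sol eps V r (g n).
  by case: (g_sol n) => [[r']|[]]; rewrite hn // => -[<-].
exists (g n) => u M hu su; pose a := rsum (fun m => u m * g n m); exists a => m.
have hv p : `|1 * u p + - a * g n p| <= M + `|a| * (5 / 4).
  apply: le_trans (ler_normD _ _) _; rewrite mul1r normrM normrN lerD //.
  by rewrite ler_wpM2l // g_le.
have := real_sol_comb 1 (- a) su sgn => sv.
suff : 1 * u m + - a * g n m = 0 by lra.
apply: (family_complete_bounded hv) => k.
have [ek|ek] := eqVneq (En k) r%:E; last exact: (family_orthogonal hv sv).
have -> : k = n by apply: En_inj; rewrite hn ek.
have s1 := summable_mulg n hu; have s2 := summable_mulg n (g_le n).
rewrite (_ : (fun m => _) = fun p => 1 * (u p * g n p) + - a * (g n p * g n p)); last first.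
  by apply/funext => p; ring.
rewrite rsumD ?rsumZ //; try exact: abs_summableZ.
by rewrite family_orthonormal eqxx -/a mul1r mulr1 subrr.
Qed.

End LocalizedFamily.

Section Completeness.
Context {R : realType} {d : nat}.
Local Notation T := 'rV[int]_d.
Variable g : T -> T -> R.
Hypothesis g_close : forall n, sums_le (fun m => `|g n m - (m == - n)%:R|) (1 / 4).

Let comb (L : seq (R[i] * T)) (m : T) : R[i] := \sum_(p <- L) p.1 * (g p.2 m)%:C.

(* Replacing each delta_k by the member of the family concentrated at k loses at
   most a quarter of the l^1 norm. *)
Lemma l1_approx_step (a : T -> R[i]) B : 0 < B -> sums_le (fun m => cabs (a m)) B ->
  exists L, sums_le (fun m => cabs (a m - comb L m)) (B * (1 / 2)).
Proof.
move=> B0 ha; have e0 : 0 < B / 4 by rewrite divr_gt0.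
have [N hN] := sums_le_tail (fun m => cabs_ge0 (a m)) ha e0.
exists [seq (a k, - k) | k <- ball N] => U uU.
pose rest m := if m \in @ball d N then 0 else a m.
have eqm m : a m - comb [seq (a k, - k) | k <- ball N] m =
    rest m + \sum_(k <- ball N) a k * ((m == k)%:R - g (- k) m)%:C.
  have -> : \sum_(k <- ball N) a k * ((m == k)%:R - g (- k) m)%:C =
      \sum_(k <- ball N) a k * (m == k)%:R - \sum_(k <- ball N) a k * (g (- k) m)%:C.
    rewrite -sumrB; apply: eq_bigr => k _; rewrite rmorphB /= mulrBr; congr (_ * _ - _).
    by case: (m == k).
  rewrite /comb big_map /= addrA; congr (_ - _).
  rewrite /rest; case: ifP => hm.
    rewrite (bigD1_seq m) ?ball_uniq //= eqxx mulr1 big1 ?addr0 ?add0r // => k km.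
    by rewrite eq_sym (negbTE km) mulr0.
  rewrite big_seq big1 ?addr0 // => k kB; case: eqP => [e|_]; last by rewrite mulr0.
  by rewrite e kB in hm.
apply: (@le_trans _ _ (\sum_(m <- U) cabs (rest m) +
   \sum_(m <- U) \sum_(k <- ball N) cabs (a k) * `|g (- k) m - (m == k)%:R|)).
  rewrite -big_split /=; apply: ler_sum => m _; rewrite eqm.
  apply: le_trans (cabsD _ _) _; rewrite lerD2l; apply: le_trans (cabs_sum _ _) _.
  by apply: ler_sum => k _; rewrite cabsM cabs_real distrC.
have -> : B * (1 / 2) = B / 4 + B * (1 / 4) by lra.
apply: lerD.
  rewrite (bigID (fun m => m \in @ball d N)) /= big1 ?add0r; last first.
    by move=> m hm; rewrite /rest hm cabs0.
  rewrite -big_filter.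
  rewrite (_ : \sum_(m <- _) _ = \sum_(m <- [seq m <- U | m \notin @ball d N]) cabs (a m)).
    by apply: hN; rewrite ?filter_uniq // => m; rewrite mem_filter => /andP [].
  rewrite big_seq [RHS]big_seq; apply: eq_bigr => m.
  by rewrite mem_filter /rest => /andP [/negbTE -> _].
rewrite exchange_big /=; apply: (@le_trans _ _ (\sum_(k <- ball N) cabs (a k) * (1 / 4))).
  apply: ler_sum => k _; rewrite -mulr_sumr ler_wpM2l ?cabs_ge0 //.
  by have := g_close (- k) uU; rewrite opprK.
by rewrite -mulr_suml ler_wpM2r ?ha ?ball_uniq //; lra.
Qed.

Lemma l1_approx (a : T -> R[i]) B j : 0 < B -> sums_le (fun m => cabs (a m)) B ->
  exists L, sums_le (fun m => cabs (a m - comb L m)) (B * (1 / 2) ^+ j).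
Proof.
move=> B0 ha; elim: j => [|j [L hL]].
  exists [::]; rewrite expr0 mulr1; apply: (sums_le_eq _ ha) => m.
  by rewrite /comb big_nil subr0.
have Bj : 0 < B * (1 / 2) ^+ j by rewrite mulr_gt0 // exprn_gt0 //; lra.
have [L' hL'] := l1_approx_step Bj hL.
exists (L ++ L'); rewrite (_ : B * (1 / 2) ^+ j.+1 = B * (1 / 2) ^+ j * (1 / 2)); last by rewrite exprS; ring.
apply: (sums_le_eq _ hL') => m.
by rewrite /comb big_cat /= opprD addrA.
Qed.

Lemma localized_family_total (S : set (T -> R[i])) :
  (forall n, ell2 (fun m => (g n m)%:C)) -> (forall n, S (fun m => (g n m)%:C)) -> l2total S.
Proof.
move=> g2 hS u u2 e e0.
have [A hA _] := sums_le_ell2 u2.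
have t0 : 0 < e ^+ 2 / 16 by rewrite divr_gt0 // exprn_gt0.
have [N hN] := sums_le_tail (fun m => sqr_ge0 (cabs (u m))) hA t0.
(* The cutoff makes [u] absolutely summable, so that the approximation in [l^1] applies; its error
   controls the [l^2] norm by [sums_le_sqr]. *)
pose u' m := if m \in @ball d N then u m else 0.
pose B := \sum_(m <- ball N) cabs (u m) + 1.
have s0 : 0 <= \sum_(m <- @ball d N) cabs (u m) by apply: sumr_ge0 => m _; apply: cabs_ge0.
have B0 : 0 < B by rewrite /B; lra.
have hu' : sums_le (fun m => cabs (u' m)) B.
  move=> U uU; apply: (@le_trans _ _ (\sum_(m <- ball N) cabs (u m))); last by rewrite /B; lra.
  rewrite (bigID (fun m => m \in @ball d N)) /= [X in _ + X]big1 ?addr0; last first.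
    by move=> m hm; rewrite /u' (negbTE hm) cabs0.
  rewrite (eq_bigr (fun m => cabs (u m))); last by move=> m hm; rewrite /u' hm.
  rewrite -big_filter; apply: ler_sum_sub; rewrite ?filter_uniq //.
    by move=> m; apply: cabs_ge0.
  by move=> m; rewrite mem_filter => /andP [].
have e4 : 0 < e / 4 by rewrite divr_gt0.
have [j hj] : exists j, B * (1 / 2) ^+ j <= e / 4.
  have c0 : (fun k => B * (1 / 2) ^+ k) @ \oo --> B * (0 : R).
    apply: cvgM; first exact: cvg_cst.
    by apply: cvg_expr; rewrite ger0_norm //; lra.
  rewrite mulr0 in c0; move/cvgrPdist_le : c0 => /(_ _ e4) [j _ /(_ j (leqnn j))].
  have h0 : 0 <= B * (1 / 2) ^+ j by apply: mulr_ge0; [exact: ltW|apply: exprn_ge0; lra].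
  by rewrite /= sub0r normrN ger0_norm // => h; exists j.
have [L hL] := l1_approx j B0 hu'; have {hL} hL := sums_leW hj hL.
exists (size L), (fun i => (tnth (in_tuple L) i).1),
  (fun i m => (g (tnth (in_tuple L) i).2 m)%:C); split; first by move=> i; split.
apply: (@le_lt_trans _ _ (e / 2)); last lra.
have e20 : 0 <= e / 2 by lra.
have hsq := sums_le_sqr (fun m => cabs_ge0 _) hL.
apply: (l2norm_le e20) => U uU.
apply: (@le_trans _ _ (\sum_(m <- U) (2 * cabs (u m - u' m) ^+ 2 + 2 * cabs (u' m - comb L m) ^+ 2))).
  apply: ler_sum => m _.
  have -> : (u - \sum_(i < size L) (tnth (in_tuple L) i).1 *:
      (fun m => (g (tnth (in_tuple L) i).2 m)%:C : R[i])) m = (u m - u' m) + (u' m - comb L m).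
    rewrite addrA subrK; congr (_ - _).
    by rewrite fct_sumE /comb [in RHS]big_tnth.
  have h := cabsD (u m - u' m) (u' m - comb L m).
  have h0 := cabs_ge0 ((u m - u' m) + (u' m - comb L m)).
  move: h h0 (cabs_ge0 (u m - u' m)) (cabs_ge0 (u' m - comb L m)).
  move: (cabs (_ + _)) (cabs (u m - _)) (cabs (u' m - _)) => x y z h1 h2 h3 h4.
  have : x ^+ 2 <= (y + z) ^+ 2 by apply: lerXn2r; rewrite ?nnegrE ?addr_ge0.
  have := sqr_ge0 (y - z); lra.
rewrite big_split /= -!mulr_sumr.
have h1 : \sum_(m <- U) cabs (u m - u' m) ^+ 2 <= e ^+ 2 / 16.
  rewrite (bigID (fun m => m \in @ball d N)) /= big1 ?add0r; last first.
    by move=> m hm; rewrite /u' hm subrr cabs0 expr0n.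
  rewrite (eq_bigr (fun m => cabs (u m) ^+ 2)); last first.
    by move=> m hm; rewrite /u' (negbTE hm) subr0.
  rewrite -big_filter; apply: hN; rewrite ?filter_uniq // => m.
  by rewrite mem_filter => /andP [].
have h2 := hsq U uU.
have -> : (e / 2) ^+ 2 = 2 * (e ^+ 2 / 16) + 2 * (e / 4) ^+ 2 by field.
by apply: lerD; rewrite ler_pM2l.
Qed.

End Completeness.

(** * Real solutions as eigenvectors of the operator *)

Section OperatorReal.
Context {R : realType} {d : nat}.
Local Notation T := 'rV[int]_d.
Variables (f : R -> \bar R) (w : 'rV[R]_d) (eps x : R).
Local Notation V := (potential f w x).
Implicit Types (u : T -> R[i]) (v : T -> R).

Lemma laplacianE u n : laplacian u n = \sum_(m <- nbrs n) u m.
Proof.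
rewrite /laplacian (_ : [set m | _] = [set` nbrs n]) -?fsbig_seq ?nbrs_uniq //.
by apply/seteqP; split=> m /=; rewrite nbrsP => /eqP.
Qed.

Lemma abs_summable_ell2 v : abs_summable v -> ell2 (fun n => (v n)%:C).
Proof.
move=> /abs_summable_sqr [B hB]; apply: (@ell2_sums_le _ _ _ B).
by apply: (sums_le_eq _ hB) => n; rewrite cabs_real real_normK // num_real.
Qed.

Lemma real_sol_eigeneq r v : abs_summable v -> real_sol eps V r v ->
  eigeneq f w eps x r%:E (fun n => (v n)%:C).
Proof.
move=> sv [v0 hv]; split; first split.
- exact: abs_summable_ell2.
- by move=> n hn; rewrite v0.
(* For the domain, the equation expresses the potential times [v] by [v] and its translates, which
   are summable. At a singular site the left side is 0, so the hopping term is added back there. *)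
- have -> : (fun n => (fine (V n))%:C * (v n)%:C) =
      (fun n => (r * v n + - eps * (\sum_(p <- nbrs 0) v (n + p)) +
         (if V n == -oo%E then eps * \sum_(p <- nbrs 0) v (n + p) else 0))%:C).
    apply/funext => n; rewrite -rmorphM /=; congr (_ %:C).
    case: eqVneq => [Vn|Vn]; first by rewrite v0 // !mulr0 add0r mulNr addNr.
    have := hv n Vn; rewrite nbrs_sum; lra.
  apply: abs_summable_ell2; apply: abs_summableD.
    apply: abs_summableD; first exact: abs_summableZ.
    apply: abs_summableZ; apply: abs_summable_sum => p; exact: abs_summable_shift.
  apply: (@abs_summable_le _ _ _ (fun n => eps * \sum_(p <- nbrs 0) v (n + p))).
    by move=> n; case: ifP => // _; rewrite normr0.
  apply: abs_summableZ; apply: abs_summable_sum => p; exact: abs_summable_shift.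
- apply/funext => n; rewrite /opH.
  have -> : (r%:C *: (fun n => (v n)%:C : R[i])) n = r%:C * (v n)%:C by [].
  case: ifPn => [|hn]; first by rewrite inE => hn; rewrite v0 // mulr0.
  rewrite laplacianE -(rmorph_sum (real_complex R)) -!rmorphM -rmorphD /=; congr (_ %:C).
  have Vn : V n != -oo%E by apply: contra hn => /eqP hn; rewrite inE.
  have := hv n Vn; lra.
Qed.

Lemma ell2_bounded u : ell2 u ->
  exists M, forall n, `|complex.Re (u n)| <= M /\ `|complex.Im (u n)| <= M.
Proof.
move=> /sums_le_ell2 [B hB _]; exists (1 + B) => n.
have := hB [:: n] isT; rewrite big_seq1 sqr_cabs.
move: (complex.Re _) (complex.Im _) => a b h.
by split; rewrite ler_norml; apply/andP; split; nra.
Qed.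

Lemma eigeneq_real_sol r u : eigeneq f w eps x r%:E u ->
  real_sol eps V r (fun n => complex.Re (u n)) /\ real_sol eps V r (fun n => complex.Im (u n)).
Proof.
move=> [[_ u0 _] heq].
have ReS (s : seq T) : complex.Re (\sum_(m <- s) u m) = \sum_(m <- s) complex.Re (u m).
  by apply: (big_morph (fun z : R[i] => complex.Re z)) => // -[a b] [a' b'].
have ImS (s : seq T) : complex.Im (\sum_(m <- s) u m) = \sum_(m <- s) complex.Im (u m).
  by apply: (big_morph (fun z : R[i] => complex.Im z)) => // -[a b] [a' b'].
have main n : V n != -oo%E ->
    eps%:C * \sum_(m <- nbrs n) u m + (fine (V n))%:C * u n = r%:C * u n.
  move=> Vn; have := congr1 (fun F => F n) heq; rewrite /opH.
  rewrite ifF; last by apply/negP; rewrite inE => h; move/eqP: Vn.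
  by rewrite laplacianE.
split; split=> n Vn; try by rewrite u0.
  rewrite -ReS; have := congr1 (fun z : R[i] => complex.Re z) (main n Vn).
  by case: (u n) => a b; case: (\sum_(_ <- _) _) => a' b' /=; lra.
rewrite -ImS; have := congr1 (fun z : R[i] => complex.Im z) (main n Vn).
by case: (u n) => a b; case: (\sum_(_ <- _) _) => a' b' /=; lra.
Qed.

(** Real and imaginary parts of an eigenvector solve the same real equation and are bounded, so both
    are multiples of one [t]. *)
Lemma simple_spectrum_real :
  (forall n m, singular f w x n -> singular f w x m -> n = m) ->
  (forall r, exists t : T -> R, forall v M, (forall m, `|v m| <= M) ->
     real_sol eps V r v -> exists a, forall m, v m = a * t m) ->
  simple_spectrum f w eps x.
Proof.
move=> hs ht lam u v [].
case: lam => [r||] // eu nu [ev _]; last first.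
  case: eu nu => n [c [sn ->]] nu; case: ev => m [c' [sm ->]].
  rewrite (hs m n sm sn); exists (c' / c).
  have c0 : c != 0 by apply/eqP => c0; apply: nu; rewrite c0 scale0r.
  by rewrite scalerA divfK.
have [t tP] := ht r.
have key z : eigeneq f w eps x r%:E z -> exists c : R[i], forall m, z m = c * (t m)%:C.
  move=> ez; have [[z2 _ _] _] := ez; have [M hM] := ell2_bounded z2.
  have [zr zi] := eigeneq_real_sol ez.
  have [a ha] := tP _ M (fun m => (hM m).1) zr.
  have [b hb] := tP _ M (fun m => (hM m).2) zi.
  exists (a +i* b) => m; have := ha m; have := hb m; case: (z m) => p p' /= -> ->.
  by apply/eqP; rewrite eq_complex /= !mulr0 subr0 add0r !eqxx.
have [c hc] := key u eu; have [c' hc'] := key v ev.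
have c0 : c != 0.
  by apply/eqP => c0; apply: nu; apply/funext => m; rewrite hc c0 mul0r.
exists (c' / c); apply/funext => m.
have -> : (c' / c *: u) m = c' / c * u m by [].
by rewrite hc hc' mulrA divfK.
Qed.

Lemma l2dot_real (a b : T -> R) :
  l2dot (fun n => (a n)%:C) (fun n => (b n)%:C) = (rsum (fun n => a n * b n))%:C.
Proof.
rewrite /l2dot /csum; apply/eqP; rewrite eq_complex /=; apply/andP; split; apply/eqP.
  by congr rsum; apply/funext => n /=; rewrite oppr0 mulr0 subr0.
by rewrite -[RHS](@rsum0 R d); congr rsum; apply/funext => n /=; rewrite oppr0 mul0r mulr0 addr0.
Qed.

Lemma l2norm_real v : abs_summable v ->
  l2norm (fun n => (v n)%:C) = Num.sqrt (rsum (fun n => v n ^+ 2)).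
Proof.
move=> /abs_summable_sqr [B hB]; rewrite /l2norm; congr Num.sqrt.
have [|s [-> cs _ _]] := @sqnorm_sums_le R d (fun n => (v n)%:C) B.
  by apply: (sums_le_eq _ hB) => n; rewrite cabs_real real_normK // num_real.
rewrite /=; apply/esym/rsum_eq.
  by exists B; apply: (sums_le_eq _ hB) => n; rewrite ger0_norm ?sqr_ge0.
rewrite (_ : bsum _ = bsum (fun n => cabs (v n)%:C ^+ 2)) //.
by congr bsum; apply/funext => n; rewrite cabs_real real_normK // num_real.
Qed.

End OperatorReal.

(** * Eigenfunctions *)

Section MonotoneJumps.
Context {R : realType}.
Variable F : R -> R.
Hypothesis F_mono : forall x y : R, 0 < x -> x <= y -> y < 1 -> F x <= F y.

(** Only the open interval is considered: for [F] the finite part of [f], the value [-oo] at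
    integers is replaced by 0, which breaks monotonicity at the endpoint. *)
Definition jump : set R := [set z | [/\ 0 < z, z < 1 & exists2 e : R, 0 < e &
  forall y1 y2, 0 < y1 -> y1 < z -> z < y2 -> y2 < 1 -> e <= F y2 - F y1]].

(** A rational in the gap above the supremum of the values to the left of [z]. Distinct jumps get
    distinct rationals, since a point between them separates the two. *)
Lemma jump_rational z : jump z -> exists p : rat,
  (forall y, 0 < y -> y < z -> F y < ratr p) /\ (forall y, z < y -> y < 1 -> ratr p < F y).
Proof.
move=> [z0 z1 [e e0 he]]; pose S := [set F y | y in [set y | 0 < y < z]].
have hub y2 : z < y2 -> y2 < 1 -> ubound S (F y2 - e).
  move=> zy y1 _ [y /= /andP [h1 h2] <-].
  by have := he y y2 h1 h2 zy y1; lra.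
have S0 : S !=set0 by exists (F (z / 2)); exists (z / 2) => //=; lra.
have SU : has_ubound S by exists (F ((z + 1) / 2) - e); apply: hub; lra.
have [p] : exists p : rat, ratr p \in `]sup S, sup S + e[.
  by apply: rat_in_itvoo; rewrite ltrDl.
rewrite in_itv /= => /andP [h1 h2]; exists p; split=> y hy1 hy2.
  apply: le_lt_trans h1; apply: ub_le_sup => //; exists y => //=; exact/andP.
have := ge_sup S0 (hub y hy1 hy2); lra.
Qed.

Lemma jump_countable : countable jump.
Proof.
have /choice [p hp] (z : R) : exists p : rat, jump z ->
  (forall y, 0 < y -> y < z -> F y < ratr p) /\ (forall y, z < y -> y < 1 -> ratr p < F y).
  have [/jump_rational [p hp]|h] := pselect (jump z); first by exists p.
  by exists 0 => /h.
have lt_case z z' : jump z -> jump z' -> z < z' -> p z = p z' -> False.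
  move=> jz jz' zz e; have [_ h1] := hp z jz; have [h2 _] := hp z' jz'.
  case: jz jz' => z0 _ _ [_ z1 _].
  have := h1 ((z + z') / 2); have := h2 ((z + z') / 2); rewrite e => a b.
  have : F ((z + z') / 2) < ratr (p z') by apply: a; lra.
  have : ratr (p z') < F ((z + z') / 2) by apply: b; lra.
  by lra.
apply/countable_injP; exists (fun z => choice.pickle (p z)) => z z'.
rewrite !inE => jz jz' /(pcan_inj choice.pickleK) e.
case: (ltgtP z z') => // h; first by case: (lt_case z z').
by case: (lt_case z' z).
Qed.

Lemma not_jump_continuous z (e : R) : 0 < z -> z < 1 -> ~ jump z -> 0 < e ->
  exists2 r : R, 0 < r & forall y, `|y - z| < r -> [/\ 0 < y, y < 1 & `|F y - F z| <= e].
Proof.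
move=> z0 z1 nj e0.
have [y1 [y2 [a1 a2 a3 a4 a5]]] : exists y1 y2, [/\ 0 < y1, y1 < z, z < y2, y2 < 1 & F y2 - F y1 < e].
  apply: contrapT => h; apply: nj; split=> //; exists e => // y1 y2 h1 h2 h3 h4.
  by rewrite leNgt; apply/negP => h5; apply: h; exists y1, y2; split.
exists (Num.min (z - y1) (y2 - z)); first by rewrite lt_min; lra.
move=> y; rewrite lt_min !ltr_norml => /andP [/andP [h1 h2] /andP [h3 h4]].
have y0 : 0 < y by lra.
have yy1 : y < 1 by lra.
have b1 : F y1 <= F y by apply: F_mono; lra.
have b2 : F y <= F y2 by apply: F_mono; lra.
have b3 : F y1 <= F z by apply: F_mono; lra.
have b4 : F z <= F y2 by apply: F_mono; lra.
by split=> //; rewrite ler_norml; apply/andP; split; lra.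
Qed.
End MonotoneJumps.

Section OrbitContinuity.
Context {R : realType} {d : nat}.
Local Notation T := 'rV[int]_d.
Variables (alpha : R) (f : R -> \bar R) (w : 'rV[R]_d).
Hypothesis hf : holder_monotone alpha f.

Let F z := fine (f z).

Lemma fine_mono x y : 0 < x -> x <= y -> y < 1 -> F x <= F y.
Proof.
move=> x0 xy y1; case: hf => fin per fint mono.
have nint z : 0 < z -> z < 1 -> f z != -oo%E.
  move=> z0 z1; apply/eqP => /fint [k e]; move: z0 z1; rewrite e ltr0z ltrz1; lia.
have := mono x y (ltW x0) xy y1; have := fin x; have := fin y.
have := nint x x0 (le_lt_trans xy y1); have := nint y (lt_le_trans x0 xy) y1.
rewrite /F; case: (f x) => [r||] //; case: (f y) => [s||] //= _ _ _ _.
by rewrite -EFinD lee_fin; have := powR_ge0 (y - x) alpha; lra.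
Qed.

(** Finiteness near [z] is demanded separately, because [fine] hides the value [-oo]. *)
Definition continuity_phase : set R := [set z | forall e : R, 0 < e -> exists2 r : R, 0 < r &
  forall y, `|y - z| < r -> f y != -oo%E /\ `|F y - F z| <= e].

Lemma continuity_phase_fr z : continuity_phase (fr z) -> continuity_phase z.
Proof.
have [k e] := fr_split z; case: hf => _ per _ _ hz a a0.
have [r r0 hr] := hz a a0; exists r => // y hy.
have fk t : f (t - k%:~R) = f t.
  rewrite -(periodic_fr _ per) -[RHS](periodic_fr _ per); congr f.
  by rewrite -intrN frDz.
have : `|y - k%:~R - fr z| < r by rewrite (_ : y - _ - _ = y - z) //; lra.
by move/hr; rewrite /F fk (periodic_fr _ per).
Qed.

Lemma continuity_phase_in z : 0 < z -> z < 1 -> ~ jump F z -> continuity_phase z.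
Proof.
move=> z0 z1 nj e e0; have [r r0 hr] := not_jump_continuous fine_mono z0 z1 nj e0.
exists r => // y /hr [y0 y1 h]; split=> //.
case: hf => _ _ fint _; apply/eqP => /fint [k ek]; move: y0 y1.
by rewrite ek ltr0z ltrz1; lia.
Qed.

Definition regular_orbit : set R := [set x | forall n : T, continuity_phase (x + idot n w)].

(** On an irregular orbit some phase is, modulo 1, either 0 or a jump; together with a site and an
    integer this determines [x], and all three range over countable sets. *)
Lemma irregular_countable : countable (~` regular_orbit).
Proof.
pose S := [set 0] `|` jump F.
have cS : countable S.
  rewrite /S -bigcup2E; apply: bigcup_countable => // i _; rewrite /bigcup2.
  case: ifP => _; first exact: countable1.
  case: ifP => _; last exact: countable0.
  by apply: jump_countable; apply: fine_mono.
pose B (p : T * int) := [set y + p.2%:~R - idot p.1 w | y in S].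
apply: (sub_countable (B := \bigcup_(p in [set: T * int]) B p)); last first.
  apply: bigcup_countable => // p _; apply: sub_countable cS; exact: card_image_le.
apply: subset_card_le => x /= /existsNP [n hn].
have [k e] := fr_split (x + idot n w).
exists (n, k) => //; exists (fr (x + idot n w)); last by rewrite /= -e addrK.
have [->|n0] := eqVneq (fr (x + idot n w)) 0; first by left.
right; apply: contrapT => nj; apply: hn; apply: continuity_phase_fr.
by apply: continuity_phase_in => //; rewrite ?fr_lt1 // lt_neqAle eq_sym n0 fr_ge0.
Qed.

End OrbitContinuity.

(** * The covariant family of eigenfunctions *)

Section Eigenfunctions.
Context {R : realType} {d : nat}.
Local Notation T := 'rV[int]_d.
Variables (eps q rho mu : R).
Hypotheses (q_gt0 : 0 < q) (q_small : q *+ (4 * d) <= 1 / 8) (q_le_1 : q <= 1).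
Hypotheses (hrho : 0 < rho) (hmu : 0 < mu).
Variable w : 'rV[R]_d.
Hypothesis hw : Omega rho mu w.
Variables (f : R -> \bar R) (E : R -> \bar R) (phi : R -> T -> R).
Hypothesis f_int : forall x, f x = -oo%E -> exists k : int, x = k%:~R.
Hypothesis E_per : forall x, E (x + 1) = E x.
Hypothesis E_mono : forall x y : R, 0 <= x -> x < y -> y < 1 -> (E x < E y)%E.
Hypothesis phi_per : forall x, phi (x + 1) = phi x.
Hypothesis E_sing : forall x, f x = -oo%E -> E x = -oo%E /\ phi x = fun n => (n == 0)%:R.
Hypothesis E_fin : forall x, f x != -oo%E -> exists2 r : R, E x = r%:E &
  localized_sol eps q (fun n => f (x + idot n w)) r (phi x) /\ `|r - fine (f x)| <= 1.

(** A nonzero [n] would contradict the separation of phases at a scale whose radius exceeds its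
    norm. *)
Lemma idot_int n (k : int) : idot n w = k%:~R -> n = 0.
Proof.
move=> h; apply/eqP/negPn/negP => n0.
have hn : (l1 n <= 2 ^ (l1 n).+2)%N.
  by apply: ltnW; apply: leq_ltn_trans (leqnSn _) _; apply: leq_ltn_trans (leqnSn _) _; apply: ltn_expl.
have := thc_sep hrho hmu k hw n0 hn; rewrite h subrr normr0.
by rewrite leNgt mulr_gt0 // thc_gt0.
Qed.

Lemma E_orbit_inj x : injective (fun n => E (x - idot n w)).
Proof.
move=> m n /= e; rewrite -(periodic_fr _ E_per) -[RHS](periodic_fr _ E_per) in e.
have ge (z : R) := fr_ge0 z; have lt (z : R) := fr_lt1 z.
have e' : fr (x - idot m w) = fr (x - idot n w).
  case: (ltgtP (fr (x - idot m w)) (fr (x - idot n w))) => // h.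
    by have := E_mono (ge _) h (lt _); rewrite e ltxx.
  by have := E_mono (ge _) h (lt _); rewrite e ltxx.
have [k1 e1] := fr_split (x - idot m w); have [k2 e2] := fr_split (x - idot n w).
have h : idot (m - n) w = (k2 - k1)%:~R by rewrite idotB intrB; lra.
by apply/eqP; rewrite -subr_eq0 (idot_int h).
Qed.

Lemma singular_unique x n m : singular f w x n -> singular f w x m -> n = m.
Proof.
move=> /f_int [k1 e1] /f_int [k2 e2].
have h : idot (n - m) w = (k1 - k2)%:~R by rewrite idotB intrB; lra.
by apply/eqP; rewrite -subr_eq0 (idot_int h).
Qed.

Lemma phi_0 x : phi x 0 = 1.
Proof.
have [/E_sing [_ ->]|/E_fin [r _ [[-> ]]]//] := eqVneq (f x) -oo%E.
by rewrite eqxx.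
Qed.

Lemma phi_le x n : `|phi x n| <= q ^+ l1 n.
Proof.
have [/E_sing [_ ->]|/E_fin [r _ [[]]]//] := eqVneq (f x) -oo%E.
case: eqP => [->|_]; first by rewrite l1_0 normr1 expr0.
by rewrite normr0 exprn_ge0 // ltW.
Qed.

Lemma geometric_sums_le (p : R) : 0 <= p -> p *+ (4 * d) <= 1 ->
  sums_le (fun n : T => p ^+ l1 n) (1 + p *+ (4 * d)).
Proof.
move=> p0 p1 U uU; rewrite (bigID (fun n => n == 0)) /= lerD ?lattice_sum_le //.
rewrite -big_filter.
apply: le_trans (ler_sum_sub (L := [:: 0]) _ _ _) _.
- by move=> n; apply: exprn_ge0.
- exact: filter_uniq.
- by move=> n; rewrite mem_filter inE => /andP [].
- by rewrite big_seq1 l1_0 expr0.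
Qed.

Let Q2 : R := q ^+ 2 *+ (4 * d).

Lemma Q2_le : Q2 <= 1 / 8.
Proof.
by apply: le_trans q_small; apply: ler_wMn2r; rewrite expr2 ger_pMl.
Qed.

Lemma phi_sqr_sums_le x : sums_le (fun n => phi x n ^+ 2) (1 + Q2).
Proof.
have h : Q2 <= 1 by apply: le_trans Q2_le _; lra.
apply: (sums_le_eq _ (geometric_sums_le (sqr_ge0 q) h)) => n.
rewrite -exprM mulnC exprM -real_normK ?num_real //.
by apply: lerXn2r; rewrite ?nnegrE ?phi_le // exprn_ge0 // ltW.
Qed.

Definition mass x := rsum (fun n => phi x n ^+ 2).

Lemma phi_sqr_summable x : abs_summable (fun n => phi x n ^+ 2).
Proof.
exists (1 + Q2); apply: (sums_le_eq _ (phi_sqr_sums_le x)) => n.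
by rewrite ger0_norm ?sqr_ge0.
Qed.

Lemma mass_ge1 x : 1 <= mass x.
Proof.
apply: (cvgr_to_ge (rsum_lim (phi_sqr_summable x))); apply: nearW => N.
rewrite /bsum (bigD1_seq 0) ?ball_uniq ?mem_ball ?l1_0 //= phi_0 expr1n lerDl.
by apply: sumr_ge0 => n _; rewrite sqr_ge0.
Qed.

Lemma mass_le x : mass x <= 1 + Q2.
Proof.
apply: (cvgr_to_le (rsum_lim (phi_sqr_summable x))); apply: nearW => N.
by apply: phi_sqr_sums_le; apply: ball_uniq.
Qed.

Lemma sqrt_mass x : 1 <= Num.sqrt (mass x).
Proof. by rewrite -[leLHS]sqrtr1 ler_sqrt ?mass_ge1 // (le_trans ler01) ?mass_ge1. Qed.

Definition nphi x n := phi x n / Num.sqrt (mass x).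

Lemma nphi_le x n : `|nphi x n| <= q ^+ l1 n.
Proof.
have s1 := sqrt_mass x; have s0 : 0 < Num.sqrt (mass x) by apply: lt_le_trans s1.
rewrite normrM normfV (gtr0_norm s0) ler_pdivrMr //.
apply: le_trans (phi_le x n) _; apply: ler_peMr => //; apply: exprn_ge0; exact: ltW.
Qed.

Lemma nphi_0 x : `|nphi x 0 - 1| <= Q2.
Proof.
have s1 := sqrt_mass x; have s0 : 0 < Num.sqrt (mass x) by apply: lt_le_trans s1.
have e : mass x = Num.sqrt (mass x) ^+ 2 by rewrite sqr_sqrtr // (le_trans ler01) ?mass_ge1.
have m1 := mass_le x; rewrite e in m1.
rewrite /nphi phi_0; move: s1 s0 m1; move: (Num.sqrt _) => s s1 s0 m1.
have i1 : 1 / s <= 1 by rewrite ler_pdivrMr // mul1r.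
rewrite ler0_norm ?subr_le0 // opprB lerBlDr -lerBlDl ler_pdivlMr //; nra.
Qed.

Lemma nphi_close x : sums_le (fun n => `|nphi x n - (n == 0)%:R|) (1 / 4).
Proof.
move=> U uU; have Q0 : 0 <= Q2 by rewrite mulrn_wge0 // sqr_ge0.
rewrite (bigID (fun n => n == 0)) /= (_ : 1 / 4 = 1 / 8 + 1 / 8); last by lra.
apply: lerD.
  rewrite -big_filter.
  apply: le_trans (ler_sum_sub (L := [:: 0]) _ _ _) _ => //.
  - exact: filter_uniq.
  - by move=> n; rewrite mem_filter inE => /andP [].
  - by rewrite big_seq1 eqxx; apply: le_trans (nphi_0 x) Q2_le.
have q1 : q *+ (4 * d) <= 1 by apply: le_trans q_small _; lra.
apply: le_trans (le_trans (lattice_sum_le (ltW q_gt0) q1 uU) q_small).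
by apply: ler_sum => n n0; rewrite (negbTE n0) subr0 nphi_le.
Qed.

Lemma nphi_summable x : abs_summable (nphi x).
Proof.
have q1 : q *+ (4 * d) <= 1 by apply: le_trans q_small _; lra.
exists (1 + q *+ (4 * d)); apply: (sums_le_eq _ (geometric_sums_le (ltW q_gt0) q1)) => n.
exact: nphi_le.
Qed.

Lemma nphi_norm x : rsum (fun n => nphi x n ^+ 2) = 1.
Proof.
have m1 := mass_ge1 x; have m0 : 0 < mass x by apply: lt_le_trans m1.
rewrite (_ : (fun n => _) = fun n => (mass x)^-1 * phi x n ^+ 2); last first.
  apply/funext => n; rewrite /nphi exprMn exprVn sqr_sqrtr ?ltW // mulrC //.
by rewrite rsumZ ?mulVf ?gt_eqF //; apply: phi_sqr_summable.
Qed.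

Lemma nphi_sing x : f x = -oo%E -> forall n, nphi x n = (n == 0)%:R.
Proof.
move=> fx n; rewrite /nphi; have [_ ph] := E_sing fx.
have -> : mass x = 1.
  rewrite /mass ph -[RHS](rsum_delta (fun=> 1) (0 : T)); congr rsum; apply/funext => m.
  by rewrite mul1r; case: eqP; rewrite ?expr1n ?expr0n.
by rewrite sqrtr1 divr1 ph.
Qed.

Definition orbit_family x n m := nphi (x - idot n w) (n + m).

Lemma orbit_family_close x n : sums_le (fun m => `|orbit_family x n m - (m == - n)%:R|) (1 / 4).
Proof.
apply: (sums_le_eq _ (sums_le_shift n (nphi_close (x - idot n w)))) => m.
by rewrite /orbit_family [n + m]addrC addr_eq0.
Qed.

Lemma orbit_family_sol x n :
  (exists2 r, E (x - idot n w) = r%:E & real_sol eps (potential f w x) r (orbit_family x n)) \/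
  [/\ E (x - idot n w) = -oo%E, potential f w x (- n) = -oo%E
    & forall m, orbit_family x n m = (m == - n)%:R].
Proof.
set z := x - idot n w; have [fz|fz] := eqVneq (f z) -oo%E.
  right; split; first by have [] := E_sing fz.
    by rewrite /potential idotN.
  by move=> m; rewrite /orbit_family -/z nphi_sing // addrC addr_eq0.
left; have [r Er [[_ _ hs he] _]] := E_fin fz; exists r => //.
have pot m : potential f w x m = f (z + idot (n + m) w).
  by rewrite /potential idotD; congr f; rewrite /z; ring.
split=> m; rewrite pot => hm; rewrite /orbit_family -/z /nphi.
  by rewrite hs // mul0r.
have := he _ hm; rewrite -mulr_suml nbrs_sum => h.
rewrite nbrs_sum (eq_bigr (fun p => phi z (n + m + p))); last by move=> p _; rewrite addrA.
by rewrite !mulrA -mulrDl h mul0r.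
Qed.

Lemma orbit_family_norm x n : rsum (fun m => orbit_family x n m ^+ 2) = 1.
Proof.
rewrite -[RHS](nphi_norm (x - idot n w)) -[RHS](rsum_shift _ n); congr rsum.
by apply/funext => m; rewrite /orbit_family [n + m]addrC.
Qed.

Hypothesis f_holder : exists alpha, holder_monotone alpha f.

(** Two localized solutions at one phase are both close to [basisv 0], hence not orthogonal, so
    their energies agree; simplicity and the value 1 at the origin then identify them. This
    determines all limits along ultrafilters. *)
Lemma localized_sol_unique x r phi1 : f x != -oo%E ->
  localized_sol eps q (fun n => f (x + idot n w)) r phi1 -> E x = r%:E /\ phi1 = phi x.
Proof.
move=> fx [p0 ple ps pe]; have [r0 Er0 [[_ _ hs he] _]] := E_fin fx.
have q1 : q *+ (4 * d) <= 1 by apply: le_trans q_small _; lra.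
have gs := geometric_sums_le (ltW q_gt0) q1.
have one (v : T -> R) : (forall n, `|v n| <= q ^+ l1 n) -> forall n : T, `|v n| <= 1.
  by move=> hv n; apply: le_trans (hv n) _; rewrite exprn_ile1 // ltW.
have s1 : abs_summable phi1 by exists (1 + q *+ (4 * d)); apply: (sums_le_eq _ gs).
have sol0 : real_sol eps (potential f w x) r0 (phi x) by [].
have sol1 : real_sol eps (potential f w x) r phi1 by [].
have rr : r0 = r.
  apply/eqP/negPn/negP => rn.
  have h0 := real_sol_orthogonal (one _ (phi_le x)) s1 sol0 sol1 rn.
  have sp : abs_summable (fun n => phi x n * phi1 n).
    apply: (abs_summable_le _ s1) => n; rewrite normrM ler_piMl //; exact: one (phi_le x) _.
  suff : 1 / 2 <= rsum (fun n => phi x n * phi1 n) by rewrite h0; lra.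
  apply: (cvgr_to_ge (rsum_lim sp)); apply: nearW => N.
  rewrite /bsum (bigD1_seq 0) ?ball_uniq ?mem_ball ?l1_0 //= phi_0 p0 mulr1.
  have hb : `|\sum_(n <- ball N | n != 0) phi x n * phi1 n| <= 1 / 8.
    apply: le_trans (ler_norm_sum _ _ _) _.
    apply: le_trans (le_trans (lattice_sum_le (ltW q_gt0) q1 (ball_uniq N)) q_small).
    apply: ler_sum => n _; rewrite normrM; apply: le_trans (ple n).
    by rewrite ler_piMl //; exact: one (phi_le x) _.
  by move: hb; rewrite ler_norml => /andP [h _]; lra.
rewrite {r0}rr in Er0 sol0 he; split=> //.
have [t tP] := family_simple (orbit_family_close x) (@E_orbit_inj x) (orbit_family_sol x)
  (orbit_family_norm x) r.
have [a ha] := tP _ 1 (one _ (phi_le x)) sol0.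
have [b hb] := tP _ 1 (one _ ple) sol1.
have e0 : a * t 0 = b * t 0 by rewrite -ha -hb phi_0 p0.
have t0 : t 0 != 0.
  by apply/eqP => t0; have := phi_0 x; rewrite ha t0 mulr0 => /esym/eqP; rewrite oner_eq0.
by apply/funext => n; rewrite hb ha (mulIf t0 e0).
Qed.

(** Compactness and uniqueness: along any ultrafilter of phases tending to [x] the potentials
    converge at every site and the energies stay bounded, so the limit of [phi y] is a localized
    solution at [x], and there is only one. *)
Lemma phi_continuous x n : regular_orbit f w x -> phi y n @[y --> x] --> phi x n.
Proof.
move=> hx.
have nb (r : R) : 0 < r -> \forall y \near x, `|y - x| < r.
  move=> r0; have /cvgrPdist_lt /(_ r r0) : y @[y --> x] --> x by apply: cvg_id.
  by apply: filterS => y; rewrite distrC.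
have near_fin (m : T) : \forall y \near x, f (y + idot m w) != -oo%E.
  have [r r0 hr] := hx m 1 ltr01; apply: filterS (nb r r0) => y h; have [] // := hr (y + idot m w).
  by rewrite (_ : y + _ - _ = y - x) //; lra.
have fcont (m : T) : fine (f (y + idot m w)) @[y --> x] --> fine (f (x + idot m w)).
  apply/cvgrPdist_le => e e0; have [r r0 hr] := hx m e e0.
  apply: filterS (nb r r0) => y h; rewrite distrC; have [] // := hr (y + idot m w).
  by rewrite (_ : y + _ - _ = y - x) //; lra.
have fx m : f (x + idot m w) != -oo%E by have := nbhs_singleton (near_fin m).
have fx0 : f x != -oo%E by have := fx 0; rewrite idot0 addr0.
have PF : ProperFilter (nbhs x) by exact: nbhs_pfilter.
apply: (@ultra_cvg _ _ (nbhs x) _ _ PF) => U UU xU.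
have near_fin0 : U [set y | f y != -oo%E].
  apply: xU; apply: filterS (near_fin 0) => y /=; by rewrite idot0 addr0.
have hE : U [set y | `|fine (E y)| <= `|fine (f x)| + 2].
  have h1 : U [set y | `|fine (f x) - fine (f y)| <= 1].
    have := fcont 0; under eq_fun do rewrite idot0 addr0; rewrite idot0 addr0 => fc.
    by apply: xU; move/cvgrPdist_le : fc => /(_ 1 ltr01).
  apply: filterS (filterI near_fin0 h1) => y [/= fy h].
  have [r -> [_ hr]] := E_fin fy; rewrite /=.
  have -> : r = (r - fine (f y)) - (fine (f x) - fine (f y)) + fine (f x) by ring.
  apply: le_trans (ler_normD _ _) _; rewrite addrC lerD2l.
  by apply: le_trans (ler_normB _ _) _; lra.
have [m fm|m fm|m|r [phi1 [_ h2 h3]]] := @limit_solution R d eps q R U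
    (fun m => f (x + idot m w)) (fun y m => fine (f (y + idot m w)))
    (fun y => fine (E y)) phi (`|fine (f x)| + 2) UU (ltW q_gt0) q_le_1 _ _ hE
    phi_0 phi_le _.
- by move=> B /fcont; apply: xU.
- by move: (fx m); rewrite fm.
- apply: filterS (filterI near_fin0 (xU _ (near_fin m))) => y [/= fy fm].
  by have [r -> [[_ _ _ he] _]] := E_fin fy; apply: he.
have [_ <-] := localized_sol_unique fx0 h3.
exact: h2.
Qed.

Let q_sums : sums_le (fun n : T => q ^+ l1 n) (1 + q *+ (4 * d)).
Proof. by apply: geometric_sums_le; [exact: ltW|apply: le_trans q_small _; lra]. Qed.

Let sqr_le (t : R) (n : T) : `|t| <= q ^+ l1 n -> `|t ^+ 2| <= q ^+ l1 n.
Proof.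
move=> h; rewrite normrX expr2; refine (le_trans _ h).
by rewrite ler_piMl // (le_trans h) // exprn_ile1 // ltW.
Qed.

Lemma mass_continuous x : regular_orbit f w x -> mass y @[y --> x] --> mass x.
Proof.
move=> hx; apply: (@rsum_dominated R d R (nbhs x) (fun y n => phi y n ^+ 2) (fun n => phi x n ^+ 2)
  _ _ _ q_sums) => [y n|n|n].
- exact/sqr_le/phi_le.
- exact/sqr_le/phi_le.
- under eq_fun do rewrite expr2; rewrite expr2; apply: cvgM; exact: phi_continuous.
Qed.

Lemma nphi_continuous x n : regular_orbit f w x -> nphi y n @[y --> x] --> nphi x n.
Proof.
move=> hx; apply: cvgM; first exact: phi_continuous.
apply: cvgV; first by rewrite gt_eqF // (lt_le_trans _ (sqrt_mass x)).
exact: (cvg_comp _ _ (mass_continuous hx) (@sqrt_continuous R (mass x))).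
Qed.

Definition eigenfunction x : T -> R[i] := fun n => (nphi x n)%:C.

Lemma eigenfunction_continuous x (e : R) : regular_orbit f w x -> 0 < e ->
  \forall y \near x, l2norm (eigenfunction y - eigenfunction x) < e.
Proof.
move=> hx e0.
have q4 : sums_le (fun n : T => 4 * q ^+ l1 n) (4 * (1 + q *+ (4 * d))).
  exact: sums_leZ q_sums.
have c0 : rsum (fun n => (nphi y n - nphi x n) ^+ 2) @[y --> x] --> rsum (fun _ : T => 0 : R).
  apply: (@rsum_dominated R d R (nbhs x) (fun y n => (nphi y n - nphi x n) ^+ 2) (fun=> 0)
    _ _ _ q4) => [y n|n|n].
  - have h1 := nphi_le y n; have h2 := nphi_le x n.
    have h : `|nphi y n - nphi x n| <= 2 * q ^+ l1 n by apply: le_trans (ler_normB _ _) _; lra.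
    rewrite normrX; apply: (@le_trans _ _ ((2 * q ^+ l1 n) ^+ 2)).
      by apply: lerXn2r; rewrite ?nnegrE // mulr_ge0 // exprn_ge0 // ltW.
    have p0 : 0 <= q ^+ l1 n by apply: exprn_ge0; apply: ltW.
    have p1 : q ^+ l1 n <= 1 by rewrite exprn_ile1 // ltW.
    nra.
  - by rewrite normr0 mulr_ge0 // exprn_ge0 // ltW.
  - have h : nphi y n - nphi x n @[y --> x] --> (0 : R).
      rewrite -[X in _ --> X](subrr (nphi x n)).
      by apply: cvgB; [exact: nphi_continuous|exact: cvg_cst].
    have h2 := cvgM h h; rewrite mulr0 in h2; exact: h2.
rewrite rsum0 in c0; move/cvgrPdist_lt : c0 => /(_ (e ^+ 2)); rewrite exprn_gt0 // => /(_ isT).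
apply: filterS => y; rewrite sub0r normrN => h.
have -> : eigenfunction y - eigenfunction x = fun n => (nphi y n - nphi x n)%:C.
  by apply/funext => n; rewrite rmorphB.
rewrite l2norm_real; last first.
  apply: (@abs_summable_le _ _ _ (fun n => nphi y n + - 1 * nphi x n)).
    by move=> n; rewrite mulN1r.
  by apply: abs_summableD; [|apply: abs_summableZ]; apply: nphi_summable.
rewrite -[ltRHS]ger0_norm ?(ltW e0) // -sqrtr_sqr ltr_sqrt ?exprn_gt0 //.
exact: le_lt_trans (ler_norm _) h.
Qed.

Lemma eigenfunction_ell2 x : ell2 (eigenfunction x).
Proof. exact/abs_summable_ell2/nphi_summable. Qed.

(* Off the countable set of irregular orbits the eigenfunction is norm continuous,
   so preimages of open sets are open up to countable sets. *)
Lemma eigenfunction_measurable : l2measurable eigenfunction.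
Proof.
move=> U oU; set A := _ @^-1` U.
have [alpha hf] := f_holder.
have -> : A = interior A `|` (A `&` ~` regular_orbit f w).
  apply/seteqP; split=> [x Ax|x [/interior_subset //|[]//]].
  have [hx|hx] := pselect (regular_orbit f w x); last by right.
  left; have [r r0 hr] := oU _ (eigenfunction_ell2 x) Ax.
  apply: filterS (eigenfunction_continuous hx r0) => y; apply: hr; exact: eigenfunction_ell2.
apply: measurableU; first by apply: measurable_realfun.open_measurable; apply: open_interior.
apply: countable_measurable; first by move=> t; apply: measurable_set1.
apply: (sub_countable _ (irregular_countable w hf)).
by apply: subset_card_le => x [].
Qed.

Let orbit_summable x n := g_summable (orbit_family_close x) n.

Lemma orbit_eigeneq x n :
  eigeneq f w eps x (E (x - idot n w)) (l2shift n (eigenfunction (x - idot n w))).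
Proof.
case: (orbit_family_sol x n) => [[r -> sol]|[-> Vn gE]].
  exact: real_sol_eigeneq (orbit_summable x n) sol.
exists (- n), 1; split=> //; rewrite scale1r; apply/funext => m.
rewrite /l2shift /eigenfunction (gE m : nphi _ (n + m) = _) /basisv.
by rewrite (rmorph_nat (real_complex R)).
Qed.

Lemma orbit_eigenvector x n :
  eigenvector f w eps x (E (x - idot n w)) (l2shift n (eigenfunction (x - idot n w))).
Proof.
split; first exact: orbit_eigeneq.
move=> u0; have := orbit_family_norm x n.
rewrite (_ : (fun m => _) = fun=> 0); first by rewrite rsum0 => /esym/eqP; rewrite oner_eq0.
apply/funext => m; have := congr1 (fun u => complex.Re (u m)) u0.
by rewrite /orbit_family => /= ->; rewrite expr0n.
Qed.

Lemma orbit_ell2 x n : ell2 (l2shift n (eigenfunction (x - idot n w))).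
Proof. exact: abs_summable_ell2 (orbit_summable x n). Qed.

Lemma orbit_orthonormal_basis x :
  orthonormal_basis (fun n => l2shift n (eigenfunction (x - idot n w))).
Proof.
split=> [n|n m|]; first exact: orbit_ell2.
  rewrite (l2dot_real (orbit_family x n) (orbit_family x m)).
  rewrite (family_orthonormal (orbit_family_close x) (@E_orbit_inj x) (orbit_family_sol x)
    (orbit_family_norm x)).
  by rewrite (rmorph_nat (real_complex R)).
apply: (localized_family_total (orbit_family_close x)) => n; first exact: orbit_ell2.
by exists n.
Qed.

Lemma orbit_pure_point x : pure_point f w eps x.
Proof.
apply: (localized_family_total (orbit_family_close x)) => n; first exact: orbit_ell2.
by exists (E (x - idot n w)); apply: orbit_eigenvector.
Qed.

Lemma orbit_simple_spectrum x : simple_spectrum f w eps x.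
Proof.
apply: simple_spectrum_real => [n m|r]; first exact: singular_unique.
exact: (family_simple (orbit_family_close x) (@E_orbit_inj x) (orbit_family_sol x)
  (orbit_family_norm x) r).
Qed.

Lemma eigenfunction_eigeneq x : eigeneq f w eps x (E x) (eigenfunction x).
Proof.
have := orbit_eigeneq x 0; rewrite idot0 subr0.
by rewrite (_ : l2shift 0 _ = eigenfunction x) //; apply/funext => n; rewrite /l2shift add0r.
Qed.

Lemma eigenfunction_norm x : l2norm (eigenfunction x) = 1.
Proof. by rewrite (l2norm_real (nphi_summable x)) nphi_norm sqrtr1. Qed.

Lemma eigenfunction_0 x : cabs (eigenfunction x 0 - 1) <= q ^+ 2 *+ (4 * d).
Proof.
have -> : eigenfunction x 0 - 1 = (nphi x 0 - 1)%:C by rewrite rmorphB rmorph1.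
by rewrite cabs_real nphi_0.
Qed.

Lemma eigenfunction_decay x n : cabs (eigenfunction x n) <= q ^+ l1 n.
Proof. by rewrite cabs_real nphi_le. Qed.

Lemma eigenfunction_per x : eigenfunction (x + 1) = eigenfunction x.
Proof. by rewrite /eigenfunction /nphi /mass phi_per. Qed.

End Eigenfunctions.

Theorem corollary1p2 (R : realType) (d : nat) (alpha delta rho mu : R)
  (hd : (1 <= d)%N) (halpha : 1 <= alpha) (hdelta0 : 0 < delta)
  (hdelta1 : delta < 1) (hrho : 0 < rho) (hmu : 0 < mu) :
  exists2 eps0 : R, 0 < eps0 &
  forall eps : R, 0 < eps -> eps < eps0 ->
  forall w : 'rV[R]_d, Omega rho mu w ->
  forall f : R -> \bar R, holder_monotone alpha f ->
  exists (E : R -> \bar R) (psi : R -> 'rV[int]_d -> R[i]),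
    [/\ forall x, (E x < +oo)%E,
        forall x, E (x + 1) = E x
      & forall x y, 0 <= x -> x < y -> y < 1 -> (E x < E y)%E] /\
    [/\ forall x, ell2 (psi x),
        forall x, psi (x + 1) = psi x
      & l2measurable psi] /\
    (forall x,
      [/\ eigeneq f w eps x (E x) (psi x),
          l2norm (psi x) = 1,
          cabs (psi x 0 - 1) < eps `^ (1 - delta)
        & forall n, n != 0 ->
            cabs (psi x n) <= eps `^ ((1 - delta) * (l1 n)%:R)]) /\
    (forall x n,
      eigeneq f w eps x (E (x - idot n w)) (l2shift n (psi (x - idot n w)))) /\
    (forall x,
      orthonormal_basis (fun n => l2shift n (psi (x - idot n w))) /\
      forall n, eigenvector f w eps x (E (x - idot n w))
                  (l2shift n (psi (x - idot n w)))) /\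
    (forall x, pure_point f w eps x /\ simple_spectrum f w eps x) /\
    (forall x n m, m != - n ->
      cabs (l2shift n (psi (x - idot n w)) m)
        <= eps `^ ((1 - delta) * (l1 (n + m))%:R)).
Proof.
exists (eps0c d alpha delta rho mu); first exact: eps0c_gt0.
move=> eps eps_gt0 eps_lt w hw f hf.
have [E [phi [[E_lt E_per E_mono phi_per] E_sol]]] :=
  infinite_volume hd halpha hdelta0 hdelta1 hrho hmu eps_gt0 eps_lt hw hf.
have [_ _ f_int _] := hf.
have q0 := q_gt0 delta eps.
have qs := q_le hd halpha hdelta0 hdelta1 hrho hmu eps_gt0 eps_lt.
have q1 := q_le1 halpha hdelta0 hdelta1 hrho hmu eps_gt0 eps_lt.
have decay := q_powR halpha hdelta0 hrho hmu eps_gt0 eps_lt.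
have E_sing x := (E_sol x).1; have E_fin x := (E_sol x).2.
exists E, (eigenfunction phi); split; first by [].
split; first split.
- move=> x; exact: (eigenfunction_ell2 q0 qs q1 E_sing E_fin).
- exact: eigenfunction_per.
- apply: (eigenfunction_measurable q0 qs q1 hrho hmu hw E_per E_mono E_sing E_fin).
  by exists alpha.
split.
  move=> x; split.
  - exact: (eigenfunction_eigeneq q0 qs q1 E_sing E_fin).
  - exact: (eigenfunction_norm q0 qs q1 E_sing E_fin).
  - apply: le_lt_trans (q2_powR hd halpha hdelta0 hrho hmu eps_gt0 eps_lt).
    exact: (eigenfunction_0 q0 qs q1 E_sing E_fin).
  - move=> n _; apply: le_trans (decay _).
    exact: (eigenfunction_decay q0 qs q1 E_sing E_fin).
split; first by move=> x n; exact: (orbit_eigeneq q0 qs q1 E_sing E_fin).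
split.
  move=> x; split; first exact: (orbit_orthonormal_basis q0 qs q1 hrho hmu hw E_per E_mono E_sing E_fin).
  by move=> n; exact: (orbit_eigenvector q0 qs q1 E_sing E_fin).
split.
  move=> x; split; first exact: (orbit_pure_point q0 qs q1 E_sing E_fin).
  exact: (orbit_simple_spectrum q0 qs q1 hrho hmu hw f_int E_per E_mono E_sing E_fin).
move=> x n m _; apply: le_trans (decay _).
exact: (eigenfunction_decay q0 qs q1 E_sing E_fin).
Qed.
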